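(* Let $\boldsymbol X$ be a graphical model on a connected decomposable (chordal) graph $\mathcal G=(V,E)$, $V=\{1,\dots,d\}$, with standard Fréchet$(1)$ marginal distributions, admitting a Lebesgue density $f_{\boldsymbol X}$ on $\mathbb R_+^d$. Let $C_1,\dots,C_N$ be the maximal cliques of $\mathcal G$ in a running intersection ordering, with separators $S_2,\dots,S_N$. Suppose that for every clique $C_i$ of $\mathcal G$, $\boldsymbol X_{C_i}$ is multivariate regularly varying on $\mathbb E^{C_i}$ with limit measure $\nu^{(C_i)}$ satisfying (i) $\nu^{(C_i)}\big(\mathbb E^{C_i}\setminus\mathbb E^{C_i}_{C_i}\big)=0$; (ii) the exponent measure $\Lambda^{(C_i)}(\boldsymbol y_{C_i})=\nu^{(C_i)}([\boldsymbol 0,\boldsymbol y_{C_i}]^c)$ is absolutely continuous with respect to Lebesgue measure on $\mathbb E^{C_i}$ with density $\lambda^{(C_i)}$, in the sense that $\Lambda^{(C_i)}(\boldsymbol y_{C_i})=\int\lambda^{(C_i)}(\boldsymbol x_{C_i})\,I(\boldsymbol x_{C_i}\in[\boldsymbol 0,\boldsymbol y_{C_i}]^c)\,d\boldsymbol x_{C_i}$. Assume further that as $n\to\infty$ $$n^{|C_i|+1}f_{\boldsymbol X_{C_i}}(n\,\boldsymbol x_{C_i})\to\lambda^{(C_i)}(\boldsymbol x_{C_i}),\qquad i=1,\dots,N,$$ outside a set of Lebesgue measure zero. Then $F_{\boldsymbol X}$ belongs to the domain of attraction of a max-stable distribution (equivalently, $F_{\boldsymbol X}$ belongs to the domain of attraction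 of a multivariate Pareto distribution). The exponent measure $\Lambda$ of the limit multivariate max-stable and multivariate Pareto distribution is absolutely continuous with respect to Lebesgue measure on $\mathbb E$ and has density $$\lambda(\boldsymbol y)=\lambda^{(C_1)}(\boldsymbol y_{C_1})\prod_{i=2}^N\frac{\lambda^{(C_i)}(\boldsymbol y_{C_i})}{\lambda^{(S_i)}(\boldsymbol y_{S_i})},$$ where, for $A$ a clique $C_i$ or a separator $S_i$, $\lambda^{(A)}(\boldsymbol y_A)=\lVert\boldsymbol y_A\rVert^{-(|A|+1)}\,h^A(\boldsymbol y_A/\lVert\boldsymbol y_A\rVert)$, $\boldsymbol y_A\in\mathbb E^A$, and $h^A(\boldsymbol\omega_A)$, $\boldsymbol\omega_A\in\mathbb S_{|A|-1}$, is the density of the spectral measure $H^A$ associated with the limit measure $\nu^{(A)}$ of $\boldsymbol X_A$.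
   Context: **Notation.** For $\emptyset\ne A\subseteq V$: $\boldsymbol x_A=(x_u:u\in A)$, $\mathbb E^A=[0,\infty)^A\setminus\{\boldsymbol 0\}$, $\mathbb E=\mathbb E^V$, and for $\emptyset\neq B\subseteq A$, $\mathbb E^A_B=\{\boldsymbol x\in\mathbb E^A:\boldsymbol x_B>\boldsymbol 0,\ \boldsymbol x_{A\setminus B}=\boldsymbol 0\}$ with $\boldsymbol x_B>\boldsymbol 0$ componentwise; so $\mathbb E^A_A$ is the interior. Complements $[\boldsymbol0,\boldsymbol y]^c$ are taken in the non-negative orthant. $f_{\boldsymbol X_A}$ is the Lebesgue density of $\boldsymbol X_A$, $F_{\boldsymbol X}$ the distribution function of $\boldsymbol X$, $I$ the indicator. Standard Fréchet$(1)$ margins: $\mathbb P(X_u\le x)=\exp(-1/x)$, $x>0$, for all $u\in V$. **Graphs.** Graphs are finite, undirected, without loops or parallel edges. A graph is decomposable (chordal) if every cycle of length at least four has an edge joining two non-consecutive vertices of the cycle. The maximal cliques of a connected chordal graph can be ordered $C_1,\dots,C_N$ so that for $i=2,\dots,N$, $S_i:=C_i\cap(\bigcup_{j<i}C_j)\subset C_k$ for some $k<i$ (running intersection). ''Clique'' means maximal clique. $\boldsymbol X$ is a graphical model on $\mathcal G$ if $X_i$ and $X_j$ are conditionally independent given $\boldsymbol X_{V\setminus\{i,j\}}$ for all $i\neq j$ with $(i,j)\notin E$; its density is taken to factorize as $f_{\boldsymbol X}(\boldsymbol x)=\prod_{i=1}^Nf_{\boldsymbol X_{C_i}}(\boldsymbol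 x_{C_i})/\prod_{i=2}^Nf_{\boldsymbol X_{S_i}}(\boldsymbol x_{S_i})$. **Multivariate regular variation.** In these margins $\boldsymbol X_A$ is multivariate regularly varying with limit measure $\nu^{(A)}$ if $t\,\mathbb P(\boldsymbol X_A/t\in B)\to\nu^{(A)}(B)$ as $t\to\infty$ for all Borel sets $B$ that are relatively compact in $[0,\infty]^A\setminus\{\boldsymbol 0\}$ (i.e. bounded away from $\boldsymbol 0$) with $\nu^{(A)}(\partial B)=0$; then $\nu^{(A)}$ is homogeneous of order $-1$. Given a norm $\lVert\cdot\rVert$, $\mathbb S_{|A|-1}=\{\boldsymbol w\in\mathbb R_+^{A}:\lVert\boldsymbol w\rVert=1\}$, and the spectral measure $H^A$ is normalized by $\nu^{(A)}(\{\boldsymbol x:\lVert\boldsymbol x\rVert>r,\ \boldsymbol x/\lVert\boldsymbol x\rVert\in B\})=r^{-1}H^A(B)$, $r>0$. Its density $h^A$ is with respect to the measure $\sigma$ on $\mathbb S_{|A|-1}$ for which Lebesgue measure on the orthant is $r^{|A|-1}\,dr\,\sigma(d\boldsymbol\omega)$ in the coordinates $r=\lVert\boldsymbol x\rVert$, $\boldsymbol\omega=\boldsymbol x/\lVert\boldsymbol x\rVert$. For a separator $S_i$, contained in a clique, $\nu^{(S_i)}$ is the limit measure of $\boldsymbol X_{S_i}$. **Domains of attraction.** $F_{\boldsymbol X}$ is in the domain of attraction of a max-stable distribution with exponent measure $\Lambda$ if, for $\boldsymbol M_n$ the vector of componentwise maxima of $n$ i.i.d. copies of $\boldsymbol X$,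 $\mathbb P(\boldsymbol M_n\le n\boldsymbol y)\to\exp\{-\Lambda(\boldsymbol y)\}$ at continuity points $\boldsymbol y\in\mathbb E$ of the limit. It is in the domain of attraction of a multivariate Pareto distribution with exponent measure $\Lambda$ if $\mathbb P(\boldsymbol X\le t\boldsymbol y\mid\lVert\boldsymbol X\rVert_\infty>t)\to\{\Lambda(\boldsymbol y\wedge\boldsymbol 1)-\Lambda(\boldsymbol y)\}/\Lambda(\boldsymbol 1)$ as $t\to\infty$ at continuity points of the limit. $\Lambda$ has density $\lambda$ if $\Lambda(\boldsymbol y)=\int_{[\boldsymbol 0,\boldsymbol y]^c}\lambda(\boldsymbol x)\,d\boldsymbol x$. *)

(* Defs.v *)
From HB Require Import structures.
From mathcomp Require Import all_boot all_order all_algebra.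

Set Implicit Arguments.
Unset Strict Implicit.
Unset Printing Implicit Defensive.

Section graphs.
Variables (V : finType) (e : rel V).

Definition connected_graph := forall u v, connect e u v.

Definition chordal := forall c : seq V, (4 <= size c)%N -> ucycle e c ->
  exists x y, [/\ x \in c, y \in c, e x y, y != next c x & x != next c y].

Definition is_clique (A : {set V}) :=
  [forall x in A, forall y in A, (x != y) ==> e x y].

Definition max_clique (A : {set V}) := maxset is_clique A.

End graphs.

Section cliques.
Variables (V : finType) (N : nat) (C : 'I_N.+1 -> {set V}).

(* S_i; meaningful for i != ord0 only *)
Definition separator (i : 'I_N.+1) : {set V} :=
  C i :&: \bigcup_(j < N.+1 | (j < i)%N) C j.

Definition running_intersection := forall i : 'I_N.+1, (0 < i)%N ->
  exists2 k : 'I_N.+1, (k < i)%N & separator i \subset C k.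

Definition clique_or_separator (A : {set V}) :=
  (exists i, A = C i) \/ (exists2 i : 'I_N.+1, (0 < i)%N & A = separator i).

End cliques.

From mathcomp Require Import all_classical all_reals all_analysis.
Import Order.TTheory GRing.Theory Num.Theory.
Import numFieldNormedType.Exports.

Local Open Scope classical_set_scope.
Local Open Scope ring_scope.

(* The product sigma-algebra on 'rV[T]_n, as the library does for n.-tuple T;
   for T = R it is the Borel sigma-algebra of R^n. *)
Definition measure_rV_display : measure_display -> measure_display.
Proof. exact. Qed.

Section measurable_rV.
Context {d} {T : measurableType d}.
Variable n : nat.

Let coors : 'I_n -> 'rV[T]_n -> T := fun i x => x ord0 i.

Let rV_set0 : g_sigma_preimage coors set0.
Proof. exact: sigma_algebra0. Qed.

Let rV_setC A : g_sigma_preimage coors A -> g_sigma_preimage coors (~` A).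
Proof. exact: sigma_algebraC. Qed.

Let rV_bigcup (F : _^nat) : (forall i, g_sigma_preimage coors (F i)) ->
  g_sigma_preimage coors (\bigcup_i (F i)).
Proof. exact: sigma_algebra_bigcup. Qed.

HB.instance Definition _ := @isMeasurable.Build (measure_rV_display d)
  'rV[T]_n (g_sigma_preimage coors) rV_set0 rV_setC rV_bigcup.

End measurable_rV.


(* Lebesgue measure on R^n: a point mass for n = 0, and for n.+1 the product of
   the Lebesgue measures on R and on R^n. *)
Section lebesgue_rV.
Variable R : realType.
Local Open Scope ereal_scope.

Lemma measurable_coord n (i : 'I_n) :
  measurable_fun [set: 'rV[R]_n] (fun x : 'rV[R]_n => x ord0 i).
Proof.
move=> _ Y mY; rewrite setTI; apply: sub_sigma_algebra => /=.
rewrite -bigcup_seq/=; exists i => /=; first by rewrite mem_index_enum.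
by exists Y => //; rewrite setTI.
Qed.

Lemma measurable_fun_coordP d (T : measurableType d) n (f : T -> 'rV[R]_n) :
  (forall i, measurable_fun [set: T] (fun w => f w ord0 i)) ->
  measurable_fun [set: T] f.
Proof.
move=> mf _ Y mY.
have : g_sigma_preimage (fun (i : 'I_n) w => f w ord0 i) `<=` measurable.
  apply: smallest_sub; first exact: sigma_algebra_measurable.
  case: n => [|n] in f mf Y mY *; first by rewrite big_ord0.
  rewrite -bigcup_mkord_ord; apply: bigcup_sub => i Ii.
  by move=> A [B mB <-]; exact: mf.
apply; rewrite (@g_sigma_preimage_comp _ _ _ _
  (fun (i : 'I_n) (x : 'rV[R]_n) => x ord0 i) _ f).
by exists Y.
Qed.

Definition rV_cons n (p : measurableTypeR R * 'rV[R]_n) : 'rV[R]_n.+1 :=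
  @row_mx R 1 1 n ((p.1 : R)%:M) p.2.

Lemma rV_cons0 n p : @rV_cons n p ord0 ord0 = p.1.
Proof.
have := row_mxEl ((p.1 : R)%:M : 'rV_1) p.2 ord0 ord0.
by rewrite [RHS]mxE eqxx mulr1n (_ : lshift n ord0 = ord0); last exact: val_inj.
Qed.

Lemma rV_consS n p (j : 'I_n) : @rV_cons n p ord0 (lift ord0 j) = p.2 ord0 j.
Proof.
have := row_mxEr ((p.1 : R)%:M : 'rV_1) p.2 ord0 j.
by rewrite (_ : rshift 1 j = lift ord0 j); last exact: val_inj.
Qed.

Lemma measurable_rV_cons n :
  measurable_fun [set: measurableTypeR R * 'rV[R]_n] (@rV_cons n).
Proof.
apply: measurable_fun_coordP => i; case: (unliftP ord0 i) => [j|] ->.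
  under eq_fun do rewrite rV_consS.
  exact: (measurableT_comp (measurable_coord j) measurable_snd).
under eq_fun do rewrite rV_cons0.
exact: measurable_fst.
Qed.

HB.instance Definition _ n := isMeasurableFun.Build _ _ _ _ (@rV_cons n)
  (@measurable_rV_cons n).

Section step.
Variables (n : nat) (m : {sigma_finite_measure set 'rV[R]_n -> \bar R}).

Definition rV_cons_measure : set 'rV[R]_n.+1 -> \bar R :=
  pushforward (@lebesgue_measure R \x m) (@rV_cons n).

Let step0 : rV_cons_measure set0 = 0.
Proof. by rewrite /rV_cons_measure /pushforward preimage_set0 measure0. Qed.

Let step_ge0 A : 0 <= rV_cons_measure A.
Proof. exact: measure_ge0. Qed.

Let step_sigma_additive : semi_sigma_additive rV_cons_measure.
Proof.
by apply: measure_semi_sigma_additive; exact: measurable_rV_cons.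
Qed.

HB.instance Definition _ := isMeasure.Build _ _ _ rV_cons_measure
  step0 step_ge0 step_sigma_additive.

Let rV_cons_measure_sigma_finite : sigma_finite setT rV_cons_measure.
Proof.
have /sigma_finiteP[F [FT ndF Foo]] := sigma_finiteT (@lebesgue_measure R).
have /sigma_finiteP[G [GT ndG Goo]] := sigma_finiteT m.
pose g (x : 'rV[R]_n.+1) : measurableTypeR R * 'rV[R]_n :=
  (x ord0 ord0, \row_j x ord0 (lift ord0 j)).
have mg : measurable_fun setT g.
  apply/measurable_fun_pairP; split; first exact: measurable_coord.
  apply: measurable_fun_coordP => j.
  under eq_fun do rewrite mxE.
  exact: measurable_coord.
have gK p : g (rV_cons p) = p.
  rewrite /g rV_cons0 [RHS]surjective_pairing; congr pair.
  by apply/rowP => j; rewrite mxE rV_consS.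
exists (fun k => g @^-1` (F k `*` G k)).
  apply/seteqP; split=> // x _.
  have [i _ Fi] : (\bigcup_i F i) (g x).1 by rewrite -FT.
  have [j _ Gj] : (\bigcup_j G j) (g x).2 by rewrite -GT.
  exists (maxn i j) => //; split.
  - by move: Fi; exact/subsetPset/ndF/leq_maxl.
  - by move: Gj; exact/subsetPset/ndG/leq_maxr.
move=> k; have [mF Fk] := Foo k; have [mG Gk] := Goo k; split.
  by rewrite -[X in measurable X]setTI; apply: mg => //; exact: measurableX.
rewrite /rV_cons_measure /pushforward -comp_preimage.
rewrite (_ : g \o _ = idfun) ?preimage_id; last exact/funext.
by rewrite product_measure1E// lte_mul_pinfty// ge0_fin_numE.
Qed.

HB.instance Definition _ := Measure_isSigmaFinite.Build _ _ _ rV_cons_measure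
  rV_cons_measure_sigma_finite.

End step.

Fixpoint lebesgue_rV n : {sigma_finite_measure set 'rV[R]_n -> \bar R} :=
  if n is n'.+1 then rV_cons_measure (lebesgue_rV n')
  else \d_(0%R : 'rV[R]_0).

End lebesgue_rV.
Arguments lebesgue_rV {R} n.

Section euclidean.
Variables (R : realType) (n : nat).
Implicit Types (x y : 'rV[R]_n) (B : set 'rV[R]_n).

Definition orthant : set 'rV[R]_n := [set x | forall j, 0 <= x ord0 j].

(* the space E *)
Definition punctured : set 'rV[R]_n := orthant `\ 0.

(* the face of E on which every coordinate is positive *)
Definition open_face : set 'rV[R]_n := [set x | forall j, 0 < x ord0 j].

Definition rV_le x y := forall j, x ord0 j <= y ord0 j.

Definition rV_min x y : 'rV[R]_n := \row_j Num.min (x ord0 j) (y ord0 j).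

(* the complement of [0, y] in the orthant *)
Definition box_compl y : set 'rV[R]_n := orthant `\` [set x | rV_le x y].

(* Borel subsets of the orthant whose closure in the compactified orthant
   misses the origin *)
Definition bounded_away B :=
  [/\ measurable B, B `<=` orthant & ~ closure B 0].

(* The boundary relative to the orthant: the coordinate hyperplanes do not
   count. *)
Definition boundary B : set 'rV[R]_n :=
  closure B `&` closure (orthant `\` B).

Definition is_norm (N : 'rV[R]_n -> R) :=
  [/\ forall x, 0 <= N x, forall x, N x = 0 -> x = 0,
      forall x y, N (x + y) <= N x + N y &
      forall (a : R) x, N (a *: x) = `|a| * N x].

End euclidean.
Arguments orthant {R} n.
Arguments punctured {R} n.
Arguments open_face {R} n.

Section exponent_measures.
Variables (R : realType) (n : nat).
Implicit Types (nu mu sigma H : {measure set 'rV[R]_n -> \bar R}).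
Implicit Types (nrm lam h : 'rV[R]_n -> R).

Definition radon_on_punctured nu :=
  nu (~` punctured n) = 0%E /\ forall B, bounded_away B -> (nu B < +oo)%E.

Definition homogeneous nu := forall (t : R) (B : set 'rV[R]_n),
  0 < t -> measurable B -> nu [set t *: x | x in B] = ((t^-1)%:E * nu B)%E.

(* y |-> exp(- nu (box_compl y)) is then max-stable on E. *)
Definition exponent_measure nu := radon_on_punctured nu /\ homogeneous nu.

Definition exponent_fun nu (y : 'rV[R]_n) : \bar R := nu (box_compl y).

Definition has_exponent_density nu lam :=
  [/\ measurable_fun (punctured n) lam,
      forall x, punctured n x -> 0 <= lam x &
      forall y, punctured n y ->
        exponent_fun nu y = (\int[lebesgue_rV n]_(x in box_compl y) (lam x)%:E)%E].

Definition sphere nrm : set 'rV[R]_n := [set w | orthant n w /\ nrm w = 1].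

(* sigma is the measure on the sphere for which Lebesgue measure on the orthant
   is r^(n-1) dr sigma(dw) in polar coordinates. *)
Definition polar_measure nrm sigma :=
  sigma (~` sphere nrm) = 0%E /\
  forall B, measurable B -> B `<=` orthant n ->
    lebesgue_rV n B =
    (\int[@lebesgue_measure R]_(r in `]0%R, +oo[)
       ((r ^+ n.-1)%:E * sigma [set w | B (r *: w)]))%E.

Definition spectral_measure nrm nu H :=
  H (~` sphere nrm) = 0%E /\
  forall (r : R) B, 0 < r -> measurable B -> B `<=` sphere nrm ->
    nu [set x | r < nrm x /\ B ((nrm x)^-1 *: x)] = ((r^-1)%:E * H B)%E.

Definition spectral_density nrm sigma H h :=
  [/\ measurable_fun (sphere nrm) h,
      forall w, sphere nrm w -> 0 <= h w &
      forall B, measurable B -> B `<=` sphere nrm ->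
        H B = (\int[sigma]_(w in B) (h w)%:E)%E].

Definition radial_density nrm h (y : 'rV[R]_n) : R :=
  nrm y ^- n.+1 * h ((nrm y)^-1 *: y).

End exponent_measures.

Section random_vectors.
Variables (R : realType) (dT : measure_display) (T : measurableType dT).
Variable P : probability T R.

(* Only the values of f on the orthant matter: Y is a non-negative vector. *)
Definition has_density n (Y : T -> 'rV[R]_n) (f : 'rV[R]_n -> R) :=
  [/\ measurable_fun (orthant n) f, forall x, orthant n x -> 0 <= f x &
      forall B, measurable B ->
        P (Y @^-1` B) =
        (\int[lebesgue_rV n]_(x in B `&` orthant n) (f x)%:E)%E].

(* g is a version of P(A | Y = .) *)
Definition cond_probability m (A : set T) (Y : T -> 'rV[R]_m)
    (g : 'rV[R]_m -> R) :=
  [/\ measurable_fun setT g, forall y, 0 <= g y &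
      forall D, measurable D ->
        P (A `&` Y @^-1` D) = (\int[P]_(w in Y @^-1` D) (g (Y w))%:E)%E].

Definition cond_independent m (Y1 Y2 : T -> R) (Z : T -> 'rV[R]_m) :=
  forall B1 B2 : set R, measurable B1 -> measurable B2 ->
  exists g1 g2, [/\ cond_probability (Y1 @^-1` B1) Z g1,
    cond_probability (Y2 @^-1` B2) Z g2 &
    cond_probability (Y1 @^-1` B1 `&` Y2 @^-1` B2) Z (fun z => g1 z * g2 z)].

(* Points of [0, +oo]^n with an infinite coordinate carry no mass on either
   side, so B ranges over subsets of [0, +oo[^n. *)
Definition regularly_varying n (Y : T -> 'rV[R]_n)
    (nu : {measure set 'rV[R]_n -> \bar R}) :=
  radon_on_punctured nu /\
  forall B, bounded_away B -> nu (boundary B) = 0%E ->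
    (fun t : R => t%:E * P [set w | B (t^-1 *: Y w)])%E @ +oo%R --> nu B.

Section attraction.
Variables (n : nat) (X : {RV P >-> 'rV[R]_n}).
Variable Lambda : {measure set 'rV[R]_n -> \bar R}.

Definition iid_copies d' (T' : measurableType d') (P' : probability T' R)
    (Y : nat -> {RV P' >-> 'rV[R]_n}) :=
  (forall k B, measurable B -> P' (Y k @^-1` B) = P (X @^-1` B)) /\
  (forall (s : seq nat) (B : nat -> set 'rV[R]_n), uniq s ->
    (forall k, measurable (B k)) ->
    P' (\bigcap_(k in [set` s]) (Y k @^-1` B k)) =
    (\prod_(k <- s) P' (Y k @^-1` B k))%E).

(* M_m, for m > 0 *)
Definition componentwise_max (T' : Type) (Y : nat -> T' -> 'rV[R]_n) (m : nat)
    (w : T') : 'rV[R]_n :=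
  \row_j \big[Num.max/Y 0%N w ord0 j]_(k < m) Y k w ord0 j.

Definition attracted_max_stable :=
  let G y := expeR (- exponent_fun Lambda y)%E in
  forall d' (T' : measurableType d') (P' : probability T' R)
    (Y : nat -> {RV P' >-> 'rV[R]_n}), iid_copies Y ->
  forall y, punctured n y ->
  G z @[z --> within (punctured n) (nbhs y)] --> G y ->
  P' [set w | rV_le (componentwise_max Y m w) (m%:R *: y)] @[m --> \oo] --> G y.

Definition cond_prob (A B : set T) : R := fine (P (A `&` B)) / fine (P B).

Definition pareto_fun (y : 'rV[R]_n) : R :=
  (fine (exponent_fun Lambda (rV_min y (const_mx 1%R))) -
   fine (exponent_fun Lambda y)) / fine (exponent_fun Lambda (const_mx 1%R)).

(* The norm of 'rV[R]_n is the sup norm. When Lambda(y /\ 1) is infinite so is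
   Lambda(y), and the limit is not defined. *)
Definition attracted_pareto :=
  forall y, punctured n y ->
  (exponent_fun Lambda (rV_min y (const_mx 1%R)) < +oo)%E ->
  pareto_fun z @[z --> within (punctured n) (nbhs y)] --> pareto_fun y ->
  cond_prob [set w | rV_le (X w) (t *: y)] [set w | t < `|X w|]
    @[t --> +oo%R] --> pareto_fun y.

End attraction.
End random_vectors.

Section graphical_models.
Variables (R : realType) (d : nat).

Definition sub_rV (A : {set 'I_d}) (x : 'rV[R]_d) : 'rV[R]_#|A| :=
  \row_j x ord0 (enum_val j).

Definition pairwise_markov dT (T : measurableType dT) (P : probability T R)
    (e : rel 'I_d) (X : T -> 'rV[R]_d) :=
  forall i j, i != j -> ~~ e i j ->
    cond_independent P (fun w => X w ord0 i) (fun w => X w ord0 j)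
      (sub_rV (~: [set i; j]%SET) \o X).

(* prod_i g_{C_i}(x_{C_i}) / prod_{i >= 2} g_{S_i}(x_{S_i}), where x / 0 = 0 *)
Definition clique_product N (C : 'I_N.+1 -> {set 'I_d})
    (g : forall A : {set 'I_d}, 'rV[R]_#|A| -> R) (x : 'rV[R]_d) : R :=
  (\prod_(i < N.+1) g (C i) (sub_rV (C i) x)) /
  (\prod_(i < N.+1 | (0 < i)%N) g (separator C i) (sub_rV (separator C i) x)).

End graphical_models.

(* Main.v *)
Require Import Defs.
From HB Require Import structures.
From mathcomp Require Import all_boot all_order all_algebra.
From mathcomp Require Import all_classical all_reals all_analysis measurable_realfun.
From mathcomp Require Import ring lra.
Import Order.TTheory GRing.Theory Num.Theory.
Import numFieldNormedType.Exports.

Set Implicit Arguments.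
Unset Strict Implicit.
Unset Printing Implicit Defensive.

Local Open Scope classical_set_scope.
Local Open Scope ring_scope.
Local Opaque integral.

(* The factorization of the density passes to the limit pointwise; what has to
   be shown is that no mass is lost.  On a corner {x | every x_v > eps},
   Scheffe's lemma turns pointwise convergence and regular variation into L1
   convergence of the rescaled clique densities n^(|C|+1) f_C(n x), and, by
   integration, of the rescaled separator densities.  The product is then
   treated one clique at a time along the running intersection order: replacing
   a b / c by a' b' / c' costs at most |a - a'| + |b - b'| + |c - c'| in L1 as
   soon as the marginals of a and b' on the separator are at most c and c'.  The
   powers of n match because sum |C_i| - sum |S_i| = d.

   Off the corners, n P(X_u > n delta, X_v <= n eps) is small for small eps: inside
   a clique because the limit measure charges no hyperplane, and along the paths
   of the connected graph by transitivity.  Hence n P(X / n in [0, y]^c) tends to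
   the integral of lambda over [0, y]^c for every y > 0, and both domains of
   attraction follow.

   The limit measure of a separator is a projection of that of a clique.  Its
   density is homogeneous almost everywhere by Fubini, hence is almost everywhere
   of the form |x|^(-(n+1)) h(x/|x|), and the polar formula identifies h as the
   spectral density. *)

(** * Integration with respect to groups of coordinates *)

(** The limit densities have infinite mass near the origin, so an L1 comparison needs a cut, and a
    cut shared by all cliques must have product form: hence the corners. Cutting destroys the
    marginal identities. A clique density restricted to its own corner integrates to at most the cut
    separator density, which is why the chain asks for inequalities only. They are asked of the
    prelimit partial products, which inherit them from genuine densities, and of single limit
    cliques; no marginal of a product of limits enters. Separators come without a pointwise
    hypothesis. Their L1 convergence rests on the fact that integrating out coordinates contracts L1
    distance, applied where only the separator coordinates are cut.

    Vectors indexed by different vertex sets have different types. Densities are therefore pulled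
    back to functions of the whole vector, and a partial integral [Ints A F] is again such a
    function.

    The unit sphere is a null set, so the values of a density on it carry no information; the
    spectral density is recovered by averaging along rays. *)

Section coordinate_integrals.
Context {R : realType} {d : nat}.
Implicit Types (x : 'rV[R]_d) (u v : 'I_d) (s : seq 'I_d) (F G : 'rV[R]_d -> \bar R).
Local Notation mu := (@lebesgue_measure R).
Local Open Scope ereal_scope.

Definition upd x v (t : R) : 'rV[R]_d :=
  \row_j (if j == v then t else x ord0 j).

Lemma updE x v t j : upd x v t ord0 j = if j == v then t else x ord0 j.
Proof. by rewrite /upd mxE. Qed.

Lemma updC x u v t t' : u != v ->
  upd (upd x u t) v t' = upd (upd x v t') u t.
Proof.
move=> uv; apply/rowP => j; rewrite !updE.
by have [->|//] := eqVneq j v; rewrite eq_sym (negbTE uv).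
Qed.

Lemma measurable_upd v : measurable_fun [set: 'rV[R]_d * measurableTypeR R]
  (fun p => upd p.1 v p.2).
Proof.
apply: measurable_fun_coordP => j; under eq_fun do rewrite updE.
case: (j == v); first exact: measurable_snd.
exact: (measurableT_comp (measurable_coord j) measurable_fst).
Qed.

Lemma measurable_updr x v :
  measurable_fun [set: measurableTypeR R] (fun t => upd x v t).
Proof.
apply: measurable_fun_coordP => j; under eq_fun do rewrite updE.
by case: (j == v); [exact: measurable_id | exact: measurable_cst].
Qed.

(** The one-dimensional integral is locked so that nested integrals stay opaque to conversion;
    [int1E] opens it. *)
Fact int1_key : unit. Proof. by []. Qed.
Definition int1 := locked_with int1_key
  (fun v F x => \int[mu]_t F (upd x v t)).

Lemma int1E v F x : int1 v F x = \int[mu]_t F (upd x v t).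
Proof. by rewrite /int1 unlock. Qed.

Definition ints s F := foldr int1 F s.

Definition mge0 F := measurable_fun [set: 'rV[R]_d] F /\ forall x, 0 <= F x.

Lemma mge0_upd v F : mge0 F ->
  measurable_fun [set: 'rV[R]_d * measurableTypeR R] (fun p => F (upd p.1 v p.2)).
Proof. by move=> [mF _]; exact: (measurableT_comp mF (@measurable_upd v)). Qed.

Lemma mge0_updr v F x : mge0 F ->
  measurable_fun [set: measurableTypeR R] (fun t => F (upd x v t)).
Proof. by move=> [mF _]; exact: (measurableT_comp mF (@measurable_updr x v)). Qed.

Lemma mge0_int1 v F : mge0 F -> mge0 (int1 v F).
Proof.
move=> mF; split => [|x]; last by rewrite int1E; apply: integral_ge0 => t _; exact: mF.2.
rewrite (_ : int1 v F = fun x => \int[mu]_t F (upd x v t)); last first.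
  by apply/funext => x; rewrite int1E.
apply: (measurable_fun_fubini_tonelli_F (m2 := mu)
  (fun p : 'rV[R]_d * measurableTypeR R => F (upd p.1 v p.2))).
- exact: mge0_upd.
- by move=> ?; exact: mF.2.
Qed.

Lemma mge0_ints s F : mge0 F -> mge0 (ints s F).
Proof. by move=> mF; elim: s => [//|v s ih] /=; exact: mge0_int1. Qed.

Lemma int1C u v F : mge0 F -> int1 u (int1 v F) = int1 v (int1 u F).
Proof.
move=> mF; have [->//|uv] := eqVneq u v.
apply/funext => x; rewrite !int1E.
under eq_integral do rewrite int1E.
under [RHS]eq_integral do rewrite int1E.
pose H (p : measurableTypeR R * measurableTypeR R) := F (upd (upd x u p.1) v p.2).
have mH : measurable_fun setT H.
  have : measurable_fun [set: measurableTypeR R * measurableTypeR R]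
    (fun p => upd (upd x u p.1) v p.2).
    apply: measurable_fun_coordP => j; under eq_fun do rewrite !updE.
    case: (j == v); first exact: measurable_snd.
    by case: (j == u); [exact: measurable_fst | exact: measurable_cst].
  by move=> mU; apply: (measurableT_comp mF.1 mU).
have := fubini_tonelli (m1 := mu) (m2 := mu) H mH (fun p => mF.2 _).
rewrite /H /= => ->.
by apply: eq_integral => t _; apply: eq_integral => s _; rewrite updC.
Qed.

Lemma ints_cat s1 s2 F : ints (s1 ++ s2) F = ints s1 (ints s2 F).
Proof. by rewrite /ints foldr_cat. Qed.

Lemma ints_rem v s F : mge0 F -> v \in s -> ints s F = int1 v (ints (rem v s) F).
Proof.
move=> mF; elim: s => // w s ih /=; rewrite inE eq_sym.
have [->//|wv/= vs] := eqVneq w v.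
by rewrite ih// int1C//; exact: mge0_ints.
Qed.

(** By Tonelli the order of integration is irrelevant, which is what allows a finite set, enumerated
    in any order, to index an integral. *)
Lemma ints_perm s1 s2 F : mge0 F -> perm_eq s1 s2 -> ints s1 F = ints s2 F.
Proof.
move=> mF; elim: s1 s2 => [|v s1 ih] s2.
  by rewrite perm_sym => /perm_nilP ->.
move=> p; have vs2 : v \in s2 by rewrite -(perm_mem p) mem_head.
rewrite (ints_rem mF vs2) /= (ih (rem v s2))//.
by rewrite -(perm_cons v) (perm_trans p)// perm_to_rem.
Qed.

Lemma int1_le v F G : mge0 F -> mge0 G -> (forall x, F x <= G x) ->
  forall x, int1 v F x <= int1 v G x.
Proof.
move=> mF mG FG x; rewrite !int1E; apply: ge0_le_integral => //.
- by move=> t _; exact: mF.2.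
- exact: mge0_updr.
- exact: mge0_updr.
Qed.

Lemma ints_le s F G : mge0 F -> mge0 G -> (forall x, F x <= G x) ->
  forall x, ints s F x <= ints s G x.
Proof.
by move=> mF mG FG; elim: s => [//|v s ih] /=; apply: int1_le => //; exact: mge0_ints.
Qed.

Lemma mge0D F G : mge0 F -> mge0 G -> mge0 (fun x => F x + G x).
Proof.
move=> [mF F0] [mG G0]; split; first exact: emeasurable_funD.
by move=> x; exact: adde_ge0.
Qed.

Lemma mge0M F G : mge0 F -> mge0 G -> mge0 (fun x => F x * G x).
Proof.
move=> [mF F0] [mG G0]; split; first exact: emeasurable_funM.
by move=> x; exact: mule_ge0.
Qed.

Lemma mge0_cst (k : \bar R) : 0 <= k -> mge0 (fun _ => k).
Proof. by move=> k0; split => //; exact: measurable_cst. Qed.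

Lemma ints0 s x : ints s (fun _ => 0) x = 0.
Proof.
suff -> : ints s (fun _ => 0) = (fun _ => 0) by [].
by elim: s => [//|v s /= ->]; apply/funext => y; rewrite !int1E integral0.
Qed.

Lemma intsD s F G : mge0 F -> mge0 G ->
  ints s (fun x => F x + G x) = fun x => ints s F x + ints s G x.
Proof.
move=> mF mG; elim: s => [//|v s /= ->]; apply/funext => x.
have [mF' mG'] := (mge0_ints s mF, mge0_ints s mG).
rewrite !int1E ge0_integralD//; do ?exact: mge0_updr.
- by move=> t _; exact: mF'.2.
- by move=> t _; exact: mG'.2.
Qed.

Definition agree_off s (x y : 'rV[R]_d) := forall j, j \notin s -> x ord0 j = y ord0 j.
Definition indep s F := forall x y : 'rV[R]_d, agree_off s x y -> F x = F y.

Lemma agree_off_upd s v x t : v \in s -> agree_off s x (upd x v t).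
Proof. by move=> vs j js; rewrite updE; case: eqP => // jv; rewrite jv vs in js. Qed.

Lemma ints_ext s F G x : (forall y, agree_off s x y -> F y = G y) ->
  ints s F x = ints s G x.
Proof.
elim: s x => [|v s ih] x /= FG; first exact: FG.
rewrite !int1E.
apply: eq_integral => t _; apply: ih => y xy; apply: FG => j.
rewrite inE negb_or => /andP[jv js]; rewrite -xy// updE (negbTE jv) //.
Qed.

Lemma indep_sub s1 s2 F : {subset s1 <= s2} -> indep s2 F -> indep s1 F.
Proof.
by move=> s12 iF x y xy; apply: iF => j js; apply: xy; apply: contra js => /s12.
Qed.

Lemma intsZ s F G : mge0 F -> mge0 G -> indep s G ->
  ints s (fun x => G x * F x) = fun x => G x * ints s F x.
Proof.
move=> mF mG; elim: s => [//|v s ih] iG /=.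
rewrite ih; last by apply: indep_sub iG => j js; rewrite inE js orbT.
have mF' := mge0_ints s mF.
apply/funext => x; rewrite !int1E.
under eq_integral => t _.
  rewrite -(iG x (upd x v t)); last exact/agree_off_upd/mem_head.
  over.
rewrite ge0_integralZl//; [exact: mge0_updr| |exact: mG.2].
by move=> t _; exact: mF'.2.
Qed.

Lemma indep_ints s F : indep s (ints s F).
Proof.
elim: s => [|v s ih] x y xy /=.
  by congr F; apply/rowP => j; exact: xy.
rewrite !int1E.
apply: eq_integral => t _; apply: ih => j js; rewrite !updE.
by case: ifPn => // jv; apply: xy; rewrite inE negb_or jv.
Qed.

Lemma indep_ints_r s1 s2 F : indep s1 F -> indep s1 (ints s2 F).
Proof.
move=> iF; elim: s2 => [//|v s ih] x y xy /=.
rewrite !int1E.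
apply: eq_integral => t _; apply: ih => j js; rewrite !updE.
by case: ifPn => // jv; apply: xy.
Qed.

End coordinate_integrals.

Section reading.
Context {R : realType} {d : nat}.
Local Notation mu := (@lebesgue_measure R).
Local Open Scope ereal_scope.

Definition rd n (f : 'I_n -> 'I_d) (x : 'rV[R]_d) : 'rV[R]_n :=
  \row_j x ord0 (f j).

Lemma measurable_rd n (f : 'I_n -> 'I_d) : measurable_fun [set: 'rV[R]_d] (rd f).
Proof.
apply: measurable_fun_coordP => j; under eq_fun do rewrite mxE.
exact: measurable_coord.
Qed.

Lemma measurable_sub_rV (A : {set 'I_d}) :
  measurable_fun [set: 'rV[R]_d] (sub_rV A).
Proof. exact: measurable_rd. Qed.

Lemma rV_cons_rd n (f : 'I_n.+1 -> 'I_d) (z : 'rV[R]_d) :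
  rd f z = rV_cons (z ord0 (f ord0), rd (f \o lift ord0) z).
Proof.
apply/rowP => i; rewrite mxE.
by case: (unliftP ord0 i) => [j|] ->; rewrite ?rV_consS ?rV_cons0 ?mxE.
Qed.

Lemma measurable_rV_consr n (t : R) :
  measurable_fun [set: 'rV[R]_n] (fun y => rV_cons (t, y)).
Proof.
apply: measurable_fun_coordP => i; case: (unliftP ord0 i) => [j|] ->.
  by under eq_fun do rewrite rV_consS; exact: measurable_coord.
by under eq_fun do rewrite rV_cons0; exact: measurable_cst.
Qed.

Lemma integral_rV_cons n (G : 'rV[R]_n.+1 -> \bar R) : mge0 G ->
  \int[lebesgue_rV n.+1]_y G y =
  \int[mu]_t \int[lebesgue_rV n]_y G (rV_cons (t, y)).
Proof.
move=> mG.
rewrite [LHS](@ge0_integral_pushforward _ _ _ _ _ _ (@measurable_rV_cons R n)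
  (mu \x lebesgue_rV n)%E setT G)//; last 2 first.
- exact: mG.1.
- by move=> y _; exact: mG.2.
rewrite preimage_setT (fubini_tonelli1 (G \o @rV_cons R n))//.
- exact: (measurableT_comp mG.1 (@measurable_rV_cons R n)).
- by move=> y; exact: mG.2.
Qed.

Lemma mge0_comp n m (G : 'rV[R]_n -> \bar R) (phi : 'rV[R]_m -> 'rV[R]_n) :
  measurable_fun setT phi -> mge0 G -> mge0 (G \o phi).
Proof.
move=> mphi [mG G0]; split; last by move=> x; exact: G0.
exact: (measurableT_comp mG mphi).
Qed.

(** The bridge between [lebesgue_rV], built one coordinate at a time, and iterated integrals over
    coordinates of the large vector. Injectivity of [f] ensures that the coordinate set first is not
    overwritten by the later integrations. *)
Lemma integral_rd n (f : 'I_n -> 'I_d) (G : 'rV[R]_n -> \bar R) x :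
  injective f -> mge0 G ->
  \int[lebesgue_rV n]_y G y = ints [seq f j | j <- enum 'I_n] (G \o rd f) x.
Proof.
elim: n f G x => [|n ih] f G x injf mG.
  rewrite enum_ord0 /= integral_dirac//; last exact: mG.1.
  rewrite diracT mul1e; congr G; by apply/rowP => -[].
rewrite enum_ordSl /= -map_comp integral_rV_cons// int1E.
apply: eq_integral => t _.
rewrite (ih (f \o lift ord0) _ (upd x (f ord0) t)); last 2 first.
- by apply: inj_comp => //; exact: lift_inj.
- exact: (mge0_comp (@measurable_rV_consr _ t)).
apply: ints_ext => z xz /=; congr G.
rewrite rV_cons_rd -xz ?updE ?eqxx//.
by apply/mapP => -[j _ /injf].
Qed.

End reading.

Section set_integrals.
Context {R : realType} {d : nat}.
Local Open Scope ereal_scope.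
Implicit Types (A B : {set 'I_d}) (F G : 'rV[R]_d -> \bar R).

Definition Ints A F := ints (enum A) F.

Lemma IntsE A (G : 'rV[R]_#|A| -> \bar R) x : mge0 G ->
  \int[lebesgue_rV #|A|]_y G y = Ints A (G \o sub_rV A) x.
Proof.
move=> mG; rewrite (@integral_rd _ d _ enum_val G x enum_val_inj mG) /Ints.
rewrite (@ints_perm _ _ _ (enum A))//.
  by apply: mge0_comp => //; exact: measurable_sub_rV.
apply: uniq_perm; first by rewrite map_inj_uniq ?enum_uniq//; exact: enum_val_inj.
  exact: enum_uniq.
move=> u; rewrite mem_enum; apply/mapP/idP => [[j _ ->]|uA]; first exact: enum_valP.
by exists (enum_rank_in uA u); rewrite ?mem_enum ?enum_rankK_in.
Qed.

Lemma IntsTE F x : mge0 F -> \int[lebesgue_rV d]_y F y = Ints [set: 'I_d]%SET F x.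
Proof.
move=> mF; rewrite (@integral_rd _ d _ id F x _ mF)// map_id /Ints enum_setT enumT.
by congr ints; apply/funext => y /=; congr F; apply/rowP => j; rewrite mxE.
Qed.

Lemma setI0_notin A B u : (A :&: B = finset.set0)%SET -> u \in B -> u \notin A.
Proof. by move=> /setP/(_ u); rewrite !inE => + uB; rewrite uB andbT => ->. Qed.

Lemma IntsU A B F : mge0 F -> (A :&: B = finset.set0)%SET ->
  Ints (A :|: B)%SET F = Ints A (Ints B F).
Proof.
move=> mF AB; rewrite /Ints -ints_cat; apply: ints_perm => //.
apply: uniq_perm; first exact: enum_uniq.
  rewrite cat_uniq !enum_uniq andbT/=; apply/hasPn => u /=.
  by rewrite !mem_enum; exact: setI0_notin AB.
by move=> u; rewrite mem_cat !mem_enum inE.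
Qed.

Definition dep A F := forall x y : 'rV[R]_d, (forall j, j \in A -> x ord0 j = y ord0 j) ->
  F x = F y.

Lemma dep_sub A B F : A \subset B -> dep A F -> dep B F.
Proof. by move=> /fintype.subsetP AB dF x y xy; apply: dF => j /AB; exact: xy. Qed.

Lemma dep_indep A B F : (A :&: B = finset.set0)%SET -> dep B F -> indep (enum A) F.
Proof.
move=> AB dF x y xy; apply: dF => j jB; apply: xy.
by rewrite mem_enum; exact: setI0_notin AB jB.
Qed.

Lemma indep_dep A F : indep (enum (~: A)%SET) F -> dep A F.
Proof.
by move=> iF x y xy; apply: iF => j; rewrite mem_enum inE negbK; exact: xy.
Qed.

Lemma depC A F : dep A F -> indep (enum (~: A)%SET) F.
Proof.
by move=> dF x y xy; apply: dF => j jA; apply: xy; rewrite mem_enum inE jA.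
Qed.

Lemma dep_Ints A B F : dep A F -> dep (A :\: B)%SET (Ints B F).
Proof.
move=> dF x y xy.
have -> : Ints B F x = Ints B F (\row_j if j \in B then y ord0 j else x ord0 j).
  by apply: indep_ints => j; rewrite mem_enum mxE => /negbTE ->.
apply: (indep_ints_r (s1 := enum (~: A)%SET)); first exact: depC.
move=> j; rewrite mem_enum inE negbK mxE => jA.
by case: ifPn => // jB; apply: xy; rewrite inE jB.
Qed.

Lemma dep0_cst F : dep finset.set0 F -> forall x y, F x = F y.
Proof. by move=> dF x y; apply: dF => j; rewrite inE. Qed.

Lemma dep_self A F : dep A F -> forall x y, Ints A F x = Ints A F y.
Proof. by move=> dF; apply: dep0_cst; rewrite -(finset.setDv A); exact: dep_Ints. Qed.

Lemma IntsZ A B F G : mge0 F -> mge0 G -> dep B G -> (A :&: B = finset.set0)%SET ->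
  Ints A (fun x => G x * F x) = fun x => G x * Ints A F x.
Proof. by move=> mF mG dG AB; apply: intsZ => //; exact: dep_indep dG. Qed.

Lemma mge0_Ints A F : mge0 F -> mge0 (Ints A F).
Proof. exact: mge0_ints. Qed.

(** Integrating over [A] and then over its complement already yields the total integral, which is
    zero at every point; the remaining integration over [A] acts on the zero function. *)
Lemma Ints_null A F : mge0 F -> \int[lebesgue_rV d]_y F y = 0 ->
  \int[lebesgue_rV d]_y Ints A F y = 0.
Proof.
move=> mF F0; have mF' := mge0_Ints A mF.
rewrite (IntsTE 0%R mF') -(finset.setUCr A) IntsU//; last first.
  by rewrite finset.setICr.
rewrite (_ : Ints (~: A)%SET (Ints A F) = fun _ => 0) ?/Ints ?ints0//.
apply/funext => x; rewrite -/(Ints _ _) -/(Ints _ _) -IntsU//; last first.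
  by rewrite finset.setIC finset.setICr.
by rewrite finset.setUC finset.setUCr -IntsTE.
Qed.

Local Notation leb := (@lebesgue_rV R d).

Lemma ge0_integral_eq0P F : mge0 F ->
  \int[leb]_y F y = 0 <-> {ae leb, forall x, F x = 0}.
Proof.
move=> mF; have := @ae_eq_integral_abs _ _ _ leb _ measurableT F mF.1.
under eq_integral do rewrite gee0_abs ?mF.2//.
move=> [H1 H2]; split=> [/H1|H].
  by apply: filterS => x /= /(_ Logic.I).
by apply: H2; apply: filterS H => x /= -> _.
Qed.

(** Fubini for an exceptional set. Adding to [G] the function equal to [+oo] on the null set makes
    the inequality hold everywhere, and the partial integrals of the added function vanish almost
    everywhere by [Ints_null]. *)
Lemma Ints_ae_le A F G : mge0 F -> mge0 G ->
  {ae leb, forall x, F x <= G x} -> {ae leb, forall x, Ints A F x <= Ints A G x}.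
Proof.
move=> mF mG [E [mE E0 FG]].
pose H x := +oo * (\1_E x)%:E : \bar R.
have mH : mge0 H.
  apply: mge0M; first exact: mge0_cst.
  split; first by apply/measurable_EFinP; exact: measurable_indic.
  by move=> x; rewrite lee_fin.
have H0 : \int[leb]_y H y = 0.
  rewrite ge0_integralZl//; last by apply/measurable_EFinP; exact: measurable_indic.
  by rewrite integral_indic// setIT [X in _ * X]E0 mule0.
have /(ge0_integral_eq0P (mge0_Ints A mH)) := Ints_null A mH H0.
apply: filterS => x Hx.
have : Ints A F x <= Ints A (fun x => G x + H x) x.
  apply: ints_le => //; first exact: mge0D.
  move=> y; have [Ey|nEy] := pselect (E y).
    by rewrite /H indicE mem_set// mule1 addey ?leey// gt_eqF// (lt_le_trans _ (mG.2 y)) ?ltNy0.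
  rewrite /H indicE memNset// mule0 adde0; apply: contrapT => /FG; exact: nEy.
by rewrite /Ints intsD// [X in _ <= _ + X](_ : _ = 0) ?adde0.
Qed.

Lemma lebesgue_rV_setT_gt0 : 0 < leb setT.
Proof.
have -> : leb setT = \int[leb]_x 1 by rewrite integral_cst// mul1e.
rewrite (IntsTE 0%R (mge0_cst lee01))// /Ints.
have : forall x : 'rV[R]_d, 0 < ints (enum ([set: 'I_d]%SET)) (fun _ => 1 : \bar R) x.
  elim: (enum _) => //= v s ih x.
  have -> : ints s (fun _ => 1) = (fun _ => ints s (fun _ => 1 : \bar R) x).
    apply/funext => y.
    have : dep finset.set0 (ints s (fun _ => 1 : \bar R)).
      by apply: indep_dep; apply: indep_ints_r => ? ?.
    by move/dep0_cst; exact.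
  rewrite int1E integral_cst//; apply: mule_gt0; first exact: ih.
  have := @lebesgue_measure_itv R `]-oo, +oo[; rewrite set_itvNyy /= => ->.
  exact: ltry.
exact.
Qed.

(** A null set is not the whole space. This extracts an inequality between two integrals that are
    constant in the point from one known almost everywhere, as happens when a function of the
    coordinates in [A] is integrated over [A]. *)
Lemma ae_cst (P : Prop) : {ae leb, forall x, P} -> P.
Proof.
move=> [E [mE E0 PE]]; apply: contrapT => nP.
have : E = setT by apply/seteqP; split => // x _; exact: PE.
by move=> ET; have := lebesgue_rV_setT_gt0; rewrite -ET [leb E]E0 ltxx.
Qed.

Lemma Ints_dep_ae_le A F G : mge0 F -> mge0 G -> dep A F -> dep A G ->
  {ae leb, forall x, F x <= G x} -> forall x, Ints A F x <= Ints A G x.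
Proof.
move=> mF mG dF dG FG x; apply: ae_cst.
apply: filterS (Ints_ae_le A mF mG FG) => y.
by rewrite (dep_self dF y x) (dep_self dG y x).
Qed.

Lemma Ints_dep_eq0 A F x : mge0 F -> dep A F -> Ints A F x = 0 ->
  {ae leb, forall x, F x = 0}.
Proof.
move=> mF dF F0; apply/(ge0_integral_eq0P mF).
rewrite (IntsTE x mF) -(finset.setUCr A) finset.setUC IntsU//; last first.
  by rewrite finset.setIC finset.setICr.
rewrite /Ints (_ : ints (enum A) F = fun _ => 0) ?ints0//.
by apply/funext => y; rewrite -F0; exact: dep_self.
Qed.

End set_integrals.

(** * Topology and measurability of row vectors *)

Section finite_measurability.
Context {dT} {T : measurableType dT} {I : finType}.

Lemma measurable_forall (P : I -> set T) : (forall i, measurable (P i)) ->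
  measurable [set x | forall i, P i x].
Proof.
move=> mP; rewrite (_ : mkset _ = \bigcap_(i in [set: I]) P i).
  by apply: fin_bigcap_measurable => //; exact: finite_finset.
by apply/seteqP; split=> x /= H; [move=> i _; exact: H | move=> i; exact: H].
Qed.

Lemma measurable_exists (P : I -> set T) : (forall i, measurable (P i)) ->
  measurable [set x | exists i, P i x].
Proof.
move=> mP; rewrite (_ : mkset _ = \bigcup_(i in [set: I]) P i).
  by apply: fin_bigcup_measurable => //; exact: finite_finset.
by apply/seteqP; split=> x /= [i]; [exists i | move=> _ Px; exists i].
Qed.

Lemma measure_exists_le {R : realType} (mu : {measure set T -> \bar R}) (F : I -> set T) :
  (forall i, measurable (F i)) ->
  (mu [set x | exists i, F i x] <= \sum_i mu (F i))%E.
Proof.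
move=> mF.
have -> : [set x | exists i, F i x] = \big[setU/set0]_(i <- index_enum I) F i.
  rewrite -bigcup_seq; apply/seteqP; split=> x /= [i]; last by exists i.
  by exists i => //=; rewrite mem_index_enum.
elim: index_enum => [|i r ih]; first by rewrite !big_nil measure0.
rewrite !big_cons (le_trans (measureU2 _ _ _))//; first exact: bigsetU_measurable.
by rewrite leeD2l.
Qed.

End finite_measurability.

Section euclidean_topology.
Context {R : realType} {n : nat}.
Implicit Types (x y : 'rV[R]_n) (U : set 'rV[R]_n) (j : 'I_n) (c : R).

Lemma measurable_coord_le j c : measurable [set x : 'rV[R]_n | x ord0 j <= c].
Proof.
have := @measurable_coord R n j measurableT `]-oo, c]%classic (measurable_itv _).
by rewrite setTI set_itvNyc.
Qed.

Lemma measurable_coord_lt j c : measurable [set x : 'rV[R]_n | c < x ord0 j].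
Proof.
rewrite (_ : mkset _ = ~` [set x : 'rV[R]_n | x ord0 j <= c]).
  by apply: measurableC; exact: measurable_coord_le.
by apply/seteqP; split=> x /=; rewrite ltNge => /negP.
Qed.

Lemma measurable_coord_ge j c : measurable [set x : 'rV[R]_n | c <= x ord0 j].
Proof.
have := @measurable_coord R n j measurableT `[c, +oo[%classic (measurable_itv _).
by rewrite setTI set_itvcy.
Qed.

Lemma measurable_coord_gt j c : measurable [set x : 'rV[R]_n | x ord0 j < c].
Proof.
rewrite (_ : mkset _ = ~` [set x : 'rV[R]_n | c <= x ord0 j]).
  by apply: measurableC; exact: measurable_coord_ge.
by apply/seteqP; split=> x /=; rewrite ltNge => /negP.
Qed.

Lemma open_rVP U x : open U -> U x -> exists2 e : R, 0 < e &
  forall y, (forall j, `|x ord0 j - y ord0 j| < e) -> U y.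
Proof.
move=> oU Ux; have /nbhs_ballP[e /= e0 eU] : nbhs x U by exact: open_nbhs_nbhs.
exists e => // y xy; apply: eU; split => // i j.
by rewrite (ord1 i); exact: xy.
Qed.

(** The product sigma-algebra contains the open sets because an open set is the union of the
    rational boxes inside it, enumerated by [pickle] as pairs of centre and half-width. A half-width
    below [e / 2] and a centre that close to [x] keep the box within [e] of [x]. *)
Lemma open_rV_measurable U : open U -> measurable U.
Proof.
move=> oU.
pose box (c : 'rV[rat]_n * rat) : set 'rV[R]_n :=
  [set x : 'rV[R]_n | forall j, x ord0 j \in `]ratr (c.1 ord0 j - c.2), ratr (c.1 ord0 j + c.2)[].
have mbox (c : 'rV[rat]_n * rat) : measurable (box c).
  apply: measurable_forall => j.
  rewrite (_ : (fun x => _) = [set x : 'rV[R]_n | ratr (c.1 ord0 j - c.2) < x ord0 j]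
     `&` [set x : 'rV[R]_n | x ord0 j < ratr (c.1 ord0 j + c.2)]).
    by apply: measurableI; [exact: measurable_coord_lt | exact: measurable_coord_gt].
  by apply/seteqP; split=> x /=; rewrite in_itv/= => /andP.
rewrite (_ : U = \bigcup_k
    (if @unpickle ('rV[rat]_n * rat)%type k is Some c then
       if `[< box c `<=` U >] then box c else set0 else set0)).
  apply: bigcup_measurable => k _.
  case: unpickle => [c|]; last exact: measurable0.
  by case: ifP => _; [exact: mbox | exact: measurable0].
apply/seteqP; split=> [x Ux|x [k _]]; last first.
  by case: unpickle => // c; case: ifPn => // /asboolP cU; exact: cU.
have [e e0 eU] := open_rVP oU Ux.
have [r /[!in_itv]/= /andP[r0 re]] : exists r : rat, ratr r \in `]0, e / 2[.
  by apply: rat_in_itvoo; rewrite divr_gt0.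
have qP j : exists q : rat, ratr q \in `]x ord0 j - ratr r, x ord0 j + ratr r[.
  by apply: rat_in_itvoo; rewrite ltrBlDr -addrA ltrDl addr_gt0.
have [q Hq] := choice qP.
pose c : 'rV[rat]_n * rat := (\row_j q j, r).
exists (pickle c) => //; rewrite pickleK.
have bU : box c `<=` U.
  move=> y yc; apply: eU => j; have := Hq j; have := yc j.
  rewrite /= mxE !in_itv/= rmorphB rmorphD /= => /andP[a1 a2] /andP[a3 a4].
  by rewrite ltr_norml; apply/andP; split; lra.
rewrite asboolT// => j; have := Hq j.
rewrite mxE !in_itv/= rmorphB rmorphD /= => /andP[a3 a4].
by apply/andP; split; lra.
Qed.

Lemma closed_rV_measurable U : closed U -> measurable U.
Proof.
move=> cU; rewrite -[U]setCK; apply: measurableC.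
by apply: open_rV_measurable; exact: closed_openC.
Qed.

Lemma measurable_orthant : measurable (@orthant R n).
Proof. by apply: measurable_forall => j; exact: measurable_coord_ge. Qed.

Lemma measurable_rV_le y : measurable [set x : 'rV[R]_n | rV_le x y].
Proof. by apply: measurable_forall => j; exact: measurable_coord_le. Qed.

Lemma measurable_box_compl y : measurable (box_compl y).
Proof. by apply: measurableD; [exact: measurable_orthant | exact: measurable_rV_le]. Qed.

Lemma measurable_rV_set1 y : measurable [set y].
Proof.
rewrite (_ : [set y] = [set x : 'rV[R]_n | rV_le x y] `&`
    [set x : 'rV[R]_n | forall j, y ord0 j <= x ord0 j]).
  apply: measurableI; first exact: measurable_rV_le.
  by apply: measurable_forall => j; exact: measurable_coord_ge.
apply/seteqP; split=> [x ->|x /= [xy yx]]; [by split => j|].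
by apply/rowP => j; apply/eqP; rewrite eq_le xy yx.
Qed.

Lemma measurable_punctured : measurable (@punctured R n).
Proof. by apply: measurableD; [exact: measurable_orthant | exact: measurable_rV_set1]. Qed.

Lemma measurable_boundary U : measurable (boundary U).
Proof. by apply: measurableI; apply: closed_rV_measurable; exact: closed_closure. Qed.

Lemma closed_coord_le j c : closed [set x : 'rV[R]_n | x ord0 j <= c].
Proof.
rewrite (_ : mkset _ = (fun x : 'rV[R]_n => x ord0 j) @^-1` [set t | t <= c])//.
by apply: closed_comp; [move=> x _; exact: coord_continuous | exact: closed_le].
Qed.

Lemma closed_coord_ge j c : closed [set x : 'rV[R]_n | c <= x ord0 j].
Proof.
rewrite (_ : mkset _ = (fun x : 'rV[R]_n => x ord0 j) @^-1` [set t | c <= t])//.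
by apply: closed_comp; [move=> x _; exact: coord_continuous | exact: closed_ge].
Qed.

Lemma closed_forall (I : finType) (F : I -> set 'rV[R]_n) :
  (forall i, closed (F i)) -> closed [set x : 'rV[R]_n | forall i, F i x].
Proof.
move=> cF; rewrite (_ : mkset _ = \bigcap_(i in [set: I]) F i).
  by apply: closed_bigI => i _; exact: cF.
by apply/seteqP; split=> x /= H; [move=> i _; exact: H | move=> i; exact: H].
Qed.

Lemma closed_exists (I : finType) (F : I -> set 'rV[R]_n) :
  (forall i, closed (F i)) -> closed [set x : 'rV[R]_n | exists i, F i x].
Proof.
move=> cF; rewrite (_ : mkset _ = \bigcup_(i in [set: I]) F i).
  by apply: closed_bigcup => //; exact: finite_finset.
by apply/seteqP; split=> x /= [i]; [exists i | move=> _ Px; exists i].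
Qed.

Lemma closure_sub_closed (A B : set 'rV[R]_n) : A `<=` B -> closed B ->
  closure A `<=` B.
Proof. by move=> AB /closure_id ->; exact: closure_subset. Qed.

Lemma closure_rVP U x : closure U x <-> forall e : R, 0 < e ->
  exists2 y, U y & forall j, `|x ord0 j - y ord0 j| < e.
Proof.
split=> [cU e e0|H A /nbhs_ballP[e /= e0 eA]].
  have /cU[y [Uy xy]] : nbhs x (ball x e) by exact: nbhsx_ballx.
  by exists y => // j; case: xy => _; exact.
have [y Uy xy] := H _ e0; exists y; split => //; apply: eA; split => // i j.
by rewrite (ord1 i); exact: xy.
Qed.

(** Boundaries are never computed: a closed set around [U] and a closed set around its complement in
    the orthant suffice, since only their intersection has to be null. *)
Lemma boundary_sub U (F1 F2 : set 'rV[R]_n) : closed F1 -> closed F2 ->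
  U `<=` F1 -> orthant n `\` U `<=` F2 -> boundary U `<=` F1 `&` F2.
Proof.
move=> c1 c2 s1 s2 x [x1 x2]; split; first exact: (closure_sub_closed s1).
exact: (closure_sub_closed s2 c2).
Qed.

Lemma boundary_box_compl y :
  boundary (box_compl y) `<=` [set x : 'rV[R]_n | exists j, x ord0 j = y ord0 j].
Proof.
move=> x /(boundary_sub (closed_exists (fun j => @closed_coord_ge j (y ord0 j)))
  (closed_forall (fun j => @closed_coord_le j (y ord0 j)))) [].
- move=> z [_ /= zy]; apply: contrapT => /forallNP H; apply: zy => j.
  by rewrite ltW// ltNge; apply/negP; exact: H.
- by move=> z [oz /not_andP[//|/contrapT zy]]; exact: zy.
by move=> [j /= yx] /(_ j) /= xy; exists j; apply/eqP; rewrite eq_le xy.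
Qed.

Lemma boundary_slab (u v : 'I_n) (a b : R) :
  boundary (orthant n `&` [set x : 'rV[R]_n | a < x ord0 u /\ x ord0 v <= b])
  `<=` [set x : 'rV[R]_n | x ord0 u = a] `|` [set x : 'rV[R]_n | x ord0 v = b].
Proof.
move=> x /(boundary_sub (closedI (@closed_coord_ge u a) (@closed_coord_le v b))
  (closedU (@closed_coord_le u a) (@closed_coord_ge v b))) [].
- by move=> z [_ [/ltW ? ?]].
- move=> z [oz /not_andP[//|/not_andP[/negP|/negP]]]; first by rewrite -leNgt; left.
  by rewrite -ltNge => /ltW; right.
by move=> [/= x1 x2] [/= x3|/= x3]; [left|right]; apply/eqP; rewrite eq_le ?x1 ?x2 ?x3.
Qed.

Lemma boundary_face_slab (S : {set 'I_n}) (a : R) : boundary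
    (orthant n `&` [set x : 'rV[R]_n | forall j, j \in S -> a < x ord0 j])
  `<=` [set x : 'rV[R]_n | exists j, x ord0 j = a].
Proof.
pose F1 := [set x : 'rV[R]_n | forall j : {j | j \in S}, a <= x ord0 (val j)].
pose F2 := [set x : 'rV[R]_n | exists j : {j | j \in S}, x ord0 (val j) <= a].
move=> x /(boundary_sub (F1 := F1) (F2 := F2)) [].
- by apply: closed_forall => j; exact: closed_coord_ge.
- by apply: closed_exists => j; exact: closed_coord_le.
- by move=> z [_ zS] [j jS]; exact/ltW/zS.
- move=> z [oz /not_andP[//|/existsNP[j /not_implyP[jS /negP]]]].
  by rewrite -leNgt; exists (exist _ j jS).
move=> H [[j jS] /= xj]; exists j; apply/eqP; rewrite eq_le xj.
exact: (H (exist _ j jS)).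
Qed.

Lemma bounded_awayP U : bounded_away U <-> [/\ measurable U, U `<=` orthant n &
  exists2 e : R, 0 < e & forall x, U x -> exists j, e <= x ord0 j].
Proof.
split=> -[mU oU].
  move=> nU; split=> //; apply: contrapT => H; apply: nU; apply/closure_rVP => e e0.
  apply: contrapT => H'; apply: H; exists e => // x Ux; apply: contrapT => H''.
  apply: H'; exists x => // j; rewrite mxE sub0r normrN ger0_norm; last exact: oU.
  by rewrite ltNge; apply/negP => ?; apply: H''; exists j.
move=> [e e0 eU]; split=> // /closure_rVP /(_ e e0)[y /[dup] Uy /eU[j ej]] /(_ j).
by rewrite mxE sub0r normrN ger0_norm ?(oU _ Uy)// ltNge ej.
Qed.

Lemma bounded_away_box_compl y : (forall j, 0 < y ord0 j) ->
  bounded_away (box_compl y).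
Proof.
move=> y0; apply/bounded_awayP; split; first exact: measurable_box_compl.
  by move=> x [].
pose e := \big[Num.min/1]_j y ord0 j.
exists e.
  by apply: lt_bigmin => // j _; exact: y0.
move=> x [_ /existsNP[j /negP]]; rewrite -ltNge => /ltW yx; exists j.
by apply: le_trans yx; exact: bigmin_le.
Qed.

Lemma rV_norm_leP x (t : R) : 0 <= t -> reflect (forall j, `|x ord0 j| <= t) (`|x| <= t).
Proof.
move=> t0; rewrite [`|x|]mx_normrE; apply: (iffP idP) => [xt j|xt].
  apply: le_trans xt.
  exact: (@le_bigmax _ _ _ 0 (fun i : 'I_1 * 'I_n => `|x i.1 i.2|) (ord0, j)).
by apply/bigmax_leP; split => // -[i j] _ /=; rewrite (ord1 i).
Qed.

Section norms.
Variable nrm : 'rV[R]_n -> R.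
Hypothesis nrmP : is_norm nrm.

Lemma nrm0 : nrm 0 = 0.
Proof. by case: nrmP => _ _ _ /(_ 0 0); rewrite scale0r normr0 mul0r. Qed.

Lemma nrmN x : nrm (- x) = nrm x.
Proof. by case: nrmP => _ _ _ /(_ (- 1) x); rewrite scaleN1r normrN1 mul1r. Qed.

Lemma nrm_ge0 x : 0 <= nrm x. Proof. by case: nrmP. Qed.

Lemma nrm_gt0 x : x != 0 -> 0 < nrm x.
Proof.
move=> x0; rewrite lt_neqAle nrm_ge0 andbT eq_sym; apply: contra x0 => /eqP.
by case: nrmP => _ H _ _ /H ->.
Qed.

Lemma nrmZ (a : R) x : 0 <= a -> nrm (a *: x) = a * nrm x.
Proof. by case: nrmP => _ _ _ -> a0; rewrite ger0_norm. Qed.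

Lemma nrm_le_sum x : nrm x <= \sum_j `|x ord0 j| * nrm (delta_mx ord0 j).
Proof.
case: nrmP => _ _ nD nZ; rewrite [in leLHS](row_sum_delta x).
elim/big_ind2: _ => [|a b c e ab ce|j _]; first by rewrite nrm0.
- by apply: le_trans (nD _ _) _; exact: lerD.
- by rewrite nZ.
Qed.

Lemma nrm_dist x y : `|nrm x - nrm y| <= nrm (x - y).
Proof.
case: nrmP => _ _ nD _; rewrite ler_norml; apply/andP; split.
  rewrite lerNl opprB lerBlDr -[nrm (x - y)]nrmN opprB.
  by apply: le_trans (nD _ _); rewrite subrK.
by rewrite lerBlDr; apply: le_trans (nD _ _); rewrite subrK.
Qed.

Lemma measurable_nrm : measurable_fun [set: 'rV[R]_n] nrm.
Proof.
(* The sum is a Lipschitz constant of [nrm] for the sup norm; adding 1 makes [K] positive and the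
   final inequality strict. *)
pose K := \sum_j nrm (delta_mx ord0 j) + 1.
have K0 : 0 < K.
  by rewrite ltr_wpDl// sumr_ge0// => j _; exact: nrm_ge0.
apply: (measurability _ (RGenOInfty.measurableE R)) => _ [_ [a ->] <-].
rewrite setTI; apply: open_rV_measurable; rewrite openE => x /= ax.
move: ax; rewrite in_itv/= andbT => ax.
apply/nbhs_ballP; exists ((nrm x - a) / K); first by rewrite /= divr_gt0// subr_gt0.
move=> y [_ /(_ ord0) xy]; rewrite /= in_itv/= andbT.
have : nrm (x - y) < nrm x - a.
  apply: le_lt_trans (nrm_le_sum _) _.
  apply: (@le_lt_trans _ _ ((nrm x - a) / K * \sum_j nrm (delta_mx ord0 j))).
    rewrite mulr_sumr; apply: ler_sum => j _; rewrite ler_wpM2r ?nrm_ge0//.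
    by rewrite !mxE; apply: ltW; exact: xy.
  rewrite mulrAC ltr_pdivrMr// ltr_pM2l ?subr_gt0//.
  by rewrite /K ltrDl.
have := nrm_dist x y; rewrite ler_norml => /andP[_ h1] h2; lra.
Qed.

End norms.

End euclidean_topology.

Section readings.
Context {R : realType} {m n : nat}.
Variable f : 'I_m -> 'I_n.

Lemma orthant_rd (x : 'rV[R]_n) : orthant n x -> orthant m (rd f x).
Proof. by move=> ox j; rewrite mxE. Qed.

Lemma closure_rd (B : set 'rV[R]_m) :
  closure (rd f @^-1` B) `<=` rd f @^-1` (closure B).
Proof.
move=> x /closure_rVP H; apply/closure_rVP => e /H[y By xy].
by exists (rd f y) => // j; rewrite !mxE.
Qed.

Lemma boundary_rd (B : set 'rV[R]_m) :
  boundary (orthant n `&` rd f @^-1` B) `<=` rd f @^-1` (boundary B).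
Proof.
move=> x [x1 x2]; split; apply: closure_rd.
  by apply: closure_subset x1 => y [].
apply: closure_subset x2 => y [oy /not_andP[//|yB]]; split => //.
exact: orthant_rd.
Qed.

Lemma bounded_away_rd (B : set 'rV[R]_m) : bounded_away B ->
  bounded_away (orthant n `&` rd f @^-1` B).
Proof.
move=> /bounded_awayP[mB oB [e e0 eB]]; apply/bounded_awayP; split.
- apply: measurableI; first exact: measurable_orthant.
  by rewrite -[X in measurable X]setTI; exact: measurable_rd.
- by move=> x [].
- by exists e => // x [_ /= /eB[j]]; rewrite mxE => ej; exists (f j).
Qed.

End readings.

Section density_measure.
Context {dT} {T : measurableType dT} {R : realType}.
Variables (mu : {measure set T -> \bar R}) (g : T -> \bar R).
Hypothesis mg : measurable_fun [set: T] g.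
Hypothesis g0 : forall x, (0 <= g x)%E.

(** The two proofs are arguments so that the measure structure can be inferred from the term
    alone. *)
Definition density_measure_of (_ : measurable_fun [set: T] g)
  (_ : forall x, (0 <= g x)%E) (B : set T) : \bar R := (\int[mu]_(x in B) g x)%E.
Local Notation dm := (density_measure_of mg g0).

Let dm0 : dm set0 = 0%E.
Proof. exact: integral_set0. Qed.

Let dm_ge0 B : (0 <= dm B)%E.
Proof. by apply: integral_ge0 => x _; exact: g0. Qed.

Let dm_sigma_additive : semi_sigma_additive dm.
Proof. exact: semi_sigma_additive_nng_induced. Qed.

HB.instance Definition _ := isMeasure.Build _ _ _ dm dm0 dm_ge0 dm_sigma_additive.

Definition density_measure : {measure set T -> \bar R} := dm.

Lemma density_measureE B : density_measure B = (\int[mu]_(x in B) g x)%E.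
Proof. by []. Qed.

End density_measure.

(** * Scaling, and uniqueness of measures on the punctured orthant *)

Section scaling.
Context {R : realType}.
Local Notation mu := (@lebesgue_measure R).
Local Open Scope ereal_scope.

Lemma measurable_scale1 (k : R) : measurable_fun [set: measurableTypeR R]
  (fun t : measurableTypeR R => k * t : measurableTypeR R)%R.
Proof. by apply: measurable_funM => //; exact: measurable_cst. Qed.

(** [k] times the image of Lebesgue measure under [t -> k * t] gives every interval its length, so
    uniqueness of Lebesgue measure applies. *)
Lemma integral_scale1 (k : R) (F : measurableTypeR R -> \bar R) : (0 < k)%R ->
  measurable_fun [set: measurableTypeR R] F -> (forall t, 0 <= F t) ->
  \int[mu]_t F (k * t)%R = (k^-1)%:E * \int[mu]_t F t.
Proof.
move=> k0 mF F0.
have k0' : (0 <= k)%R := ltW k0.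
pose m := pushforward mu (fun t : measurableTypeR R => k * t : measurableTypeR R)%R.
pose m1 : {measure set measurableTypeR R -> \bar R} :=
  measure_function_pushforward__canonical__measure_function_Measure mu (measurable_scale1 k).
have mE A : measurable A -> mu A = mscale (NngNum k0') m1 A.
  apply: lebesgue_measure_unique => _ [[a b] _ <-].
  rewrite lebesgue_measure_itv/= lte_fin.
  have -> : mscale (NngNum k0') m1 `]a, b]%classic =
    k%:E * mu ((fun t : R => k * t)%R @^-1` `]a, b]%classic) by [].
  rewrite (_ : _ @^-1` _ = `](a / k)%R, (b / k)%R]%classic); last first.
    apply/seteqP; split=> t /=; rewrite !in_itv/= ltr_pdivrMr// ler_pdivlMr//;
      by rewrite mulrC.
  rewrite [X in _ = _ * X](lebesgue_measure_itv `](a / k)%R, (b / k)%R])/= lte_fin.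
  rewrite ltr_pM2r ?invr_gt0//; case: ifPn => ab; last by rewrite mule0.
  by rewrite -!EFinB -EFinM; congr (_%:E); field; rewrite gt_eqF.
rewrite [in RHS](eq_measure_integral (mscale (NngNum k0') m1)); last first.
  by move=> A mA _; exact: mE.
rewrite ge0_integral_mscale// (ge0_integral_pushforward (measurable_scale1 k))//.
by rewrite preimage_setT muleA -EFinM mulVf ?mul1e// gt_eqF.
Qed.

Lemma measurable_scale n (k : R) :
  measurable_fun [set: 'rV[R]_n] (fun y => k *: y)%R.
Proof.
apply: measurable_fun_coordP => j; under eq_fun do rewrite mxE.
by apply: measurable_funM; [exact: measurable_cst | exact: measurable_coord].
Qed.

Lemma scale_image n (k : R) (B : set 'rV[R]_n) : (0 < k)%R ->
  [set (k *: x)%R | x in B] = [set x | B (k^-1 *: x)%R].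
Proof.
move=> k0; have kn0 : k != 0%R by rewrite gt_eqF.
apply/seteqP; split=> [_ [x Bx <-]|x Bx] /=; first by rewrite scalerA mulVf// scale1r.
by exists (k^-1 *: x)%R => //; rewrite scalerA mulfV// scale1r.
Qed.

Lemma measurable_scale_image n (k : R) (B : set 'rV[R]_n) : (0 < k)%R ->
  measurable B -> measurable [set (k *: x)%R | x in B].
Proof.
move=> k0 mB; rewrite scale_image// -[X in measurable X]setTI.
exact: measurable_scale.
Qed.

Lemma integral_scale n (k : R) (G : 'rV[R]_n -> \bar R) : (0 < k)%R -> mge0 G ->
  \int[lebesgue_rV n]_y G (k *: y)%R = (k ^- n)%:E * \int[lebesgue_rV n]_y G y.
Proof.
move=> k0; elim: n G => [|n ih] G mG.
  rewrite expr0 invr1 mul1e; apply: eq_integral => y _; congr G.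
  by apply/rowP => -[].
have mGk : mge0 (fun y => G (k *: y)%R).
  by apply: (mge0_comp (phi := fun y => k *: y)%R) => //; exact: measurable_scale.
rewrite !integral_rV_cons//.
have rV_consZ t y : (k *: rV_cons (t, y) = rV_cons (k * t, k *: y) :> 'rV[R]_n.+1)%R.
  apply/rowP => i; rewrite mxE.
  by case: (unliftP ord0 i) => [j|] ->; rewrite ?rV_consS ?rV_cons0 ?mxE.
under eq_integral => t _.
  under eq_integral do rewrite rV_consZ.
  rewrite (ih (fun y => G (rV_cons (k * t, y))%R)); last first.
    by apply: (mge0_comp (phi := fun y => rV_cons (k * t, y))%R) => //; exact: measurable_rV_consr.
  over.
pose H (t : measurableTypeR R) := \int[lebesgue_rV n]_y G (rV_cons (t, y)).
have mH : measurable_fun setT H.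
  apply: (measurable_fun_fubini_tonelli_F (m2 := lebesgue_rV n) (G \o @rV_cons R n)).
  - exact: (measurableT_comp mG.1 (@measurable_rV_cons R n)).
  - by move=> p; exact: mG.2.
have H0 t : 0 <= H t by apply: integral_ge0 => y _; exact: mG.2.
transitivity (\int[mu]_t ((k ^- n)%:E * H (k * t)%R)) => //.
have mHk : measurable_fun setT (fun t : measurableTypeR R => H (k * t)%R).
  exact: (measurableT_comp mH (measurable_scale1 k)).
rewrite (ge0_integralZl mu measurableT mHk (fun t _ => H0 _)); last first.
  by rewrite lee_fin invr_ge0 exprn_ge0// ltW.
by rewrite integral_scale1// muleA -EFinM exprS invfM mulrC.
Qed.

End scaling.

Section punctured_sets.
Context {R : realType} {n : nat}.

Lemma boundary_punctured (D : set 'rV[R]_n) : bounded_away D -> boundary D `<=` punctured n.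
Proof.
move=> /bounded_awayP[mD oD [e e0 eD]] x [cx _]; split.
  apply: (closure_sub_closed oD _ cx).
  by apply: (@closed_forall R n 'I_n) => j; exact: closed_coord_ge.
have [j] : exists j, e <= x ord0 j.
  apply: (closure_sub_closed eD _ cx).
  by apply: (@closed_exists R n 'I_n) => j; exact: closed_coord_ge.
by move=> ej x0; move: ej; rewrite x0 mxE leNgt e0.
Qed.

Lemma punctured_gt0 (x : 'rV[R]_n) : punctured n x -> exists j, 0 < x ord0 j.
Proof.
move=> [ox x0]; apply: contrapT => /forallNP H'; apply: x0; apply/rowP => j.
by rewrite mxE; apply/eqP; rewrite eq_le ox andbT leNgt; apply/negP; exact: H'.
Qed.

Lemma punctured_box (x : 'rV[R]_n) : punctured n x ->
  exists k : nat, box_compl (const_mx k.+1%:R^-1) x.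
Proof.
move=> [ox x0]; have [j xj] := punctured_gt0 (conj ox x0).
have [k kx] := ltr_add_invr xj; rewrite add0r in kx.
by exists k; split=> // /(_ j); rewrite mxE; apply/negP; rewrite -ltNge.
Qed.

End punctured_sets.

Section uniqueness.
Context {R : realType} {n : nat}.
Implicit Types (x y z : 'rV[R]_n) (B : set 'rV[R]_n).

Definition lower y : set 'rV[R]_n := [set x | rV_le x y].

Lemma lowerI y z : lower y `&` lower z = lower (rV_min y z).
Proof.
apply/seteqP; split=> x.
  by move=> [xy xz] j; rewrite mxE le_min xy xz.
by move=> H; split=> j; have := H j; rewrite mxE le_min => /andP[].
Qed.

(** The lower sets generate because the half-space [x_i <= a] is the union over [k] of the lower
    sets with bound [a] in coordinate [i] and [k] in all others. They are stable under intersection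
    by [lowerI]. *)
Lemma measurable_rVE :
  @measurable _ 'rV[R]_n = <<s [set A | exists y, A = lower y] >>.
Proof.
apply/seteqP; split; last first.
  apply: smallest_sub; first exact: sigma_algebra_measurable.
  by move=> _ [y ->]; exact: measurable_rV_le.
set G := mkset _.
apply: smallest_sub; first exact: smallest_sigma_algebra.
rewrite -bigcup_seq => A [i _ [Y mY <-]].
suff : measurable_fun [set: g_sigma_algebraType G]
    (fun x : g_sigma_algebraType G => (x : 'rV[R]_n) ord0 i : measurableTypeR R).
  by move=> /(_ measurableT Y mY).
apply: (measurability _ (RGenOInfty.measurableE R)) => _ [_ [a ->] <-].
rewrite setTI (_ : _ @^-1` _ = ~` \bigcup_k lower (\row_j if j == i then a else k%:R)).
  apply: measurableC; apply: bigcup_measurable => k _.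
  by apply: sub_sigma_algebra; exists (\row_j if j == i then a else k%:R).
apply/seteqP; split=> x /=; rewrite in_itv/= andbT ltNge.
  by move=> /negP xa [k _ /(_ i)]; rewrite mxE eqxx.
move=> H; apply/negP => xa; apply: H.
exists (Num.bound (\sum_j `|x ord0 j|)) => // j; rewrite mxE.
case: eqP => [->//|_].
apply: le_trans (ltW (archi_boundP _)); last by rewrite sumr_ge0.
by rewrite (bigD1 j)//= (le_trans (ler_norm _))// lerDl sumr_ge0.
Qed.

Section two_measures.
Variables mu nu : {measure set 'rV[R]_n -> \bar R}.
Hypothesis mu0 : mu (~` punctured n) = 0%E.
Hypothesis nu0 : nu (~` punctured n) = 0%E.
Hypothesis mu_fin : forall y, (forall j, 0 < y ord0 j) -> (mu (box_compl y) < +oo)%E.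
Hypothesis mu_nu : forall y, (forall j, 0 < y ord0 j) -> mu (box_compl y) = nu (box_compl y).

Let D (e : R) := box_compl (const_mx e : 'rV[R]_n).

(** For positive [z] the set is the difference of the complements of [[0, min(z, e)]] and [[0, z]],
    both of finite measure. *)
Let lower_pos (e : R) z : 0 < e -> (forall j, 0 < z ord0 j) ->
  mu (lower z `&` D e) = nu (lower z `&` D e).
Proof.
move=> e0 z0; pose w : 'rV[R]_n := rV_min z (const_mx e).
have w0 j : 0 < w ord0 j by rewrite !mxE lt_min z0.
have -> : lower z `&` D e = box_compl w `\` box_compl z.
  apply/seteqP; split=> x.
    move=> [xz [ox xe]]; split; last by move=> [_]; exact.
    split=> // xw; apply: xe => j; have := xw j.
    by rewrite !mxE le_min => /andP[].
  move=> [[ox xw] xz]; have {}xz : rV_le x z by apply: contrapT => ?; apply: xz.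
  split=> //; split=> // xe; apply: xw => j; rewrite !mxE le_min xz.
  by have := xe j; rewrite mxE.
have zw : box_compl w `&` box_compl z = box_compl z.
  apply/setIidPr => x [ox xz]; split=> // xw; apply: xz => j.
  by apply: le_trans (xw j) _; rewrite mxE ge_min lexx.
have [mw mz] := (measurable_box_compl w, measurable_box_compl z).
rewrite measureD//; last exact: mu_fin.
rewrite (measureD mw mz); last by have := mu_fin w0; rewrite mu_nu.
by rewrite !zw; congr (_ - _)%E; exact: mu_nu.
Qed.

Let muD_fin (e : R) : 0 < e -> (mu (D e) < +oo)%E.
Proof. by move=> e0; apply: mu_fin => j; rewrite mxE. Qed.

Let nuD_fin (e : R) : 0 < e -> (nu (D e) < +oo)%E.
Proof. by move=> e0; rewrite -mu_nu ?muD_fin// => j; rewrite mxE. Qed.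

Let mD e : measurable (D e). Proof. exact: measurable_box_compl. Qed.

(** A non-negative [z] is approached from above by the positive vectors [z + 1 / k.+1]; with a
    negative coordinate the set is empty. *)
Let lower_all (e : R) z : 0 < e -> mu (lower z `&` D e) = nu (lower z `&` D e).
Proof.
move=> e0; have [z0|/existsNP[j /negP zj]] := pselect (forall j, 0 <= z ord0 j); last first.
  have -> : lower z `&` D e = set0; last by rewrite !measure0.
  apply/seteqP; split=> // x [/(_ j) xz [/(_ j) ox _]].
  by apply/negP: zj; rewrite negbK (le_trans ox).
pose zz (k : nat) : 'rV[R]_n := z + const_mx k.+1%:R^-1.
have zz0 k j : 0 < zz k ord0 j by rewrite !mxE ltr_wpDl.
pose F k := lower (zz k) `&` D e.
have mF k : measurable (F k) by apply: measurableI => //; exact: measurable_rV_le.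
have FI : \bigcap_k F k = lower z `&` D e.
  apply/seteqP; split=> x; last first.
    move=> [xz Dx] k _; split=> // j; apply: le_trans (xz j) _.
    by rewrite !mxE lerDl invr_ge0.
  move=> H; have [_ Dx] := H 0%N Logic.I; split=> // j.
  apply/ler_addgt0Pr => d d0.
  have [k /ltW kd] := ltr_add_invr d0; rewrite add0r in kd.
  have [/(_ j)] := H k Logic.I.
  by rewrite !mxE => xk _; rewrite (le_trans xk)// lerD2l.
have dF : nonincreasing_seq F.
  move=> k l kl; apply/subsetPset => x [xz Dx]; split=> // j.
  apply: le_trans (xz j) _; rewrite !mxE lerD2l lef_pV2 ?posrE//.
  by rewrite ler_nat.
have h (m : {measure set 'rV[R]_n -> \bar R}) : (m (D e) < +oo)%E ->
    m \o F @ \oo --> m (lower z `&` D e).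
  move=> mfin; rewrite -FI; apply: nonincreasing_cvg_mu => //.
    apply: le_lt_trans mfin; apply: le_measure; rewrite ?inE//; first by move=> x [].
  by rewrite FI; apply: measurableI => //; exact: measurable_rV_le.
have h1 := h mu (muD_fin e0); have h2 := h nu (nuD_fin e0).
have E : mu \o F = nu \o F by apply/funext => k /=; exact: lower_pos.
by rewrite E in h1; exact: (cvg_unique _ h1 h2).
Qed.

Let mu_nuD (e : R) B : 0 < e -> measurable B -> mu (B `&` D e) = nu (B `&` D e).
Proof.
move=> e0 mB.
pose G : set (set 'rV[R]_n) := [set A | exists y, A = lower y].
pose m1 : {measure set 'rV[R]_n -> \bar R} := mrestr mu (mD e).
pose m2 : {measure set 'rV[R]_n -> \bar R} := mrestr nu (mD e).
suff : m1 B = m2 B by [].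
apply: (@measure_unique _ _ _ G (fun k => lower (const_mx k%:R))) => //.
- exact: measurable_rVE.
- by move=> _ _ [y ->] [z ->]; exists (rV_min y z); rewrite lowerI.
- by move=> k; exists (const_mx k%:R).
- apply/seteqP; split=> // x _.
  exists (Num.bound (\sum_j `|x ord0 j|)) => // j; rewrite mxE.
  apply: le_trans (ltW (archi_boundP _)); last by rewrite sumr_ge0.
  by rewrite (bigD1 j)//= (le_trans (ler_norm _))// lerDl sumr_ge0.
- by move=> _ [z ->]; exact: lower_all.
- move=> k; apply: le_lt_trans (muD_fin e0).
  by apply: le_measure; rewrite ?inE//; apply: measurableI => //; exact: measurable_rV_le.
Qed.

(** Measures that are infinite near the origin are out of reach of the uniqueness theorem on
    intersection-stable families. They are compared on [D e], where both are finite, and [e] then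
    decreases to zero. *)
Lemma measure_eq_box B : measurable B -> mu B = nu B.
Proof.
move=> mB.
pose F (k : nat) := B `&` D k.+1%:R^-1.
have mF k : measurable (F k) by exact: measurableI.
have dF : nondecreasing_seq F.
  move=> k l kl; apply/subsetPset => x [Bx [ox xk]]; split=> //; split=> // xl.
  apply: xk => j; apply: le_trans (xl j) _; rewrite !mxE lef_pV2 ?posrE//.
  by rewrite ler_nat.
have FB : \bigcup_k F k = B `&` punctured n.
  apply/seteqP; split=> x.
    move=> [k _ [Bx [ox xk]]]; split=> //; split=> // x0; apply: xk => j.
    by rewrite x0 !mxE.
  move=> [Bx [ox x0]].
  by have [k Dk] := punctured_box (conj ox x0); exists k.
have h (m : {measure set 'rV[R]_n -> \bar R}) : m (~` punctured n) = 0%E ->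
    m \o F @ \oo --> m B.
  move=> m0; have -> : m B = m (\bigcup_k F k).
    rewrite FB -[in LHS](setIT B) -(setUv (punctured n)) setIUr.
    rewrite measureU//; last 3 first.
    - by apply: measurableI => //; exact: measurable_punctured.
    - by apply: measurableI => //; apply: measurableC; exact: measurable_punctured.
    - by rewrite setIACA setICr setI0.
    rewrite [X in (_ + X)%E](_ : _ = 0%E) ?adde0//.
    apply: (subset_measure0 _ _ _ m0) => //.
    - by apply: measurableI => //; apply: measurableC; exact: measurable_punctured.
    - by apply: measurableC; exact: measurable_punctured.
  by apply: nondecreasing_cvg_mu => //; exact: bigcup_measurable.
have h1 := h mu mu0; have h2 := h nu nu0.
have E : mu \o F = nu \o F by apply/funext => k /=; exact: mu_nuD.
by rewrite E in h1; exact: (cvg_unique _ h1 h2).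
Qed.

End two_measures.
End uniqueness.

Section nonneg_functions.
Context {R : realType} {n : nat}.
Implicit Types (g : 'rV[R]_n -> R) (D : set 'rV[R]_n).

Definition rmge0 g := measurable_fun [set: 'rV[R]_n] g /\ forall x, 0 <= g x.

Lemma rmge0_mge0 g : rmge0 g -> mge0 (fun x => (g x)%:E).
Proof.
by move=> [mg g0]; split; [exact/measurable_EFinP | move=> x; rewrite lee_fin].
Qed.

Lemma rmge0_patch D g : measurable D -> measurable_fun D g ->
  (forall x, D x -> 0 <= g x) -> rmge0 (g \_ D).
Proof.
move=> mD mg g0; split; first exact/(measurable_restrictT _ mD).
exact: restrict_ge0.
Qed.

Lemma rmge0_patchT D g : measurable D -> rmge0 g -> rmge0 (g \_ D).
Proof.
by move=> mD [mg g0]; apply: rmge0_patch => //; exact: measurable_funTS.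
Qed.

Lemma rmge0_measurable D g : rmge0 g -> measurable_fun D (fun x => (g x)%:E).
Proof. by move=> mg; apply: measurable_funTS; exact: (rmge0_mge0 mg).1. Qed.

Lemma rmge0M g1 g2 : rmge0 g1 -> rmge0 g2 -> rmge0 (fun x => g1 x * g2 x).
Proof.
move=> [m1 p1] [m2 p2]; split; first exact: measurable_funM.
by move=> x; exact: mulr_ge0.
Qed.

Lemma rmge0_comp m g (phi : 'rV[R]_m -> 'rV[R]_n) :
  measurable_fun setT phi -> rmge0 g ->
  measurable_fun [set: 'rV[R]_m] (g \o phi) /\ forall x, 0 <= (g \o phi) x.
Proof.
move=> mphi [mg g0]; split; first exact: (measurableT_comp mg mphi).
by move=> x; exact: g0.
Qed.

Lemma mge0_indic D : measurable D -> mge0 (fun x => (\1_D x)%:E : \bar R).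
Proof.
move=> mD; split; first by apply/measurable_EFinP; exact: measurable_indic.
by move=> x; rewrite lee_fin.
Qed.

Lemma mge0_epatch D (G : 'rV[R]_n -> \bar R) : measurable D -> mge0 G -> mge0 (G \_ D).
Proof.
move=> mD [mG G0]; split; last by apply: erestrict_ge0 => x _; exact: G0.
by apply/(measurable_restrictT _ mD); exact: measurable_funTS.
Qed.

End nonneg_functions.

(** * Marginals *)

Section embedding.
Context {R : realType} {d : nat}.
Implicit Types (A B : {set 'I_d}).

(** A one-sided inverse of [sub_rV A]. The value 0 off [A] is a default, invisible to functions that
    depend on the coordinates in [A] only. *)
Definition emb A (y : 'rV[R]_#|A|) : 'rV[R]_d :=
  \row_u (if [pick j | enum_val j == u] is Some j then y ord0 j else 0).

Lemma emb_val A (y : 'rV[R]_#|A|) (j : 'I_#|A|) :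
  emb y ord0 (enum_val j) = y ord0 j.
Proof.
rewrite mxE; case: pickP => [k /eqP/enum_val_inj -> //|/(_ j)].
by rewrite eqxx.
Qed.

Lemma emb_sub A (x : 'rV[R]_d) u : u \in A -> emb (sub_rV A x) ord0 u = x ord0 u.
Proof.
move=> uA; rewrite -[u in LHS](enum_rankK_in uA uA) emb_val mxE.
by rewrite enum_rankK_in.
Qed.

Lemma measurable_emb A : measurable_fun [set: 'rV[R]_#|A|] (@emb A).
Proof.
apply: measurable_fun_coordP => u; under eq_fun do rewrite mxE.
by case: pickP => [j _|_]; [exact: measurable_coord | exact: measurable_cst].
Qed.

Lemma dep_emb A (F : 'rV[R]_d -> \bar R) x : dep A F -> F (emb (sub_rV A x)) = F x.
Proof. by move=> dF; apply: dF => u uA; exact: emb_sub. Qed.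

Lemma sub_rV_eq A (x y : 'rV[R]_d) : (forall j, j \in A -> x ord0 j = y ord0 j) ->
  sub_rV A x = sub_rV A y.
Proof. by move=> xy; apply/rowP => j; rewrite !mxE xy// enum_valP. Qed.

Lemma dep_sub_rV A (G : 'rV[R]_#|A| -> \bar R) : dep A (G \o sub_rV A).
Proof. by move=> x y xy /=; rewrite (sub_rV_eq xy). Qed.

Definition pr_index A B (AB : A \subset B) (j : 'I_#|A|) : 'I_#|B| :=
  let jB := fintype.subsetP AB _ (enum_valP j) in enum_rank_in jB (enum_val j).

Definition pr A B (AB : A \subset B) : 'rV[R]_#|B| -> 'rV[R]_#|A| :=
  rd (pr_index AB).

Lemma pr_indexK A B (AB : A \subset B) j : enum_val (pr_index AB j) = enum_val j.
Proof. by rewrite enum_rankK_in//; apply: (fintype.subsetP AB); exact: enum_valP. Qed.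

Lemma pr_sub A B (AB : A \subset B) x : pr AB (sub_rV B x) = sub_rV A x.
Proof. by apply/rowP => j; rewrite !mxE pr_indexK. Qed.

Lemma measurable_pr A B (AB : A \subset B) : measurable_fun setT (pr AB).
Proof. exact: measurable_rd. Qed.

Local Notation leb n := (@lebesgue_rV R n).
Local Open Scope ereal_scope.

Lemma IntsTU A F x : mge0 F ->
  \int[leb d]_y F y = Ints (~: A)%SET (Ints A F) x :> \bar R.
Proof.
move=> mF; rewrite (IntsTE x mF) -(finset.setUCr A) finset.setUC IntsU//.
by rewrite finset.setIC finset.setICr.
Qed.

Lemma Ints_split A B F : A \subset B -> mge0 F ->
  Ints B F = Ints A (Ints (B :\: A)%SET F) :> ('rV[R]_d -> \bar R).
Proof.
move=> AB mF; rewrite -IntsU//; last by apply/setP => v; rewrite !inE; case: (v \in A).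
by congr Ints; apply/setP => v; rewrite !inE; case: (boolP (v \in A)) => //= /(fintype.subsetP AB).
Qed.

Lemma ae_sub_rV A (Q : 'rV[R]_#|A| -> Prop) :
  {ae leb #|A|, forall y, Q y} -> {ae leb d, forall x, Q (sub_rV A x)}.
Proof.
move=> [E [mE E0 QE]].
have mI := mge0_indic mE.
have := @Ints_dep_eq0 _ _ A ((fun y => (\1_E y)%:E) \o sub_rV A) 0%R.
case=> //.
- by apply: mge0_comp => //; exact: measurable_sub_rV.
- exact: dep_sub_rV.
- by rewrite -IntsE// integral_indic// setIT.
move=> N [mN N0 NE]; exists N; split => // x /= nQ; apply: NE => /=.
by rewrite indicE mem_set//; [move=> [] /eqP; rewrite oner_eq0 | exact: QE].
Qed.

(** The marginal of [U] on [A], kept as a function of the whole vector so that marginals on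
    different sets can be compared; [emb] brings it back to ['rV[R]_#|A|]. *)
Definition marg A B (U : 'rV[R]_#|B| -> \bar R) : 'rV[R]_d -> \bar R :=
  Ints (B :\: A)%SET (U \o sub_rV B).

Lemma mge0_sub_rV A (G : 'rV[R]_#|A| -> \bar R) : mge0 G ->
  mge0 (G \o sub_rV A : 'rV[R]_d -> \bar R).
Proof. by move=> mG; apply: mge0_comp => //; exact: measurable_sub_rV. Qed.

Lemma mge0_marg A B (U : 'rV[R]_#|B| -> \bar R) : mge0 U -> mge0 (marg A U).
Proof. by move=> mU; apply: mge0_Ints; exact: mge0_sub_rV. Qed.

Lemma dep_marg A B (U : 'rV[R]_#|B| -> \bar R) : A \subset B -> dep A (marg A U).
Proof.
move=> AB; have := @dep_Ints _ _ B (B :\: A)%SET _ (@dep_sub_rV B U).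
apply: dep_sub; apply/fintype.subsetP => v; rewrite !inE negb_and negbK.
by move=> /andP[/orP[|/negbTE ->]].
Qed.

Lemma measurable_pr_preimage A B (AB : A \subset B) D : measurable D ->
  measurable (pr AB @^-1` D).
Proof. by move=> mD; rewrite -[X in measurable X]setTI; exact: (measurable_pr AB). Qed.

Lemma integral_marg A B (AB : A \subset B) (U : 'rV[R]_#|B| -> \bar R) D :
  mge0 U -> measurable D ->
  \int[leb #|B|]_(z in pr AB @^-1` D) U z = \int[leb #|A|]_(y in D) marg A U (emb y).
Proof.
move=> mU mD.
have mU' := mge0_sub_rV mU; have mw := mge0_marg A mU; have dw := @dep_marg _ _ U AB.
have mw' : mge0 (marg A U \o @emb A) by apply: mge0_comp => //; exact: measurable_emb.
have mprD := measurable_pr_preimage AB mD.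
rewrite [LHS]integral_mkcond (IntsE 0%R (mge0_epatch mprD mU)).
rewrite [RHS]integral_mkcond (IntsE 0%R (mge0_epatch mD mw')).
have -> : (U \_ (pr AB @^-1` D)) \o sub_rV B =
    fun x => ((fun y => (\1_D y)%:E) \o sub_rV A) x * (U \o sub_rV B) x.
  apply/funext => x /=; rewrite epatch_indic/= muleC; congr (_%:E * _).
  rewrite !indicE; congr (_%:R); congr (nat_of_bool _).
  by apply: asbool_equiv_eq => /=; rewrite pr_sub.
have mI := mge0_sub_rV (mge0_indic mD).
rewrite (Ints_split AB); last exact: mge0M.
rewrite (@IntsZ _ _ _ A)//; last 2 first.
- exact: dep_sub_rV.
- by apply/setP => v; rewrite !inE; case: (v \in A); rewrite ?andbF.
congr (Ints A _ _); apply/funext => x /=.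
by rewrite epatch_indic/= (dep_emb x dw) muleC.
Qed.

(** Recovering a function almost everywhere from its integrals over all measurable sets requires
    integrability, hence the finiteness assumption; [marg A U] might a priori be infinite at some
    points. *)
Lemma marg_eq A B (AB : A \subset B) (u : 'rV[R]_#|A| -> \bar R)
    (U : 'rV[R]_#|B| -> \bar R) : mge0 u -> mge0 U ->
  (forall D, measurable D -> \int[leb #|A|]_(y in D) u y =
     \int[leb #|B|]_(z in pr AB @^-1` D) U z) ->
  \int[leb #|A|]_y u y < +oo ->
  {ae leb d, forall x, u (sub_rV A x) = marg A U x}.
Proof.
move=> mu mU H ufin.
have mw := mge0_marg A mU; have dw := @dep_marg _ _ U AB.
have mw' : mge0 (marg A U \o @emb A) by apply: mge0_comp => //; exact: measurable_emb.
have : ae_eq (leb #|A|) setT u (marg A U \o @emb A).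
  apply: integral_ae_eq => //.
  - apply/integrableP; split; first exact: mu.1.
    by under eq_integral => y _ do rewrite gee0_abs ?mu.2//.
  - exact: mw'.1.
  by move=> D _ mD; rewrite H// integral_marg.
move=> aeq.
have : {ae leb #|A|, forall y, u y = marg A U (emb y)} by apply: filterS aeq => y /= ->.
by move/ae_sub_rV; apply: filterS => x /=; rewrite (dep_emb x dw).
Qed.

(** Marginalization contracts L1 distance: the triangle inequality is applied under the integral
    over [B] minus [A]. It is written with sums, since a difference of two possibly infinite
    integrals would be meaningless. *)
Lemma Ints_contract A B (AB : A \subset B) (u w U W : 'rV[R]_d -> R) x :
  rmge0 u -> rmge0 w -> rmge0 U -> rmge0 W ->
  dep A (fun x => (u x)%:E) -> dep A (fun x => (w x)%:E) ->
  dep B (fun x => (U x)%:E) -> dep B (fun x => (W x)%:E) ->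
  {ae leb d, forall x, (u x)%:E = Ints (B :\: A)%SET (fun x => (U x)%:E) x} ->
  {ae leb d, forall x, (w x)%:E = Ints (B :\: A)%SET (fun x => (W x)%:E) x} ->
  Ints A (fun x => `|u x - w x|%:E) x <= Ints B (fun x => `|U x - W x|%:E) x.
Proof.
move=> mu mw mU mW du dw dU dW uU wW.
have mD (f g : 'rV[R]_d -> R) : rmge0 f -> rmge0 g -> mge0 (fun x => `|f x - g x|%:E).
  move=> [mf _] [mg _]; split; last by move=> z; rewrite lee_fin.
  by apply/measurable_EFinP; apply: measurableT_comp => //; exact: measurable_funB.
rewrite (Ints_split AB); last exact: mD.
apply: (Ints_dep_ae_le (A := A)).
- exact: mD.
- by apply: mge0_Ints; exact: mD.
- by move=> y z yz; have [-> ->] := (EFin_inj (du _ _ yz), EFin_inj (dw _ _ yz)).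
- have dUW : dep B (fun x => `|U x - W x|%:E).
    by move=> y z yz; have [-> ->] := (EFin_inj (dU _ _ yz), EFin_inj (dW _ _ yz)).
  apply: dep_sub (@dep_Ints _ _ B (B :\: A)%SET _ dUW); apply/fintype.subsetP => v.
  by rewrite !inE negb_and negbK => /andP[/orP[|/negbTE ->]].
have le (f g : 'rV[R]_d -> R) : rmge0 f -> rmge0 g -> forall x,
    Ints (B :\: A)%SET (fun x => (f x)%:E) x <= Ints (B :\: A)%SET (fun x => (g x)%:E) x
      + Ints (B :\: A)%SET (fun x => `|f x - g x|%:E) x.
  move=> mf mg z; rewrite /Ints -[leRHS]/((fun z => _ + _) z) -intsD//; last 2 first.
  - exact: rmge0_mge0.
  - exact: mD.
  apply: ints_le; first exact: rmge0_mge0.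
  - by apply: mge0D; [exact: rmge0_mge0 | exact: mD].
  by move=> y; rewrite -EFinD lee_fin -lerBlDl ler_norm.
near=> y.
have uy : (u y)%:E = Ints (B :\: A)%SET (fun x => (U x)%:E) y by near: y.
have wy : (w y)%:E = Ints (B :\: A)%SET (fun x => (W x)%:E) y by near: y.
have [uw|wu] := leP (w y) (u y).
  have := le _ _ mU mW y; rewrite -uy -wy => h.
  by rewrite ger0_norm ?subr_ge0// EFinB leeBlDl.
have := le _ _ mW mU y; rewrite -uy -wy => h.
rewrite [`|u y - _|%R]distrC gtr0_norm ?subr_gt0// EFinB leeBlDl//.
by under [X in _ + ints _ X _]eq_fun do rewrite distrC.
Unshelve. all: by end_near. Qed.

End embedding.

(** * The L1 estimate along a running intersection order *)

Section real_densities.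
Context {R : realType} {d : nat}.
Implicit Types (a b c : 'rV[R]_d -> R) (A B : {set 'I_d}).
Local Notation leb := (@lebesgue_rV R d).
Local Open Scope ereal_scope.

Definition rdep A a := forall x y : 'rV[R]_d,
  (forall j, j \in A -> x ord0 j = y ord0 j) -> a x = a y.

Lemma rdep_dep A a : rdep A a -> dep A (fun x => (a x)%:E).
Proof. by move=> da x y /da ->. Qed.

Lemma rdep_sub A B a : A \subset B -> rdep A a -> rdep B a.
Proof. by move=> /fintype.subsetP AB da x y xy; apply: da => j /AB; exact: xy. Qed.

Lemma rmge0V c : rmge0 c -> rmge0 (fun x => (c x)^-1)%R.
Proof.
move=> [mc c0]; split; last by move=> x; rewrite invr_ge0.
have -> : (fun x => (c x)^-1)%R = (fun x => c x `^ (-1))%R.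
  by apply/funext => x; rewrite powR_inv1.
exact: (measurableT_comp (measurable_powR _) mc).
Qed.

Lemma rmge0_dist a b : rmge0 a -> rmge0 b -> rmge0 (fun x => `|a x - b x|)%R.
Proof.
move=> [ma _] [mb _]; split=> //.
by apply: measurableT_comp => //; exact: measurable_funB.
Qed.

Lemma rmge0_prod (I : finType) (Q : pred I) (g : I -> 'rV[R]_d -> R) :
  (forall i, Q i -> rmge0 (g i)) -> rmge0 (fun x => \prod_(i | Q i) g i x)%R.
Proof.
move=> mg; split; last by move=> x; apply: prodr_ge0 => i /mg [].
under eq_fun do rewrite -big_filter.
by apply: measurable_prod => i; rewrite mem_filter => /andP[/mg[]].
Qed.

(** The indicator of [c = 0] does not involve the coordinates in [A], so it passes through the
    integral and leaves a function of zero total mass. This makes the convention [x / 0 = 0]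
    harmless in the quotients [b / c]. *)
Lemma ae_eq0_of_Ints A b c : rmge0 b -> rmge0 c -> rdep (~: A)%SET c ->
  {ae leb, forall x, Ints A (fun x => (b x)%:E) x <= (c x)%:E} ->
  {ae leb, forall x, c x = 0%R -> b x = 0%R}.
Proof.
move=> mb mc dc H.
pose I x : R := \1_[set x | c x = 0%R] x.
have mI : rmge0 I.
  split=> [|x]; last by [].
  apply: measurable_indic; rewrite (_ : mkset _ = c @^-1` [set 0%R])//.
  by rewrite -[X in measurable X]setTI; exact: mc.1.
have IcE x y : c x = c y -> I x = I y.
  by move=> e; rewrite /I !indicE; congr (nat_of_bool _)%:R; apply: asbool_equiv_eq; rewrite /= e.
have mF : mge0 (fun x => (I x * b x)%:E) by exact: rmge0_mge0 (rmge0M mI mb).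
have e0 : Ints A (fun x => (I x * b x)%:E) = fun x => (I x)%:E * Ints A (fun x => (b x)%:E) x.
  rewrite -(@IntsZ _ _ A (~: A)%SET)//.
  - exact: rmge0_mge0.
  - exact: rmge0_mge0.
  - by move=> x y /dc /IcE ->.
  - by rewrite finset.setICr.
have H0 : \int[leb]_x (I x * b x)%:E = 0.
  rewrite (IntsTU A 0%R mF); apply/eqP; rewrite eq_le (mge0_Ints _ (mge0_Ints _ mF)).2 andbT.
  rewrite -[leRHS](ints0 (enum (~: A)%SET) (0%R : 'rV[R]_d)).
  apply: (Ints_dep_ae_le (A := (~: A)%SET)).
  - exact: mge0_Ints.
  - exact: mge0_cst.
  - by apply: indep_dep; rewrite finset.setCK; exact: indep_ints.
  - by [].
  apply: filterS H => x Hx; rewrite e0 /I indicE.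
  case: (boolP (x \in _)) => [/set_mem /= cx|_]; last by rewrite mul0e.
  by rewrite mul1e -[0]/(0%R%:E) -cx.
have := (ge0_integral_eq0P mF).1 H0; apply: filterS => x [+] cx.
by rewrite /I indicE mem_set// mul1r.
Qed.

Lemma IntsD A (F G : 'rV[R]_d -> \bar R) x : mge0 F -> mge0 G ->
  Ints A (fun x => F x + G x) x = Ints A F x + Ints A G x.
Proof. by move=> mF mG; rewrite /Ints intsD. Qed.

(** For [g = 0] the left-hand side vanishes because [f / 0 = 0], so the bound holds on the zero set
    of the denominator too. *)
Lemma mule_div_le (f g : R) (h : \bar R) : (0 <= f)%R -> (0 <= g)%R -> h <= g%:E ->
  (f / g)%:E * h <= f%:E.
Proof.
move=> f0 g0 hg; apply: (@le_trans _ _ ((f / g)%:E * g%:E)).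
  by apply: lee_wpmul2l => //; rewrite lee_fin divr_ge0.
rewrite -EFinM lee_fin; have [->|gn0] := eqVneq g 0%R; first by rewrite mulr0.
by rewrite divfK.
Qed.

Lemma IntsZr A B (f g : 'rV[R]_d -> R) : rmge0 f -> rmge0 g -> rdep B f ->
  (A :&: B = finset.set0)%SET ->
  Ints A (fun x => (f x * g x)%:E) = fun x => (f x)%:E * Ints A (fun x => (g x)%:E) x.
Proof.
move=> mf mg df AB; rewrite -(@IntsZ _ _ A B _ (fun x => (f x)%:E)) //.
- exact: rmge0_mge0.
- exact: rmge0_mge0.
- exact: rdep_dep.
Qed.

Section step.
Variables (U C : {set 'I_d}) (a a' b b' c c' : 'rV[R]_d -> R).
Local Notation S := (U :&: C)%SET.
Hypotheses (ma : rmge0 a) (ma' : rmge0 a') (mb : rmge0 b) (mb' : rmge0 b')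
  (mc : rmge0 c) (mc' : rmge0 c').
Hypotheses (da : rdep U a) (da' : rdep U a') (db : rdep C b) (db' : rdep C b')
  (dc : rdep S c) (dc' : rdep S c').
Hypothesis h1 : {ae leb, forall x, Ints (U :\: C)%SET (fun x => (a x)%:E) x <= (c x)%:E}.
Hypothesis h3 : {ae leb, forall x, Ints (C :\: U)%SET (fun x => (b' x)%:E) x <= (c' x)%:E}.

Let disj A B : (A :&: (B :\: A) = finset.set0)%SET.
Proof. by apply/setP => v; rewrite !inE; case: (v \in A). Qed.

Let quot x := (b' x / c' x)%R.
Let dist x := `|b x / c x - b' x / c' x|%R.

Let mquot : rmge0 quot. Proof. exact: rmge0M (rmge0V mc'). Qed.
Let mdist : rmge0 dist.
Proof. exact: rmge0_dist (rmge0M mb (rmge0V mc)) mquot. Qed.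

Let SC : (S \subset C)%SET. Proof. exact: subsetIr. Qed.
Let SU : (S \subset U)%SET. Proof. exact: subsetIl. Qed.

Let rdep_div A (f g : 'rV[R]_d -> R) : rdep A f -> rdep A g -> rdep A (fun x => f x / g x)%R.
Proof. by move=> df dg x y xy; rewrite (df _ _ xy) (dg _ _ xy). Qed.

(* a b / c - a' b' / c' = (a - a') b' / c' + a (b / c - b' / c'); in the first term
   integrate out C \ U, in the second U \ C and then the rest of C off S. *)
Lemma L1_step x :
  Ints (U :|: C)%SET (fun x => `|a x * b x / c x - a' x * b' x / c' x|%:E) x <=
  Ints U (fun x => `|a x - a' x|%:E) x + Ints C (fun x => `|b x - b' x|%:E) x
  + Ints S (fun x => `|c x - c' x|%:E) x.
Proof.
pose T1 x := (`|a x - a' x| * quot x)%R.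
pose T2 x := (a x * dist x)%R.
have mT1 : rmge0 T1 by exact: rmge0M (rmge0_dist ma ma') mquot.
have mT2 : rmge0 T2 by exact: rmge0M.
have UCU : (U :|: C = U :|: (C :\: U))%SET by apply/setP => v; rewrite !inE; case: (v \in U).
have UCC : (U :|: C = C :|: (U :\: C))%SET.
  by apply/setP => v; rewrite !inE; case: (v \in C); rewrite ?orbT ?orbF.
apply: (@le_trans _ _ (Ints (U :|: C)%SET (fun x => (T1 x)%:E) x +
    Ints (U :|: C)%SET (fun x => (T2 x)%:E) x)).
  rewrite -IntsD; try exact: rmge0_mge0.
  apply: ints_le; first exact: rmge0_mge0 (rmge0_dist (rmge0M (rmge0M ma mb) (rmge0V mc))
    (rmge0M (rmge0M ma' mb') (rmge0V mc'))).
  - by apply: mge0D; exact: rmge0_mge0.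
  move=> y; rewrite -EFinD lee_fin /T1 /T2 /quot /dist.
  have -> : (a y * b y / c y - a' y * b' y / c' y =
    (a y - a' y) * (b' y / c' y) + a y * (b y / c y - b' y / c' y))%R by ring.
  apply: le_trans (ler_normD _ _) _.
  by rewrite !normrM (ger0_norm (ma.2 y)) (ger0_norm (mb'.2 y)) (ger0_norm ((rmge0V mc').2 y)).
rewrite -addeA; apply: leeD.
  rewrite UCU IntsU//; last exact: rmge0_mge0.
  rewrite (_ : Ints (C :\: U)%SET _ = fun x => (`|a x - a' x| / c' x)%:E *
      Ints (C :\: U)%SET (fun x => (b' x)%:E) x); last first.
    rewrite -(@IntsZr _ U)//; last 3 first.
    - exact: rmge0M (rmge0_dist ma ma') (rmge0V mc').
    - apply: rdep_div; last exact: rdep_sub dc'.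
      by move=> y z yz; rewrite (da yz) (da' yz).
    - by rewrite finset.setIC.
    by congr (Ints _); apply/funext => y; rewrite /T1 /quot; congr _%:E; ring.
  apply: (Ints_dep_ae_le (A := U)).
  - apply: mge0M; last exact: mge0_Ints (rmge0_mge0 mb').
    exact: rmge0_mge0 (rmge0M (rmge0_dist ma ma') (rmge0V mc')).
  - exact: rmge0_mge0 (rmge0_dist ma ma').
  - move=> y z yz; congr (_%:E * _).
      by rewrite (da yz) (da' yz) (rdep_sub SU dc' yz).
    have : dep (C :\: (C :\: U))%SET (Ints (C :\: U)%SET (fun x => (b' x)%:E)).
      exact: (@dep_Ints _ _ C _ _ (rdep_dep db')).
    apply; move=> j; rewrite !inE negb_and negbK => /andP[/orP[jU _|/negbTE -> //]].
    exact: yz.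
  - by move=> y z yz; rewrite (da yz) (da' yz).
  by apply: filterS h3 => y; apply: mule_div_le => //; exact: mc'.2.
(* Where [c'] vanishes so does [b'], almost everywhere; the left-hand side of the pointwise bound
   below then reduces to [|b|], which is [|b - b'|]. *)
have c'b' := ae_eq0_of_Ints mb' mc' _ h3.
(* After the integration over [U] minus [C], the factor [a] is replaced by its bound [c], and
   [c |b / c - b' / c'|] is at most [|b - b'| + |c - c'| b' / c']. The last term contributes
   [|c - c'|] once [b'] is integrated down to the separator. *)
apply: (@le_trans _ _ (Ints C (fun x => `|b x - b' x|%:E + (`|c x - c' x| / c' x * b' x)%:E) x)).
  rewrite UCC IntsU//; last exact: rmge0_mge0.
  rewrite (_ : Ints (U :\: C)%SET _ = fun x => (dist x)%:E *
      Ints (U :\: C)%SET (fun x => (a x)%:E) x); last first.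
    rewrite -(@IntsZr _ C)//; last 2 first.
    - by move=> y z yz; rewrite /dist /quot (db yz) (db' yz) (rdep_sub SC dc yz) (rdep_sub SC dc' yz).
    - by rewrite finset.setIC.
    by congr (Ints _); apply/funext => y; rewrite /T2 mulrC.
  have mE : mge0 (fun x => `|b x - b' x|%:E + (`|c x - c' x| / c' x * b' x)%:E).
    apply: mge0D; first exact: rmge0_mge0 (rmge0_dist mb mb').
    exact: rmge0_mge0 (rmge0M (rmge0M (rmge0_dist mc mc') (rmge0V mc')) mb').
  apply: (Ints_dep_ae_le (A := C)) => //.
  - by apply: mge0M; [exact: rmge0_mge0 | exact: mge0_Ints (rmge0_mge0 ma)].
  - move=> y z yz; congr (_%:E * _).
      by rewrite /dist /quot (db yz) (db' yz) (rdep_sub SC dc yz) (rdep_sub SC dc' yz).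
    have : dep (U :\: (U :\: C))%SET (Ints (U :\: C)%SET (fun x => (a x)%:E)).
      exact: (@dep_Ints _ _ U _ _ (rdep_dep da)).
    apply; move=> j; rewrite !inE negb_and negbK => /andP[/orP[jU _|/negbTE -> //]].
    exact: yz.
  - by move=> y z yz; rewrite (db yz) (db' yz) (rdep_sub SC dc yz) (rdep_sub SC dc' yz).
  apply: filterS2 h1 (c'b' _); last first.
    by apply: rdep_sub dc'; apply/fintype.subsetP => v; rewrite !inE negb_and negbK => /andP[-> _].
  move=> y hy cb; apply: (@le_trans _ _ ((dist y)%:E * (c y)%:E)).
    by apply: lee_wpmul2l hy; rewrite lee_fin; exact: mdist.2.
  rewrite -EFinM -EFinD lee_fin /dist /quot.
  have [cy0|c0] := eqVneq (c y) 0%R.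
    by rewrite cy0 mulr0 addr_ge0// mulr_ge0 ?mb'.2// divr_ge0// mc'.2.
  rewrite -[X in (_ * X <= _)%R]ger0_norm ?mc.2// -normrM.
  have [c'0|c'0] := eqVneq (c' y) 0%R.
    by rewrite c'0 invr0 (cb c'0) !mulr0 !subr0 addr0 divfK.
  have -> : ((b y / c y - b' y / c' y) * c y = (b y - b' y) + (c' y - c y) * (b' y / c' y))%R.
    by field; rewrite c0 c'0.
  apply: le_trans (ler_normD _ _) _; rewrite lerD2l normrM distrC.
  by rewrite (ger0_norm (mquot.2 y)) mulrAC mulrA.
rewrite IntsD; last 2 first.
- exact: rmge0_mge0 (rmge0_dist mb mb').
- exact: rmge0_mge0 (rmge0M (rmge0M (rmge0_dist mc mc') (rmge0V mc')) mb').
apply: leeD2l.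
rewrite (Ints_split SC); last first.
  exact: rmge0_mge0 (rmge0M (rmge0M (rmge0_dist mc mc') (rmge0V mc')) mb').
have CS : (C :\: S = C :\: U)%SET.
  by apply/setP => v; rewrite !inE; case: (v \in C); rewrite ?andbT ?andbF.
rewrite CS (@IntsZr _ S); last 4 first.
- exact: rmge0M (rmge0_dist mc mc') (rmge0V mc').
- exact: mb'.
- by move=> y z yz; rewrite (dc yz) (dc' yz).
- by apply/setP => v; rewrite !inE; case: (v \in U); rewrite ?andbF.
apply: (Ints_dep_ae_le (A := S)).
- apply: mge0M; last exact: mge0_Ints (rmge0_mge0 mb').
  exact: rmge0_mge0 (rmge0M (rmge0_dist mc mc') (rmge0V mc')).
- exact: rmge0_mge0 (rmge0_dist mc mc').
- move=> y z yz; congr (_%:E * _); first by rewrite (dc yz) (dc' yz).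
  have : dep (C :\: (C :\: U))%SET (Ints (C :\: U)%SET (fun x => (b' x)%:E)).
    exact: (@dep_Ints _ _ C _ _ (rdep_dep db')).
  apply; move=> j; rewrite !inE negb_and negbK => /andP[/orP[jU jC|/negbTE -> //]].
  by apply: yz; rewrite inE jU.
- by move=> y z yz; rewrite (dc yz) (dc' yz).
by apply: filterS h3 => y; apply: mule_div_le => //; exact: mc'.2.
Qed.
End step.

Section chain.
Variables (N : nat) (C : 'I_N.+1 -> {set 'I_d}).
Hypothesis C_rip : running_intersection C.

Definition upto (k : nat) : {set 'I_d} := (\bigcup_(j < N.+1 | (j < k)%N) C j)%SET.

Lemma separatorE i : separator C i = (upto i :&: C i)%SET.
Proof. by rewrite finset.setIC. Qed.

Lemma uptoS (i : 'I_N.+1) : upto i.+1 = (upto i :|: C i)%SET.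
Proof.
rewrite /upto (bigD1 i)//= finset.setUC; congr (_ :|: _)%SET.
by apply: eq_bigl => j; rewrite ltnS ltn_neqAle andbC.
Qed.

Lemma sub_upto (j : 'I_N.+1) k : (j < k)%N -> C j \subset upto k.
Proof. by move=> jk; rewrite (finset.bigcup_sup j). Qed.

Variables (b b' c c' : 'I_N.+1 -> 'rV[R]_d -> R).
Hypotheses (mb : forall i, rmge0 (b i)) (mb' : forall i, rmge0 (b' i)).
Hypotheses (mc : forall i : 'I_N.+1, (0 < i)%N -> rmge0 (c i))
  (mc' : forall i : 'I_N.+1, (0 < i)%N -> rmge0 (c' i)).
Hypotheses (db : forall i, rdep (C i) (b i)) (db' : forall i, rdep (C i) (b' i)).
Hypotheses (dc : forall i : 'I_N.+1, (0 < i)%N -> rdep (separator C i) (c i))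
  (dc' : forall i : 'I_N.+1, (0 < i)%N -> rdep (separator C i) (c' i)).
(** Asked for every clique [C j] containing the separator, because running intersection carries the
    bound through an earlier clique; on the limit side the clique [C i] itself is enough. *)
Hypothesis bc : forall i j : 'I_N.+1, (0 < i)%N -> (j <= i)%N -> separator C i \subset C j ->
  {ae leb, forall x, Ints (C j :\: separator C i)%SET (fun x => (b j x)%:E) x <= (c i x)%:E}.
Hypothesis bc' : forall i : 'I_N.+1, (0 < i)%N ->
  {ae leb, forall x, Ints (C i :\: separator C i)%SET (fun x => (b' i x)%:E) x <= (c' i x)%:E}.

Definition chain_product (g s : 'I_N.+1 -> 'rV[R]_d -> R) (k : nat) x : R :=
  ((\prod_(j < N.+1 | (j < k)%N) g j x) /
   (\prod_(j < N.+1 | (0 < j)%N && (j < k)%N) s j x))%R.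

Lemma chain_product1 g s x : chain_product g s 1 x = g ord0 x.
Proof.
rewrite /chain_product (big_pred1 ord0) ?big_pred0 ?divr1//.
  by move=> j; case: (val j).
by move=> j; rewrite ltnS leqn0.
Qed.

Lemma chain_productS g s (i : 'I_N.+1) x : (0 < i)%N ->
  chain_product g s i.+1 x = (chain_product g s i x * g i x / s i x)%R.
Proof.
move=> i0; rewrite /chain_product (bigD1 i)//= [X in (_ / X)%R](bigD1 i)//= ?i0 ?ltnSn//.
rewrite (eq_bigl (fun j : 'I_N.+1 => (j < i)%N)); last first.
  by move=> j; rewrite ltnS ltn_neqAle andbC.
rewrite [X in (_ / (_ * X))%R](eq_bigl (fun j : 'I_N.+1 => (0 < j)%N && (j < i)%N)); last first.
  by move=> j; rewrite -andbA; congr (_ && _); rewrite ltnS [in RHS]ltn_neqAle andbC.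
rewrite invfM; ring.
Qed.

Lemma rmge0_chain g s k : (forall i, rmge0 (g i)) ->
  (forall i : 'I_N.+1, (0 < i)%N -> rmge0 (s i)) -> rmge0 (chain_product g s k).
Proof.
move=> mg ms; apply: (rmge0M (rmge0_prod (fun i _ => mg i)) (rmge0V (rmge0_prod _))).
by move=> i /andP[/ms].
Qed.

Lemma rdep_chain g s k : (forall i, rdep (C i) (g i)) ->
  (forall i : 'I_N.+1, (0 < i)%N -> rdep (separator C i) (s i)) ->
  rdep (upto k) (chain_product g s k).
Proof.
move=> dg ds x y xy; rewrite /chain_product; congr (_ / _)%R.
  by apply: eq_bigr => j jk; apply: dg => u uj; apply: xy; exact: (fintype.subsetP (sub_upto jk)).
apply: eq_bigr => j /andP[j0 jk]; apply: ds => // u /setIP[uj _]; apply: xy.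
exact: (fintype.subsetP (sub_upto jk)).
Qed.

Let p := chain_product b c.
Let p' := chain_product b' c'.
Let mp k : rmge0 (p k). Proof. exact: rmge0_chain. Qed.
Let mp' k : rmge0 (p' k). Proof. exact: rmge0_chain. Qed.
Let E (f : 'rV[R]_d -> R) x := (f x)%:E.

(* The marginal of the partial product on each earlier clique is dominated by that
   clique's density, whence, by running intersection, by every later separator's. *)
Let separator_marginal (i l : 'I_N.+1) : (0 < i)%N -> (l < i)%N ->
  separator C i \subset C l ->
  {ae leb, forall x, Ints (upto i :\: C l)%SET (E (p i)) x <= (b l x)%:E} ->
  {ae leb, forall x, Ints (upto i :\: C i)%SET (E (p i)) x <= (c i x)%:E}.
Proof.
move=> i0 li SCl H.
have -> : (upto i :\: C i = (C l :\: separator C i) :|: (upto i :\: C l))%SET.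
  apply/setP => v; rewrite separatorE !inE.
  have := fintype.subsetP SCl v; rewrite separatorE inE.
  have := fintype.subsetP (sub_upto li) v.
  by case: (v \in C l) (v \in C i) (v \in upto i) => -[] [] //= h1 h2; try (by have := h1 isT); try (by have := h2 isT).
rewrite IntsU; last 2 first.
- exact: rmge0_mge0.
- by apply/setP => v; rewrite !inE; case: (v \in C l); rewrite ?andbF.
have := Ints_ae_le (C l :\: separator C i)%SET (mge0_Ints _ (rmge0_mge0 (mp i)))
  (rmge0_mge0 (mb l)) H.
by apply: filterS2 (bc i0 (ltnW li) SCl) => x h1 h2; exact: le_trans h2 h1.
Qed.

(** Induction on the last clique. For [j = i] the new factor [b i / c i] depends on [C i] only, and
    the old product integrates to at most [c i] by [separator_marginal]. For [j < i] the new
    vertices are integrated first: the new factor then contributes at most one, and the bound for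
    the old product is inherited. *)
Let chain_marginal k : forall i j : 'I_N.+1, val i = k -> (j <= i)%N ->
  {ae leb, forall x, Ints (upto i.+1 :\: C j)%SET (E (p i.+1)) x <= (b j x)%:E}.
Proof.
elim: k => [|k ih] i j ik ji.
  have -> : i = ord0 by exact: val_inj.
  have -> : j = ord0 by apply: val_inj; apply/eqP; rewrite -leqn0 -ik.
  have -> : (upto 1 :\: C ord0 = finset.set0)%SET.
    rewrite (uptoS ord0) (_ : upto 0 = finset.set0) ?finset.set0U ?finset.setDv//.
    by rewrite /upto big_pred0.
  apply: aeW => x; rewrite /Ints finset.enum_set0 /= /E /p chain_product1//.
have i0 : (0 < i)%N by rewrite ik.
have ki : (k < N.+1)%N by apply: ltnW; rewrite -ik; exact: ltn_ord.
pose i' := Ordinal ki.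
have i'i : i'.+1 = i by rewrite ik.
have {}ih (j' : 'I_N.+1) : (j' < i)%N -> {ae leb, forall x, Ints (upto i :\: C j')%SET (E (p i)) x <= (b j' x)%:E}.
  by move=> j'i; rewrite -i'i; apply: ih => //; rewrite -ltnS i'i.
have [l li SCl] := C_rip i0.
have H1 := separator_marginal i0 li SCl (ih l li).
have pS x : p i.+1 x = (p i x * b i x / c i x)%R by exact: chain_productS.
have SC := subsetIl (C i) (\bigcup_(j < N.+1 | (j < i)%N) C j)%SET.
have [->|nji] := eqVneq j i.
  have -> : (upto i.+1 :\: C i = upto i :\: C i)%SET.
    by rewrite uptoS; apply/setP => v; rewrite !inE; case: (v \in C i); rewrite ?orbF.
  rewrite (_ : E (p i.+1) = fun x => ((b i x / c i x) * p i x)%:E); last first.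
    by apply/funext => x; rewrite /E pS; congr _%:E; ring.
  rewrite (@IntsZr _ (C i)); last 4 first.
  - exact: rmge0M (mb i) (rmge0V (mc i0)).
  - exact: mp.
  - by move=> x y xy; rewrite (db xy) (rdep_sub SC (dc i0) xy).
  - by apply/setP => v; rewrite !inE; case: (v \in C i); rewrite ?andbF.
  apply: filterS H1 => x Hx; apply: mule_div_le => //; first exact: (mb i).2.
  exact: (mc i0).2.
have {}ji : (j < i)%N by rewrite ltn_neqAle ji andbT.
have -> : (upto i.+1 :\: C j = (upto i :\: C j) :|: (C i :\: upto i))%SET.
  rewrite uptoS; apply/setP => v; rewrite !inE.
  have := fintype.subsetP (sub_upto ji) v.
  by case: (v \in C j) (v \in C i) (v \in upto i) => -[] [] // /(_ isT).
rewrite IntsU; last 2 first.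
- exact: rmge0_mge0.
- by apply/setP => v; rewrite !inE; case: (v \in upto i); rewrite ?andbF.
rewrite (_ : E (p i.+1) = fun x => ((p i x / c i x) * b i x)%:E); last first.
  by apply/funext => x; rewrite /E pS; congr _%:E; ring.
rewrite (@IntsZr _ (upto i)); last 4 first.
- exact: rmge0M (mp i) (rmge0V (mc i0)).
- exact: mb.
- move=> x y xy; rewrite /p (rdep_chain db dc xy); congr (_ / _)%R.
  by apply: dc => // v; rewrite separatorE => /setIP[vi _]; exact: xy.
- by apply/setP => v; rewrite !inE; case: (v \in upto i); rewrite ?andbF.
have CS : (C i :\: upto i = C i :\: separator C i)%SET.
  by rewrite separatorE; apply/setP => v; rewrite !inE; case: (v \in C i); rewrite ?andbT ?andbF.
have mq : mge0 (fun x => (p i x / c i x)%:E * Ints (C i :\: upto i)%SET (fun x => (b i x)%:E) x).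
  apply: mge0M; first exact: rmge0_mge0 (rmge0M (mp i) (rmge0V (mc i0))).
  exact: mge0_Ints (rmge0_mge0 (mb i)).
have H2 : {ae leb, forall x, (p i x / c i x)%:E * Ints (C i :\: upto i)%SET (E (b i)) x <= E (p i) x}.
  have := bc i0 (leqnn i) SC; rewrite -CS; apply: filterS => x Hx.
  by apply: mule_div_le => //; [exact: (mp i).2 | exact: (mc i0).2].
have := Ints_ae_le (upto i :\: C j)%SET mq (rmge0_mge0 (mp i)) H2.
by apply: filterS2 (ih j ji) => x h1 h2; exact: le_trans h2 h1.
Qed.

(** One use of [L1_step] per clique, with the partial product before [i] in the role of [a]. Each
    step has constant one, so the errors simply add up. *)
Lemma chain_L1 k (i : 'I_N.+1) x : val i = k ->
  Ints (upto i.+1) (fun x => `|p i.+1 x - p' i.+1 x|%:E) x <=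
  \sum_(j < N.+1 | (j <= i)%N) Ints (C j) (fun x => `|b j x - b' j x|%:E) x +
  \sum_(j < N.+1 | (0 < j)%N && (j <= i)%N)
    Ints (separator C j) (fun x => `|c j x - c' j x|%:E) x.
Proof.
elim: k i => [|k ih] i ik.
  have -> : i = ord0 by exact: val_inj.
  rewrite (big_pred1 ord0); last by move=> j; rewrite leqn0.
  rewrite big_pred0; last by move=> j; case: (val j).
  rewrite adde0 (uptoS ord0) (_ : upto 0 = finset.set0) ?finset.set0U; last first.
    by rewrite /upto big_pred0.
  rewrite le_eqVlt; apply/orP; left; apply/eqP; congr Ints.
  by apply/funext => y; rewrite /p /p' !chain_product1.
have i0 : (0 < i)%N by rewrite ik.
have ki : (k < N.+1)%N by apply: ltnW; rewrite -ik; exact: ltn_ord.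
pose i' := Ordinal ki.
have i'i : i'.+1 = i by rewrite ik.
have [l li SCl] := C_rip i0.
have H1 : {ae leb, forall x, Ints (upto i :\: C i)%SET (E (p i)) x <= (c i x)%:E}.
  apply: (separator_marginal i0 li SCl).
  rewrite -i'i; apply: (@chain_marginal k) => //.
  by rewrite -ltnS i'i.
have CS : (C i :\: upto i = C i :\: separator C i)%SET.
  by rewrite separatorE; apply/setP => v; rewrite !inE; case: (v \in C i); rewrite ?andbT ?andbF.
have H3 := bc' i0; rewrite -CS in H3.
have := @L1_step _ _ (p i) (p' i) (b i) (b' i) (c i) (c' i)
  (mp i) (mp' i) (mb i) (mb' i) (mc i0) (mc' i0)
  (rdep_chain db dc) (rdep_chain db' dc') (db (i := i)) (db' (i := i)) _ _ H1 H3 x.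
rewrite -separatorE => /(_ (dc i0) (dc' i0)); rewrite -uptoS.
move=> H.
rewrite [X in Ints _ X x <= _](_ : _ = fun x =>
    `|p i x * b i x / c i x - p' i x * b' i x / c' i x|%:E); last first.
  by apply/funext => y; rewrite /p /p' !chain_productS.
apply: le_trans H _.
rewrite (bigD1 i)//= [X in _ <= _ + X](bigD1 i) ?i0//=.
have ji' (j : 'I_N.+1) : (j <= i')%N = (j < i)%N by rewrite -i'i ltnS.
rewrite (eq_bigl (fun j : 'I_N.+1 => (j <= i')%N)); last first.
  by move=> j; rewrite ji' ltn_neqAle andbC.
rewrite [X in _ <= _ + (_ + X)](eq_bigl (fun j : 'I_N.+1 => (0 < j)%N && (j <= i')%N)); last first.
  by move=> j; rewrite ji' -andbA; congr (_ && _); rewrite [in RHS]ltn_neqAle andbC.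
have := ih i' erefl; rewrite i'i => {}ih.
have aux (y1 y2 y3 y4 y5 : \bar R) : y1 <= y4 + y5 -> y1 + y2 + y3 <= y2 + y4 + (y3 + y5).
  by move=> h; rewrite [leRHS]addeACA -[leLHS]addeA [leLHS]addeC; exact: leeD2l.
exact: aux.
Qed.

End chain.

End real_densities.

(** * Cliques and separators of a connected graph *)

Section cliques_in_running_order.
Variables (d : nat) (e : rel 'I_d).
Hypotheses (d_gt0 : (0 < d)%N) (e_sym : symmetric e) (e_connected : connected_graph e).
Variables (N : nat) (C : 'I_N.+1 -> {set 'I_d}).
Hypothesis C_cliques : forall A, max_clique e A <-> exists i, A = C i.
Hypothesis C_rip : running_intersection C.

Lemma clique_cover A : is_clique e A -> exists i, A \subset C i.
Proof.
by move=> /maxset_exists[B /C_cliques[i ->] AB]; exists i.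
Qed.

Lemma is_clique1 u : is_clique e [set u]%SET.
Proof.
apply/'forall_implyP => x /finset.set1P ->; apply/'forall_implyP => y /finset.set1P ->.
by rewrite eqxx.
Qed.

Lemma vertex_in_clique u : exists i, u \in C i.
Proof. by have [i] := clique_cover (is_clique1 u); rewrite finset.sub1set; exists i. Qed.

Lemma edge_in_clique u v : e u v -> exists i, u \in C i /\ v \in C i.
Proof.
move=> uv; have [|i] := @clique_cover [set u; v]%SET.
  apply/'forall_implyP => x /finset.set2P xE; apply/'forall_implyP => y /finset.set2P yE.
  by apply/implyP; case: xE => ->; case: yE => ->; rewrite ?eqxx// => _; rewrite // e_sym.
by rewrite finset.subUset !finset.sub1set => /andP[ui vi]; exists i.
Qed.

Lemma clique_neq0 i : C i != finset.set0.
Proof.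
apply/eqP => C0.
have /maxsetP[_ mx] : max_clique e (C i) by apply/C_cliques; exists i.
have := mx _ (is_clique1 (Ordinal d_gt0)); rewrite C0 finset.sub0set => /(_ isT) /setP.
by move=> /(_ (Ordinal d_gt0)); rewrite !inE eqxx.
Qed.

Lemma upto_full : upto C N.+1 = [set: 'I_d]%SET.
Proof.
apply/setP => u; rewrite inE; have [i ui] := vertex_in_clique u.
by apply/bigcupP; exists i.
Qed.

(* If a separator S_i were empty, the union T of the cliques hanging off C_i
   would be disconnected from C_0, ..., C_(i-1). *)
Lemma separator_neq0 (i : 'I_N.+1) : (0 < i)%N -> separator C i != finset.set0.
Proof.
move=> i0; apply/eqP => S0.
suff : forall k, (i < k <= N.+1)%N -> exists T : {set 'I_d},
    [/\ T \subset upto C k, C i \subset T, (T :&: upto C i = finset.set0)%SET &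
     forall j : 'I_N.+1, (j < k)%N -> C j \subset T \/ (C j :&: T = finset.set0)%SET].
  move=> /(_ N.+1); rewrite ltn_ord leqnn => /(_ isT)[T [_ CiT T0 CT]].
  have [u ui] := set0Pn _ (clique_neq0 i); have [v v0] := set0Pn _ (clique_neq0 ord0).
  have cT : fingraph.closed e (mem T).
    move=> x y /edge_in_clique[j [xj yj]].
    have [/fintype.subsetP CjT|/setP CjT] := CT j (ltn_ord j).
      by rewrite !CjT.
    have := CjT x; have := CjT y; rewrite !inE xj yj /= => -> -> //.
  have := closed_connect cT (e_connected u v).
  rewrite (fintype.subsetP CiT)// => /esym vT.
  have /setP/(_ v) := T0; rewrite !inE vT/= => /negP; apply.
  exact: (fintype.subsetP (sub_upto C (j := ord0) i0)).
elim=> [//|k ih] /andP[ik kN].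
have [iek|nik] := eqVneq k i.
  exists (C i); split=> //.
  - by rewrite iek; apply: sub_upto.
  move=> j; rewrite iek ltnS leq_eqVlt => /predU1P[/val_inj -> |ji]; first by left.
  right; apply/eqP; rewrite -finset.subset0 -S0 separatorE finset.setSI//.
  exact: sub_upto.
have {}ik : (i < k)%N by rewrite ltn_neqAle eq_sym nik -ltnS.
have {ih}[T [TU CiT T0 CT]] := ih (introT andP (conj ik (ltnW kN))).
pose k' := Ordinal kN.
have [l lk SCl] := C_rip (leq_ltn_trans (leq0n i) ik : (0 < k')%N).
have upk : upto C k.+1 = (upto C k' :|: C k')%SET by rewrite (uptoS C k').
rewrite separatorE in SCl.
have [ClT|ClT] := CT l lk; last first.
  exists T; split => //; first by rewrite upk (fintype.subset_trans TU)// finset.subsetUl.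
  move=> j; rewrite ltnS leq_eqVlt => /predU1P[jk|/CT//].
  have -> : j = k' by exact: val_inj.
  right; apply/eqP; rewrite -finset.subset0 -ClT finset.subsetI finset.subsetIr andbT.
  by apply: fintype.subset_trans SCl; rewrite finset.setIC finset.setSI.
exists (T :|: C k')%SET; split.
- by rewrite upk finset.setSU.
- by rewrite (fintype.subset_trans CiT)// finset.subsetUl.
- apply/eqP; rewrite -finset.subset0 -T0 finset.setIUl finset.subUset fintype.subxx/=.
  rewrite finset.subsetI finset.subsetIr andbT; apply: fintype.subset_trans ClT.
  apply: fintype.subset_trans SCl; rewrite finset.setIC finset.setSI//.
  by apply/bigcupsP => j ji; apply: sub_upto; exact: ltn_trans ji ik.
- move=> j; rewrite ltnS leq_eqVlt => /predU1P[jk|jk].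
    have -> : j = k' by exact: val_inj.
    by left; rewrite finset.subsetUr.
  have [CjT|CjT] := CT j jk; first by left; rewrite (fintype.subset_trans CjT)// finset.subsetUl.
  right; rewrite finset.setIUr CjT finset.set0U; apply/eqP.
  rewrite -finset.subset0 -CjT finset.subsetI finset.subsetIl/=.
  apply: fintype.subset_trans ClT; apply: fintype.subset_trans SCl.
  by rewrite finset.setSI//; exact: sub_upto.
Qed.

(** Each step is inclusion-exclusion for [upto C k] and [C k], whose intersection is the
    separator. *)
Lemma card_cliques k : (k <= N)%N ->
  (\sum_(i < N.+1 | (i <= k)%N) #|C i| =
   #|upto C k.+1| + \sum_(i < N.+1 | (0 < i <= k)%N) #|separator C i|)%N.
Proof.
elim: k => [|k ih] kN.
  rewrite (big_pred1 ord0) ?big_pred0 ?addn0//; last 2 first.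
  - by move=> j; case: (val j).
  - by move=> j; rewrite leqn0.
  rewrite (uptoS C ord0) (_ : upto C 0 = finset.set0) ?finset.set0U//.
  by rewrite /upto big_pred0.
have kN' : (k.+1 < N.+1)%N by [].
pose k' := Ordinal kN'.
have le (j : 'I_N.+1) : (j <= k)%N = (j <= k.+1)%N && (j != k').
  by rewrite -ltnS (ltn_neqAle j) andbC.
rewrite (bigD1 k')//= [in RHS](bigD1 k')//= ?leqnn//.
under eq_bigl do rewrite -le.
rewrite ih; last exact: ltnW.
rewrite [in RHS](eq_bigl (fun j : 'I_N.+1 => (0 < j <= k)%N)); last first.
  by move=> j; rewrite -andbA -le.
rewrite (uptoS C k') -[upto C k']/(upto C k.+1) separatorE finset.cardsU.
rewrite !addnA subnK; first by rewrite [(#|C k'| + _)%N]addnC.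
by rewrite (leq_trans (subset_leq_card (finset.subsetIl _ _)))// leq_addr.
Qed.

Lemma card_cliques_full :
  (\sum_i #|C i| = d + \sum_(i < N.+1 | (0 < i)%N) #|separator C i|)%N.
Proof.
have := card_cliques (leqnn N); rewrite upto_full finset.cardsT card_ord.
have leN (j : 'I_N.+1) : (j <= N)%N by rewrite -ltnS.
have -> : (\sum_(i < N.+1 | (i <= N)%N) #|C i| = \sum_i #|C i|)%N.
  by apply: eq_bigl => j; exact: leN.
by move=> ->; congr addn; apply: eq_bigl => j; rewrite leN andbT.
Qed.

End cliques_in_running_order.

(** There is one clique more than there are separators, which produces [d.+1]. These are the
    exponents of the rescaled densities: the quotient of the clique and separator powers is the
    power normalizing the density of the whole vector. *)
Lemma sum_card_cliquesS d N (C : 'I_N.+1 -> {set 'I_d}) :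
  (\sum_i #|C i| = d + \sum_(i < N.+1 | (0 < i)%N) #|separator C i|)%N ->
  (\sum_i #|C i|.+1 = d.+1 + \sum_(i < N.+1 | (0 < i)%N) #|separator C i|.+1)%N.
Proof.
move=> C_card; have S1 (Q : pred 'I_N.+1) (a : 'I_N.+1 -> nat) :
    (\sum_(i | Q i) (a i).+1 = \sum_(i | Q i) a i + #|Q|)%N.
  by under eq_bigr do rewrite -addn1; rewrite big_split /= sum1_card.
rewrite !S1 C_card card_ord (_ : #|_| = N); last first.
  rewrite -sum1_card big_mkcond big_ord_recl /= add0n.
  by rewrite (eq_bigr (fun _ => 1%N))// sum1_card card_ord.
by rewrite addnS addSn addnA.
Qed.

(** * Limit measures and their densities *)

Section measures_with_density.
Context {R : realType} {n : nat}.
Implicit Types (nu mu : {measure set 'rV[R]_n -> \bar R}) (l : 'rV[R]_n -> R).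
Local Notation leb := (@lebesgue_rV R n).

(** Stronger than [has_exponent_density]: all Borel sets replace box complements, and the value zero
    off the punctured orthant makes integrals over sets that leave the orthant meaningful. *)
Definition density_of nu l := [/\ rmge0 l, forall x, ~ punctured n x -> l x = 0 &
  forall B, measurable B -> nu B = (\int[leb]_(x in B) (l x)%:E)%E].

Definition null_hyperplanes nu := forall j (c : R), nu [set x | x ord0 j = c] = 0%E.

Lemma measurable_hyperplane (j : 'I_n) (c : R) :
  measurable [set x : 'rV[R]_n | x ord0 j = c].
Proof.
rewrite (_ : mkset _ = [set x : 'rV[R]_n | x ord0 j <= c] `&` [set x : 'rV[R]_n | c <= x ord0 j]).
  by apply: measurableI; [exact: measurable_coord_le | exact: measurable_coord_ge].
apply/seteqP; split=> x /=; first by move=> ->.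
by move=> [xc cx]; apply/eqP; rewrite eq_le xc.
Qed.

Lemma lebesgue_hyperplane (j : 'I_n) (c : R) : leb [set x : 'rV[R]_n | x ord0 j = c] = 0%E.
Proof.
have mH := measurable_hyperplane j c.
have mI := mge0_indic mH.
have : {ae leb, forall x, ((\1_[set x : 'rV[R]_n | x ord0 j = c] x)%:E = 0%E :> \bar R)}.
  apply/(ge0_integral_eq0P mI).
  rewrite (IntsTU [set j]%SET 0 mI) /Ints enum_set1 /=.
  rewrite (_ : int1 _ _ = fun _ => 0%E) ?ints0//; apply/funext => x; rewrite int1E.
  rewrite (_ : (fun t => _) = fun t => (\1_[set c : measurableTypeR R] t)%:E).
    by rewrite integral_indic//= setIT lebesgue_measure_set1.
  apply/funext => t /=; rewrite !indicE; congr (_%:R%:E); congr nat_of_bool.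
  by apply: asbool_equiv_eq => /=; rewrite updE eqxx.
move=> [E [mE E0 HE]]; apply: (subset_measure0 mH mE _ E0) => x /= xc; apply: HE => /=.
by rewrite indicE mem_set// => -[] /eqP; rewrite oner_eq0.
Qed.

Lemma null_exists nu (I : finType) (F : I -> set 'rV[R]_n) :
  (forall i, measurable (F i)) -> (forall i, nu (F i) = 0%E) ->
  nu [set x | exists i, F i x] = 0%E.
Proof.
move=> mF F0.
apply/eqP; rewrite eq_le measure_ge0 andbT (le_trans (measure_exists_le nu mF))//.
by rewrite big1.
Qed.

Lemma orthantZ (k : R) {x : 'rV[R]_n} : 0 < k -> orthant n (k *: x) <-> orthant n x.
Proof. by move=> k0; split=> ox j; have := ox j; rewrite mxE pmulr_rge0. Qed.

Lemma puncturedZ (k : R) {x : 'rV[R]_n} : 0 < k -> punctured n (k *: x) <-> punctured n x.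
Proof.
move=> k0; split=> -[ox x0]; (split; first exact/(orthantZ k0)) => x00; apply: x0.
  by rewrite x00 /= scaler0.
by move/eqP: x00; rewrite scaler_eq0 gt_eqF//= => /eqP.
Qed.

Lemma box_complZ (k : R) {x} (y : 'rV[R]_n) : 0 < k ->
  box_compl y (k *: x) <-> box_compl (k^-1 *: y) x.
Proof.
move=> k0.
have xy : rV_le (k *: x) y <-> rV_le x (k^-1 *: y).
  by split=> h j; have := h j; rewrite !mxE; rewrite ler_pdivlMl.
by split=> -[/(orthantZ k0) ox h]; split=> // /xy.
Qed.

Lemma density_null_hyperplanes nu l : density_of nu l -> null_hyperplanes nu.
Proof.
move=> [ml _ nul] j c; have mH := measurable_hyperplane j c; rewrite nul//.
apply: null_set_integral => //; last exact: lebesgue_hyperplane.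
exact: rmge0_measurable.
Qed.

Lemma density_of_punctured nu l : density_of nu l -> nu (~` punctured n) = 0%E.
Proof.
move=> [ml l0 nul]; have mp := @measurable_punctured R n.
rewrite nul; last exact: measurableC.
by apply: integral0_eq => x /= xp; rewrite l0.
Qed.

Lemma box_compl_punctured (y : 'rV[R]_n) : (forall j, 0 <= y ord0 j) ->
  box_compl y `<=` punctured n.
Proof. by move=> y0 x [ox xy]; split=> // x0; apply: xy => j; rewrite x0 mxE. Qed.

(** The measure with density [l] agrees with [nu] on box complements of positive vectors, and
    [measure_eq_box] extends this to Borel sets. In dimension zero there is no punctured [y] to
    apply the hypothesis to, but box complements are empty. *)
Lemma exponent_density_of nu l : radon_on_punctured nu ->
  has_exponent_density nu l -> density_of nu (l \_ (punctured n)).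
Proof.
move=> [nu0 nufin] [ml l0 nul].
have mp := @measurable_punctured R n.
have mlp : rmge0 (l \_ (punctured n)) by exact: rmge0_patch.
have lp0 x : ~ punctured n x -> (l \_ (punctured n)) x = 0.
  by move=> xp; rewrite patchE memNset.
have [mE E0] := rmge0_mge0 mlp.
pose m := density_measure leb mE E0.
have md : density_of m (l \_ (punctured n)) by split.
split=> // B mB; rewrite -[RHS]/(m B).
apply: measure_eq_box => //; first exact: density_of_punctured md.
- by move=> y y0; apply: nufin; exact: bounded_away_box_compl.
move=> y y0; have [[j _]|ny] := pselect (exists j : 'I_n, True); last first.
  have -> : box_compl y = set0; last by rewrite !measure0.
  apply/seteqP; split=> // x [_]; apply => j; exfalso; apply: ny.
  by exists j.
have yp : punctured n y.
  by split=> [k|y00]; [exact/ltW/y0 | have := y0 j; rewrite y00 mxE ltxx].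
rewrite [LHS]nul// [RHS]density_measureE.
apply: eq_integral => x /set_mem xb; rewrite patchE mem_set//.
by apply: box_compl_punctured xb => k; exact/ltW/y0.
Qed.

Lemma integral_scale_image (k : R) (B : set 'rV[R]_n) l : 0 < k -> measurable B ->
  rmge0 l -> (\int[leb]_(x in [set k *: x | x in B]) (l x)%:E =
    (k ^+ n)%:E * \int[leb]_(x in B) (l (k *: x))%:E)%E.
Proof.
move=> k0 mB ml; have kn0 : k != 0 by rewrite gt_eqF.
have mG : mge0 ((EFin \o l) \_ [set k *: x | x in B]).
  by apply: mge0_epatch; [exact: measurable_scale_image | exact: rmge0_mge0].
transitivity ((k ^+ n)%:E * \int[leb]_x ((EFin \o l) \_ [set k *: x | x in B]) (k *: x))%E.
  rewrite integral_scale// muleA -EFinM mulfV ?expf_neq0// mul1e.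
  exact: (integral_mkcond _ _).
congr (_ * _)%E; apply/esym; apply: (etrans (integral_mkcond _ _)).
apply: eq_integral => x _; rewrite !patchE; case: (boolP (x \in B)) => [/set_mem Bx|xB].
  by rewrite mem_set//; exists x.
rewrite memNset// => -[y By] /(scalerI kn0) xy.
by case/negP: xB; apply/mem_set; rewrite -xy.
Qed.

(** A density may have infinite mass near the origin, so equality is obtained on countably many box
    complements that exhaust the punctured orthant. *)
Lemma density_eq nu l l' : density_of nu l -> density_of nu l' ->
  (forall B, bounded_away B -> (nu B < +oo)%E) -> {ae leb, forall x, l x = l' x}.
Proof.
move=> [ml l0 nul] [ml' l0' nul'] nufin.
pose D (k : nat) := box_compl (const_mx k.+1%:R^-1 : 'rV[R]_n).
have mD k : measurable (D k) by exact: measurable_box_compl.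
have aeD k : {ae leb, forall x, D k x -> l x = l' x}.
  have : ae_eq leb (D k) (EFin \o l) (EFin \o l').
    apply: integral_ae_eq => //.
    - apply/integrableP; split; first exact: rmge0_measurable.
      under eq_integral => x _ do rewrite gee0_abs ?lee_fin ?ml.2//.
      by rewrite -nul//; apply: nufin; apply: bounded_away_box_compl => j; rewrite mxE.
    - exact: rmge0_measurable.
    by move=> E _ mE; rewrite -nul// nul'.
  by apply: filterS => x H Dx; case: (H Dx).
have : {ae leb, forall x, forall k, D k x -> l x = l' x} by exact/ae_foralln.
apply: filterS => x H; have [xp|xp] := pselect (punctured n x); last by rewrite l0// l0'.
by have [k Dk] := punctured_box xp; exact: (H k).
Qed.

End measures_with_density.

Section limit_measures.
Context {R : realType} {dT} {T : measurableType dT} {P : probability T R} {n : nat}.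
Variable Y : T -> 'rV[R]_n.
Hypothesis mY : measurable_fun setT Y.
Implicit Types (nu mu : {measure set 'rV[R]_n -> \bar R}).
Local Open Scope ereal_scope.

Lemma rv_box_compl nu (y : 'rV[R]_n) : regularly_varying P Y nu ->
  null_hyperplanes nu -> (forall j, (0 < y ord0 j)%R) ->
  t%:E * P [set w | box_compl y (t^-1 *: Y w)%R] @[t --> +oo%R] --> nu (box_compl y).
Proof.
move=> [_ rv] nh y0; apply: rv; first exact: bounded_away_box_compl.
have mHs : measurable [set x : 'rV[R]_n | exists j, x ord0 j = y ord0 j].
  by apply: measurable_exists => j; exact: measurable_hyperplane.
apply: (subset_measure0 (measurable_boundary _) mHs); first exact: boundary_box_compl.
by apply: null_exists => // j; [exact: measurable_hyperplane | exact: nh].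
Qed.

Lemma rv_unique nu mu : regularly_varying P Y nu -> null_hyperplanes nu ->
  regularly_varying P Y mu -> null_hyperplanes mu ->
  forall B, measurable B -> nu B = mu B.
Proof.
move=> rn hn rm hm; apply: measure_eq_box; [exact: rn.1.1 | exact: rm.1.1 | |].
- by move=> y y0; apply: rn.1.2; exact: bounded_away_box_compl.
move=> y y0; exact: (cvg_unique _ (rv_box_compl rn hn y0) (rv_box_compl rm hm y0)).
Qed.

(** Replacing [s] by [t * s] in the limit that defines [nu] gives [nu] and its rescaled copy the
    same mass on box complements. *)
Lemma rv_homogeneous nu : regularly_varying P Y nu -> null_hyperplanes nu ->
  homogeneous nu.
Proof.
move=> rn hn t B t0 mB.
have t0' : (0 <= t)%R := ltW t0.
have tn0 : t != 0%R by rewrite gt_eqF.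
have msc (k : R) : measurable_fun setT (fun x : 'rV[R]_n => k *: x)%R := @measurable_scale R n k.
pose m1 : {measure set 'rV[R]_n -> \bar R} :=
  measure_function_pushforward__canonical__measure_function_Measure nu (msc t^-1%R).
pose m : {measure set 'rV[R]_n -> \bar R} := mscale (NngNum t0') m1.
have mE A : m A = t%:E * nu [set x | A (t^-1 *: x)%R] by [].
rewrite scale_image//; suff -> : nu B = m B.
  by rewrite mE muleA -EFinM mulVf// mul1e.
apply: measure_eq_box => //.
- exact: rn.1.1.
- have t1 : (0 < t^-1)%R by rewrite invr_gt0.
  rewrite mE [X in nu X](_ : _ = ~` punctured n) ?rn.1.1 ?mule0//.
  by apply/seteqP; split=> x /= xp /(puncturedZ t1).
- by move=> y y0; apply: rn.1.2; exact: bounded_away_box_compl.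
move=> y y0.
have ty0 j : (0 < (t *: y) ord0 j)%R by rewrite mxE mulr_gt0.
have box_t : [set x | box_compl y (t^-1 *: x)%R] = box_compl (t *: y)%R.
  have t1 : (0 < t^-1)%R by rewrite invr_gt0.
  apply/seteqP; split=> x /=; first by move=> /(box_complZ _ t1); rewrite invrK.
  by move=> h; apply/(box_complZ _ t1); rewrite invrK.
rewrite mE box_t.
have h1 : t%:E * (s%:E * P [set w | box_compl (t *: y) (s^-1 *: Y w)]) @[s --> +oo%R] -->
    t%:E * nu (box_compl (t *: y)) by exact: cvgeZl (rv_box_compl rn hn ty0).
have h3 : (t * s)%R @[s --> +oo%R] --> +oo%R by exact: gt0_cvgMry.
have h2 := cvg_comp _ _ h3 (rv_box_compl rn hn y0).
apply: (cvg_unique _ h2) => //; apply: cvg_trans h1; apply: near_eq_cvg.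
near=> s.
have s0 : (0 < s)%R by near: s; exact: nbhs_pinfty_gt.
rewrite /comp muleA -EFinM; congr (_ * P _).
have t1 : (0 < t^-1)%R by rewrite invr_gt0.
apply/seteqP; split=> w /=; rewrite invfM -scalerA.
  by move=> h; apply/(box_complZ _ t1); rewrite invrK.
by move=> /(box_complZ _ t1); rewrite invrK.
Unshelve. all: by end_near. Qed.

End limit_measures.

Lemma EFin_patch {T : Type} {R : numFieldType} (f : T -> R) (D : set T) x :
  ((f \_ D) x)%:E = ((fun x => (f x)%:E) \_ D) x.
Proof. by rewrite !patchE; case: ifP. Qed.

(** * Projections of limit measures and their densities *)

Section marginal_measure.
Context {R : realType} {d : nat}.
Variables (A B : {set 'I_d}) (AB : A \subset B).
Variable nu : {measure set 'rV[R]_#|B| -> \bar R}.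
Local Notation leb n := (@lebesgue_rV R n).
Local Open Scope ereal_scope.

Let M : set 'rV[R]_#|B| := pr AB @^-1` (punctured #|A|).
Let mM : measurable M.
Proof. by apply: measurable_pr_preimage; exact: measurable_punctured. Qed.
Let nuM : {measure set 'rV[R]_#|B| -> \bar R} := mrestr nu mM.

(** The restriction to points with non-zero projection matters: [nu] could otherwise place mass,
    even infinite mass, at the origin of the smaller space. *)
Definition pr_measure : {measure set 'rV[R]_#|A| -> \bar R} :=
  measure_function_pushforward__canonical__measure_function_Measure nuM (measurable_pr AB).

Lemma pr_measureE D : pr_measure D = nu (pr AB @^-1` D `&` pr AB @^-1` punctured #|A|).
Proof. by []. Qed.

Lemma pr_measure_punctured D : D `<=` punctured #|A| -> pr_measure D = nu (pr AB @^-1` D).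
Proof. by move=> Dp; rewrite pr_measureE -preimage_setI setIidl. Qed.

Lemma measure_orthant n (mu : {measure set 'rV[R]_n -> \bar R}) E :
  mu (~` punctured n) = 0 -> measurable E -> mu E = mu (orthant n `&` E).
Proof.
move=> m0 mE; have mo := @measurable_orthant R n.
rewrite (measureDI mu mE mo) setIC [X in X + _](_ : _ = 0) ?add0e//.
apply: (subset_measure0 _ _ _ m0).
- exact: measurableD.
- by apply: measurableC; exact: measurable_punctured.
- by move=> x [_ nox] [].
Qed.

Section regular_variation.
Context {dT} {T : measurableType dT} {P : probability T R}.
Variable X : T -> 'rV[R]_d.
Hypothesis mX : measurable_fun setT X.
Hypothesis X_ge0 : P (X @^-1` ~` orthant d) = 0.

(** The preimage of a set bounded away from the origin is again bounded away once it is cut back to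
    the orthant. Neither the law of [X] nor [nu] sees this cut, and boundaries pull back along the
    projection. *)
Lemma rv_pr_measure : regularly_varying P (sub_rV B \o X) nu ->
  regularly_varying P (sub_rV A \o X) pr_measure.
Proof.
move=> [[nu0 nufin] rv].
have key D : bounded_away D ->
    pr_measure D = nu (orthant #|B| `&` pr AB @^-1` D).
  move=> bD; have [mD oD [e e0 eD]] := (bounded_awayP D).1 bD.
  rewrite pr_measure_punctured; first by apply: measure_orthant nu0 _; exact: measurable_pr_preimage.
  move=> y Dy; split; first exact: oD.
  by move=> y0; have [j] := eD _ Dy; rewrite y0 mxE leNgt e0.
split.
  split.
    rewrite pr_measureE (_ : _ `&` _ = set0) ?measure0//.
    by rewrite -preimage_setI setICl preimage_set0.
  by move=> D bD; rewrite key//; apply: nufin; exact: bounded_away_rd.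
move=> D bD D0; rewrite key//.
have bE := bounded_away_rd (pr_index AB) bD.
have h := rv _ bE _.
have {}h : t%:E * P [set w | (orthant #|B| `&` pr AB @^-1` D)
       (t^-1 *: (sub_rV B \o X) w)%R] @[t --> +oo%R] --> nu (orthant #|B| `&` pr AB @^-1` D).
  apply: h; apply: (subset_measure0 (measurable_boundary _) _ (@boundary_rd _ _ _ (pr_index AB) D)).
    by apply: measurable_pr_preimage; exact: measurable_boundary.
  by rewrite -D0; apply/esym/pr_measure_punctured; exact: boundary_punctured.
apply: cvg_trans h; apply: near_eq_cvg; near=> t.
have t0 : (0 < t^-1)%R by rewrite invr_gt0; near: t; exact: nbhs_pinfty_gt.
congr (_ * _); have [mD _ _] := (bounded_awayP D).1 bD.
have mE : measurable (orthant #|B| `&` pr AB @^-1` D).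
  by apply: measurableI; [exact: measurable_orthant | exact: measurable_pr_preimage].
have mY (C : {set 'I_d}) (G : set 'rV[R]_#|C|) : measurable G ->
    measurable [set w | G (t^-1 *: (sub_rV C \o X) w)%R].
  move=> mG; rewrite -[X in measurable X]setTI.
  apply: (measurableT_comp (measurable_scale _)) => //.
  exact: (measurableT_comp (@measurable_sub_rV R d C) mX).
have prE w : pr AB (t^-1 *: sub_rV B (X w)) = t^-1 *: sub_rV A (X w).
  by rewrite -(pr_sub AB); apply/rowP => j; rewrite !mxE.
rewrite [in RHS](measureDI P (mY _ _ mD) (mY _ _ mE)) [X in _ = X + _](_ : _ = 0).
  rewrite add0e; congr (P _); apply/seteqP; split=> [w [ow]|w [_ //]].
  by rewrite /preimage/= prE.
apply: (subset_measure0 _ _ _ X_ge0).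
- by apply: measurableD; exact: mY.
- rewrite -[X in measurable X]setTI; apply: mX => //; apply: measurableC.
  exact: measurable_orthant.
move=> w [Dw Ew] ow; apply: Ew; split; last by rewrite /preimage/= prE.
by apply/(orthantZ t0) => j; rewrite mxE.
Unshelve. all: by end_near. Qed.

End regular_variation.

(** The marginal is integrable on every box complement, hence finite almost everywhere on the
    punctured orthant, where [fine] therefore changes it on a null set only. *)
Lemma density_pr_measure l : density_of nu l -> radon_on_punctured pr_measure ->
  density_of pr_measure
    ((fun y => fine (marg A (EFin \o l) (emb y))) \_ (punctured #|A|)).
Proof.
move=> [ml l0 nul] [p0 pfin].
have mL := rmge0_mge0 ml; have mI := mge0_marg A mL.
have mI' : mge0 (marg A (EFin \o l) \o @emb _ _ A) by apply: mge0_comp => //; exact: measurable_emb.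
have mp := @measurable_punctured R #|A|.
have mf : rmge0 ((fun y => fine (marg A (EFin \o l) (emb y))) \_ (punctured #|A|)).
  apply: rmge0_patch => //.
  - apply: measurable_funTS; apply: (measurableT_comp _ mI'.1).
    exact: fine_measurable.
  - by move=> y _; rewrite fine_ge0// (mI'.2 y).
have IE D : measurable D -> D `<=` punctured #|A| ->
    pr_measure D = \int[leb #|A|]_(y in D) marg A (EFin \o l) (emb y).
  move=> mD Dp; rewrite pr_measure_punctured//.
  rewrite nul; last exact: measurable_pr_preimage.
  exact: integral_marg.
have fin : {ae leb #|A|, forall y, punctured #|A| y -> marg A (EFin \o l) (emb y) \is a fin_num}.
  have h k : {ae leb #|A|, forall y, box_compl (const_mx k.+1%:R^-1%R) y ->
      marg A (EFin \o l) (emb y) \is a fin_num}.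
    have mD := measurable_box_compl (const_mx k.+1%:R^-1%R : 'rV[R]_#|A|).
    apply: integrable_ae => //; apply/integrableP; split.
      by apply: measurable_funTS; exact: mI'.1.
    under eq_integral => y _ do rewrite gee0_abs ?(mI'.2 y)//.
    rewrite -IE//; first by apply: pfin; apply: bounded_away_box_compl => j; rewrite mxE.
    by apply: box_compl_punctured => j; rewrite mxE.
  have {}h : {ae leb #|A|, forall y k, box_compl (const_mx k.+1%:R^-1%R) y ->
      marg A (EFin \o l) (emb y) \is a fin_num} by exact/ae_foralln.
  by apply: filterS h => y h /punctured_box[k]; exact: h.
split=> //; first by move=> y yp; rewrite patchE memNset.
move=> D mD.
transitivity (pr_measure (D `&` punctured #|A|)).
  rewrite (measureDI pr_measure mD mp) [X in X + _](_ : _ = 0) ?add0e//.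
  apply: (subset_measure0 _ _ _ p0).
  - exact: measurableD.
  - exact: measurableC.
  - by move=> y [].
have mDp := measurableI _ _ mD mp.
rewrite IE//.
rewrite integral_mkcond [RHS]integral_mkcond.
apply: ae_eq_integral => //.
- by apply: (mge0_epatch mDp mI').1.
- by apply: (mge0_epatch mD (rmge0_mge0 mf)).1.
apply: filterS fin => y finy _; rewrite !patchE in_setI.
case: (y \in D) => //=; have [yp|yp] := pselect (punctured #|A| y).
  by rewrite mem_set//= fineK//; exact: finy.
by rewrite memNset.
Qed.

End marginal_measure.

Section marginal_density.
Context {R : realType} {d : nat}.
Variables (A B : {set 'I_d}) (AB : A \subset B).
Local Notation leb n := (@lebesgue_rV R n).
Local Open Scope ereal_scope.

(** Limit densities are integrable only away from the origin. Restricting the smaller density to [K]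
    and the larger one to the cylinder over [K] makes [marg_eq] applicable. *)
Lemma marg_eq_on K (gA : 'rV[R]_#|A| -> R) (gB : 'rV[R]_#|B| -> R) :
  measurable K -> rmge0 gA -> rmge0 gB ->
  (forall D, measurable D -> D `<=` K -> \int[leb #|A|]_(y in D) (gA y)%:E =
     \int[leb #|B|]_(z in pr AB @^-1` D) (gB z)%:E) ->
  \int[leb #|A|]_(y in K) (gA y)%:E < +oo ->
  {ae leb d, forall x, ((gA \_ K) (sub_rV A x))%:E =
     marg A (EFin \o (gB \_ (pr AB @^-1` K))) x}.
Proof.
move=> mK mA mB H fin; have mprK := measurable_pr_preimage AB mK.
have mA' : rmge0 (gA \_ K) by exact: rmge0_patchT.
have mB' : rmge0 (gB \_ (pr AB @^-1` K)).
  exact: rmge0_patchT.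
apply: (marg_eq (rmge0_mge0 mA') (rmge0_mge0 mB')) => [D mD|].
  transitivity (\int[leb #|A|]_(y in D `&` K) (gA y)%:E).
    rewrite integral_mkcondr; apply: eq_integral => y _.
    by rewrite EFin_patch.
  rewrite H//; last exact: measurableI.
  rewrite preimage_setI integral_mkcondr; apply: eq_integral => y _.
  by rewrite EFin_patch.
rewrite (_ : (fun x => ((gA \_ K) x)%:E) = (EFin \o gA) \_ K).
  by rewrite -integral_mkcond.
by rewrite restrict_EFin.
Qed.

End marginal_density.

Lemma measurable_patch {dT} {T : measurableType dT} {R : realType} (E : set T) (f : T -> \bar R) :
  measurable E -> measurable_fun E f -> measurable_fun setT (f \_ E).
Proof. by move=> mE mf; apply/(measurable_restrictT _ mE).1. Qed.

Lemma epatchE {T : Type} {R : realType} (E : set T) (f : T -> \bar R) x :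
  (f \_ E) x = if x \in E then f x else 0%E.
Proof. by rewrite patchE. Qed.

(** * Integration against a measure given by a density *)

Section integral_density.
Context {dT} {T : measurableType dT} {R : realType}.
Variables (mu : {measure set T -> \bar R}) (g : T -> \bar R).
Hypothesis mg : measurable_fun [set: T] g.
Hypothesis g0 : forall x, (0 <= g x)%E.
Local Open Scope ereal_scope.
Import HBNNSimple.

Lemma integral_density (F : T -> \bar R) :
  measurable_fun setT F -> (forall x, 0 <= F x) ->
  \int[density_measure mu mg g0]_x F x = \int[mu]_x (F x * g x).
Proof.
move=> mF F0; pose f_ := nnsfun_approx measurableT mF.
have nd_g m n x : (m <= n)%N -> (f_ m x)%:E <= (f_ n x)%:E.
  by move=> mn; rewrite lee_fin; exact/lefP/nd_nnsfun_approx.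
have cvg_f x : (f_ n x)%:E @[n --> \oo] --> F x by exact: cvg_nnsfun_approx.
transitivity (limn (fun n => \int[density_measure mu mg g0]_x (f_ n x)%:E)).
  rewrite -monotone_convergence//.
  - by apply: eq_integral => x _; apply/esym/cvg_lim.
  - by move=> n; exact/measurable_EFinP/measurable_funP.
  - by move=> n y _; rewrite lee_fin.
  - by move=> y _ m n mn; exact: nd_g.
transitivity (limn (fun n => \int[mu]_x ((f_ n x)%:E * g x))); last first.
  rewrite -monotone_convergence//.
  - apply: eq_integral => x _; apply/cvg_lim => //.
    (* The cases [g x = 0] and [F x = 0] are treated apart because multiplication is not continuous
       at [0 * +oo]. *)
    have [gx|gx] := eqVneq (g x) 0.
      by rewrite gx mule0 (_ : (fun n => _) = cst 0);
        [exact: cvg_cst | apply/funext => n; rewrite mule0].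
    have [Fx|Fx] := eqVneq (F x) 0.
      rewrite Fx mul0e (_ : (fun n => _) = cst 0); first exact: cvg_cst.
      apply/funext => n; rewrite (_ : (f_ n x)%:E = 0) ?mul0e//.
      apply/eqP; rewrite eq_le [X in _ && X]lee_fin fun_ge0 andbT -Fx.
      have /cvg_lim <- // := cvg_f x.
      apply: lime_ge; first by apply/cvg_ex; exists (F x); exact: cvg_f.
      by exists n => // m; exact: nd_g.
    apply: cvgeM => //; last exact: cvg_cst.
    by move: Fx gx; case: (F x) => [r| |]; case: (g x).
  - move=> n; apply: emeasurable_funM => //; exact/measurable_EFinP/measurable_funP.
  - by move=> n y _; rewrite mule_ge0// lee_fin.
  - by move=> y _ m n mn; rewrite lee_wpmul2r// nd_g.
congr (limn _); apply/funext => n.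
transitivity (\sum_(k \in range (f_ n))
    \int[mu]_x ((k * \1_(f_ n @^-1` [set k]) x)%:E * g x)).
  under eq_integral do rewrite fimfunE -fsumEFin//.
  rewrite ge0_integral_fsum//; last 2 first.
  - by move=> y; exact/measurable_EFinP/measurable_funM.
  - by move=> y x _; rewrite nnfun_muleindic_ge0.
  apply: eq_fsbigr => r _; rewrite integralZl_indic_nnsfun// integral_indic//= setIT.
  have mr : measurable (f_ n @^-1` [set r]) by exact: measurable_funPTI.
  have [r0|r0] := leP 0%R r; last first.
    rewrite preimage_nnfun0// measure0 mule0.
    by under eq_integral do rewrite indic0 mulr0 mul0e; rewrite integral0.
  transitivity (\int[mu]_x (r%:E * ((g \_ (f_ n @^-1` [set r])) x))).
    rewrite ge0_integralZl//.
    - by rewrite -integral_mkcond.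
    - by apply/(measurable_restrictT _ mr).1; exact: measurable_funTS.
    - by move=> x _; rewrite patchE; case: ifP.
  apply: eq_integral => x _; rewrite patchE indicE; case: ifP => _.
    by rewrite mulr1.
  by rewrite mulr0 mul0e mule0.
rewrite -ge0_integral_fsum//.
- apply: eq_integral => x _.
  transitivity ((\sum_(k \in range (f_ n)) (k * \1_(f_ n @^-1` [set k]) x)%:E) * g x).
    by rewrite ge0_mule_fsuml// => y; exact: nnfun_muleindic_ge0.
  by rewrite fsumEFin// -fimfunE.
- move=> r; apply: emeasurable_funM => //; exact/measurable_EFinP/measurable_funM.
- by move=> r x _; rewrite mule_ge0// nnfun_muleindic_ge0.
Qed.

End integral_density.

(** * Polar coordinates and spectral densities *)

Section inverse_square.
Context {R : realType}.
Local Notation mu := (@lebesgue_measure R).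

Lemma measurable_invX (a : R) m : 0 <= a ->
  measurable_fun (`]a, +oo[%classic : set (measurableTypeR R)) (fun r : measurableTypeR R => r ^- m).
Proof.
move=> a0; apply: (eq_measurable_fun (fun r : measurableTypeR R => (r `^ (-1)) ^+ m)).
  move=> r; rewrite inE/= in_itv/= andbT => ar.
  by rewrite powR_inv1 ?exprVn// (le_trans a0)// ltW.
by apply: measurable_funTS; apply: measurable_funX; exact: measurable_powR.
Qed.

Lemma integral_invsq (a : R) : 0 < a ->
  (\int[mu]_(r in `]a, +oo[) (r ^- 2)%:E = (a^-1)%:E)%E.
Proof.
move=> a0.
have cV (x : R) : 0 < x -> {for x, continuous (fun r : R => r^-1)}.
  by move=> x0; apply: inv_continuous; rewrite gt_eqF.
have cV2 (x : R) : 0 < x -> {for x, continuous (fun r : R => r ^- 2)}.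
  move=> x0; rewrite (_ : (fun r => _) = fun r : R => r^-1 * r^-1).
    by apply: cvgM; exact: cV.
  by apply/funext => r; rewrite expr2 invfM.
have dF (x : R) : 0 < x -> is_derive x 1 (fun r : R => - r^-1) (x ^- 2).
  move=> x0; have h := @is_deriveV R id x 1 1 (lt0r_neq0 x0) _.
  by apply: is_derive_eq; rewrite scaleNr opprK /GRing.scale/= mulr1.
rewrite (@integral_itv_obnd_cbnd _ a +oo%O (fun r => (r ^- 2)%:E)); last first.
  apply/measurable_EFinP; apply: open_continuous_measurable_fun => // x.
  by rewrite inE/= in_itv/= andbT => ax; apply: cV2; exact: lt_trans ax.
rewrite (@ge0_continuous_FTC2y _ _ (fun r : R => - r^-1) a 0).
- by rewrite sub0e -EFinN opprK.
- by move=> x ax; rewrite invr_ge0 exprn_ge0// (le_trans (ltW a0)).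
- apply: continuous_in_subspaceT => x /set_mem/=; rewrite in_itv/= andbT => ax.
  by apply: cV2; exact: lt_le_trans ax.
- rewrite -oppr0; apply: cvgN.
  by apply/gtr0_cvgV0 => //; exact: nbhs_pinfty_gt.
- by move=> x ax; have [] := dF _ (lt_trans a0 ax).
- apply: cvgN; apply: cvg_at_right_filter; exact: cV.
move=> x; rewrite in_itv/= andbT => ax.
by rewrite derive1E; have [_ ->] := dF _ (lt_trans a0 ax).
Qed.

End inverse_square.

Section polar.
Context {R : realType} {n : nat}.
Variables (nrm : 'rV[R]_n -> R) (sigma : {measure set 'rV[R]_n -> \bar R}).
Hypothesis nN : is_norm nrm.
Hypothesis sP : polar_measure nrm sigma.
Local Notation mu := (@lebesgue_measure R).
Local Notation leb := (@lebesgue_rV R n).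
Implicit Types B : set 'rV[R]_n.

Definition unit_vector (x : 'rV[R]_n) : 'rV[R]_n := (nrm x)^-1 *: x.

Definition cone B : set 'rV[R]_n := [set x | [/\ orthant n x, 0 < nrm x & B (unit_vector x)]].

Lemma measurable_unit_vector : measurable_fun setT unit_vector.
Proof.
apply: measurable_fun_coordP => j; under eq_fun do rewrite mxE.
apply: measurable_funM; last exact: measurable_coord.
by have [] := rmge0V (conj (measurable_nrm nN) (nrm_ge0 nN)).
Qed.

Lemma measurable_cone B : measurable B -> measurable (cone B).
Proof.
move=> mB; rewrite (_ : cone B = orthant n `&` ((nrm @^-1` `]0, +oo[) `&` (unit_vector @^-1` B))).
  apply: measurableI; first exact: measurable_orthant.
  apply: measurableI.
    by rewrite -[X in measurable X]setTI; exact: measurable_nrm.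
  by rewrite -[X in measurable X]setTI; exact: measurable_unit_vector.
apply/seteqP; split=> x /=; rewrite in_itv/= andbT; first by case.
by case=> ? [].
Qed.

Lemma nrm_unit_vector x : 0 < nrm x -> nrm (unit_vector x) = 1.
Proof. by move=> x0; rewrite /unit_vector (nrmZ nN) ?invr_ge0 ?(ltW x0)// mulVf// gt_eqF. Qed.

Lemma unit_vectorZ (r : R) x : 0 < r -> unit_vector (r *: x) = unit_vector x.
Proof.
move=> r0; rewrite /unit_vector (nrmZ nN) ?(ltW r0)// invfM scalerA mulrAC.
by rewrite mulVf ?mul1r// gt_eqF.
Qed.

Lemma cone_sphere (r : R) w B : 0 < r -> sphere nrm w -> cone B (r *: w) <-> B w.
Proof.
move=> r0 [ow nw]; rewrite /cone/= unit_vectorZ// /unit_vector (nrmZ nN) ?(ltW r0)// nw invr1 scale1r mulr1.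
by split=> [[]//|Bw]; split=> //; exact/orthantZ.
Qed.

Lemma measurable_sphere : measurable (sphere nrm).
Proof.
rewrite (_ : sphere nrm = orthant n `&` (nrm @^-1` [set 1])).
  apply: measurableI; first exact: measurable_orthant.
  by rewrite -[X in measurable X]setTI; apply: measurable_nrm.
by [].
Qed.

Lemma polar_set B (I : set (measurableTypeR R)) : measurable B -> B `<=` sphere nrm -> measurable I ->
  leb (cone B `&` nrm @^-1` I) =
  (\int[mu]_(r in `]0%R, +oo[) ((r ^+ n.-1)%:E * (\1_I r)%:E * sigma B))%E.
Proof.
move=> mB Bs mI.
have mC : measurable (cone B `&` nrm @^-1` I).
  apply: measurableI; first exact: measurable_cone.
  by rewrite -[X in measurable X]setTI; exact: measurable_nrm.
rewrite sP.2//; last by move=> x [[]].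
apply: eq_integral => r; rewrite inE/= in_itv/= andbT => r0.
rewrite -muleA; congr (_ * _)%E.
have mW : measurable [set w | (cone B `&` nrm @^-1` I) (r *: w)].
  by rewrite -[X in measurable X]setTI; exact: (measurable_scale r).
have mS := measurable_sphere.
rewrite (measureDI sigma mW mS) [X in (X + _)%E](_ : _ = 0%E); last first.
  by apply: (subset_measure0 _ _ _ sP.1); [exact: measurableD | exact: measurableC | move=> x []].
rewrite add0e indicE; have [rI|rI] := pselect (I r).
  rewrite mem_set// mul1e; congr (sigma _); apply/seteqP; split=> w /=.
    by move=> [[Cw _] Sw]; apply/(cone_sphere _ r0 Sw).
  move=> Bw; have Sw := Bs _ Bw; split=> //; split; first exact/(cone_sphere _ r0 Sw).
  by rewrite /preimage/= (nrmZ nN) ?(ltW r0)// Sw.2 mulr1.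
rewrite memNset// mul0e -(measure0 sigma); congr (sigma _); apply/seteqP; split=> w //=.
by move=> [[_ +] Sw]; rewrite /preimage/= (nrmZ nN) ?(ltW r0)// Sw.2 mulr1.
Qed.

Local Open Scope ereal_scope.

(** By [polar_set], the image under [nrm] of Lebesgue measure on the cone has density
    [r ^+ n.-1 * sigma B] on the positive half-line; integrating [psi] is then a change of
    variables. *)
Lemma polar_radial B (psi : measurableTypeR R -> \bar R) : measurable B -> B `<=` sphere nrm ->
  measurable_fun setT psi -> (forall r, 0 <= psi r) ->
  \int[leb]_(x in cone B) psi (nrm x) =
  \int[mu]_(r in `]0%R, +oo[) ((r ^+ n.-1)%:E * psi r * sigma B).
Proof.
move=> mB Bs mpsi psi0; have mC := measurable_cone mB.
have [mI I0] := mge0_indic mC.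
have mN := measurable_nrm nN.
pose m1 := density_measure leb mI I0.
pose g : measurableTypeR R -> \bar R := (fun r => (r ^+ n.-1)%:E * sigma B) \_ `]0%R, +oo[.
have mpos : measurable (`]0%R, +oo[%classic : set (measurableTypeR R)) by [].
have mpow (s : \bar R) : measurable_fun setT (fun r : measurableTypeR R => (r ^+ n.-1)%:E * s).
  apply: emeasurable_funM; last exact: measurable_cst.
  by apply/measurable_EFinP; exact: measurable_funX.
have mg : measurable_fun setT g.
  by apply: measurable_patch => //; exact: measurable_funTS.
have g0 r : 0 <= g r.
  rewrite /g epatchE; case: ifPn => //; rewrite inE/= in_itv/= andbT => r0.
  by rewrite mule_ge0// lee_fin exprn_ge0// ltW.
have mpsiN : measurable_fun setT (fun x => psi (nrm x)) by exact: (measurableT_comp mpsi mN).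
have eqm (I : set (measurableTypeR R)) : measurable I -> pushforward m1 nrm I = density_measure mu mg g0 I.
  move=> mI'; have mNI : measurable (nrm @^-1` I) by rewrite -[X in measurable X]setTI; exact: mN.
  transitivity (leb (cone B `&` nrm @^-1` I)).
    rewrite /pushforward density_measureE integral_indic//.
  rewrite polar_set// density_measureE.
  apply: (etrans (integral_mkcond _ _)); apply/esym; apply: (etrans (integral_mkcond _ _)); apply/esym.
  apply: eq_integral => r _.
  rewrite /g !epatchE indicE; case: ifPn => // r0; case: (r \in I) => //.
    by rewrite mule1.
  by rewrite mule0 mul0e.
transitivity (\int[m1]_x psi (nrm x)).
  rewrite integral_density//.
  apply: (etrans (integral_mkcond _ _)); apply: eq_integral => x _; rewrite epatchE indicE.
  by case: ifP => _; rewrite ?mule1 ?mule0.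
have mN' : measurable_fun setT (nrm : _ -> measurableTypeR R) := mN.
pose m2 : {measure set (measurableTypeR R) -> \bar R} :=
  measure_function_pushforward__canonical__measure_function_Measure m1 mN'.
transitivity (\int[m2]_r psi r).
  by rewrite (ge0_integral_pushforward mN').
rewrite [LHS](eq_measure_integral (density_measure mu mg g0)); last by move=> I mI' _; exact: eqm.
rewrite integral_density//; apply/esym; apply: (etrans (integral_mkcond _ _)); apply: eq_integral => r _.
rewrite /g !epatchE; case: ifP => _; last by rewrite mule0.
by rewrite muleCA muleA.
Qed.

Hypothesis n_gt0 : (0 < n)%N.

(** The powers [r ^+ n.-1] and [r ^- n.+1] leave [r ^- 2], whose integral beyond 1 is exactly 1.
    Hence on [B] the radial weight on [nrm x > 1], projected to the sphere, is [sigma] itself,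
    without a constant. *)
Lemma polar_spectral B (h : 'rV[R]_n -> R) : measurable B -> B `<=` sphere nrm -> rmge0 h ->
  \int[leb]_(x in cone B `&` [set x | (1 < nrm x)%R]) (radial_density nrm h x)%:E =
  \int[sigma]_(w in B) (h w)%:E.
Proof.
move=> mB Bs mh.
have mN := measurable_nrm nN; have mu_ := measurable_unit_vector.
have mpos : measurable (`]1%R, +oo[%classic : set (measurableTypeR R)) by [].
pose psi : measurableTypeR R -> \bar R := (fun r => (r ^- n.+1)%:E) \_ `]1%R, +oo[.
have mpsi : measurable_fun setT psi.
  by apply: measurable_patch => //; apply/measurable_EFinP; exact: measurable_invX.
have psi0 r : 0 <= psi r.
  rewrite /psi epatchE; case: ifPn => //; rewrite inE/= in_itv/= andbT => r0.
  by rewrite lee_fin invr_ge0 exprn_ge0// (le_trans _ (ltW r0)).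
have mC A : measurable A -> measurable (cone A) := @measurable_cone A.
pose S := sphere nrm; have mS : measurable S := measurable_sphere.
pose g := (fun x => psi (nrm x)) \_ (cone S).
have mg : measurable_fun setT g.
  apply: measurable_patch; [exact: mC | apply: measurable_funTS].
  exact: (measurableT_comp mpsi mN).
have g0 x : 0 <= g x by rewrite /g epatchE; case: ifP.
pose m1 := density_measure leb mg g0.
have eqm A : measurable A -> A `<=` B -> pushforward m1 unit_vector A = sigma A.
  move=> mA AB; have As := subset_trans AB Bs.
  have mUA : measurable (unit_vector @^-1` A) by rewrite -[X in measurable X]setTI; exact: mu_.
  rewrite /pushforward density_measureE.
  transitivity (\int[leb]_(x in cone A) psi (nrm x)).
    rewrite integral_mkcond [RHS]integral_mkcond; apply: eq_integral => x _.
    rewrite /g !epatchE; case: ifPn => [/set_mem xA|xA]; last first.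
      by case: ifPn => // /set_mem[_ _ Ax]; case/negP: xA; exact: mem_set.
    case: ifPn => [/set_mem[ox nx _]|nx]; first by rewrite mem_set.
    by case: ifPn => // /set_mem[ox nx' _]; move/negP: nx; case; rewrite inE; split=> //; exact: As.
  rewrite polar_radial//.
  transitivity (\int[mu]_(r in `]1%R, +oo[) (sigma A * (r ^- 2)%:E)).
    rewrite [LHS]integral_mkcond [RHS]integral_mkcond; apply: eq_integral => r _.
    rewrite /psi !epatchE; case: ifPn => r0; case: ifPn => r1.
    - rewrite muleC -EFinM; congr (_ * _%:E).
      move: r1; rewrite inE/= in_itv/= andbT => r1.
      have r0' : r != 0%R by rewrite gt_eqF// (lt_trans _ r1).
      rewrite -[X in X.+1](prednK n_gt0) !exprS; field; rewrite r0' expf_neq0//.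
    - by rewrite mule0 mul0e.
    - move: r0 r1; rewrite !inE/= !in_itv/= !andbT => /negP r0 r1.
      by case: r0; rewrite inE/= in_itv/= andbT (lt_trans _ r1).
    by [].
  have minv2 : measurable_fun (`]1%R, +oo[%classic : set (measurableTypeR R)) (fun r : measurableTypeR R => (r ^- 2)%:E).
    by apply/measurable_EFinP; exact: measurable_invX.
  rewrite ge0_integralZl// ?integral_invsq// ?invr1 ?mule1//.
  by move=> r; rewrite /= in_itv/= andbT => r1; rewrite lee_fin invr_ge0 exprn_ge0// (le_trans _ (ltW r1)).
rewrite [RHS](eq_measure_integral (measure_function_pushforward__canonical__measure_function_Measure m1 mu_)); last first.
  by move=> A mA AB; exact/esym/eqm.
have mhB : rmge0 (h \_ B) by exact: rmge0_patchT.
have mhU : mge0 (fun x => ((h \_ B) (unit_vector x))%:E).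
  exact: (mge0_comp mu_ (rmge0_mge0 mhB)).
rewrite [RHS]integral_mkcond.
transitivity (\int[pushforward m1 unit_vector]_w ((h \_ B) w)%:E); last first.
  by apply: eq_integral => w _; rewrite EFin_patch.
rewrite (ge0_integral_pushforward mu_)//; first last.
- by move=> w _; rewrite lee_fin mhB.2.
- exact: (rmge0_mge0 mhB).1.
rewrite preimage_setT integral_density//; [|exact: mhU.1|exact: mhU.2].
apply: (etrans (integral_mkcond _ _)); apply: eq_integral => x _.
rewrite /g /psi !epatchE in_setI /= patchE; case: (boolP (x \in cone B)) => [/set_mem[ox nx Bx]|xB] /=.
  rewrite (mem_set Bx) (_ : x \in cone S); last by apply/mem_set; split=> //; exact: Bs.
  have -> : (x \in [set x | (1 < nrm x)%R]) = (nrm x \in (`]1%R, +oo[%classic : set R)).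
    by apply/idP/idP => /set_mem hx; apply: mem_set; move: hx; rewrite /= in_itv/= andbT.
  by case: ifP => _; [rewrite /radial_density -EFinM mulrC | rewrite mule0].
case: (boolP (unit_vector x \in B)) => xB'; last by rewrite mul0e.
case: (boolP (x \in cone S)) => [/set_mem[ox nx _]|]; last by rewrite mule0.
by case/negP: xB; apply: mem_set; split=> //; exact: set_mem.
Qed.

End polar.

(** * Homogeneous densities in radial form *)

Section radial_densities.
Context {R : realType} {n : nat}.
Local Notation mu := (@lebesgue_measure R).
Local Notation leb := (@lebesgue_rV R n).
Local Open Scope ereal_scope.

Lemma measurable_scale_pair : measurable_fun [set: measurableTypeR R * 'rV[R]_n]
  (fun p => (p.1 : R) *: p.2)%R.
Proof.
apply: measurable_fun_coordP => j; under eq_fun do rewrite mxE.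
apply: measurable_funM; first exact: measurable_fst.
exact: (measurableT_comp (measurable_coord j) measurable_snd).
Qed.

Section homogeneous_density.
Variables (nu : {measure set 'rV[R]_n -> \bar R}) (l : 'rV[R]_n -> R).
Hypothesis nl : density_of nu l.
Hypothesis rn : radon_on_punctured nu.
Hypothesis hn : homogeneous nu.

(** By a change of variables and homogeneity of [nu], the function [x -> u ^+ n.+1 * l (u *: x)] is
    another density of [nu]. *)
Lemma homogeneous_density_eq (u : R) : (0 < u)%R ->
  {ae leb, forall x, l (u *: x)%R = (u ^- n.+1 * l x)%R}.
Proof.
move=> u0; have [ml l0 nul] := nl.
have u00 : u != 0%R by rewrite gt_eqF.
have mlu : rmge0 (fun x => u ^+ n.+1 * l (u *: x))%R.
  split; last by move=> x; rewrite mulr_ge0 ?exprn_ge0 ?ml.2// ltW.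
  apply: measurable_funM => //; exact: (measurableT_comp ml.1 (measurable_scale u)).
have du : density_of nu (fun x => u ^+ n.+1 * l (u *: x))%R.
  split=> // [x xp|B mB]; first by rewrite l0 ?mulr0// => /(puncturedZ u0).
  have muB := measurable_scale_image u0 mB; have := hn u0 mB; rewrite nul// => h.
  have -> : nu B = u%:E * (u^-1%:E * nu B) by rewrite muleA -EFinM mulfV// mul1e.
  rewrite -h integral_scale_image// muleA -EFinM -exprS -ge0_integralZl//.
  - by apply/measurable_EFinP/measurable_funTS; exact: (measurableT_comp ml.1 (measurable_scale u)).
  - by move=> x _; rewrite lee_fin ml.2.
  - by rewrite lee_fin exprn_ge0// ltW.
have := density_eq nl du rn.2.
by apply: filterS => x ->; rewrite mulrA mulVf ?mul1r// expf_neq0.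
Qed.

(* For each u the identity holds off a null set that depends on u; Fubini
   exchanges the two quantifiers. *)
Lemma homogeneous_density_ae : {ae leb, forall x, {ae mu, forall u : measurableTypeR R,
  (0 < u)%R -> l (u *: x)%R = (u ^- n.+1 * l x)%R}}.
Proof.
have [ml l0 nul] := nl.
pose D : set (measurableTypeR R * 'rV[R]_n) := [set p | (0 < (p.1 : R))%R].
have mD : measurable D.
  rewrite (_ : D = fst @^-1` (`]0%R, +oo[%classic : set (measurableTypeR R))).
    by rewrite -[X in measurable X]setTI; exact: measurable_fst.
  by apply/seteqP; split=> p /=; rewrite in_itv/= andbT.
pose F (p : measurableTypeR R * 'rV[R]_n) : \bar R :=
  (`|(p.1 : R) ^+ n.+1 * l ((p.1 : R) *: p.2) - l p.2|%R)%:E.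
have mF : measurable_fun setT (F \_ D).
  apply: measurable_patch => //; apply: measurable_funTS; apply/measurable_EFinP.
  apply: measurableT_comp => //; apply: measurable_funB.
    apply: measurable_funM; first by apply: measurable_funX; exact: measurable_fst.
    exact: (measurableT_comp ml.1 measurable_scale_pair).
  exact: (measurableT_comp ml.1 measurable_snd).
have F0 p : 0 <= (F \_ D) p by rewrite epatchE; case: ifP => // _; rewrite lee_fin.
have FE (u : measurableTypeR R) x : (0 < (u : R))%R -> (F \_ D) (u, x) = 0 -> l (u *: x)%R = (u ^- n.+1 * l x)%R.
  move=> u0; rewrite epatchE mem_set// => -[] /normr0P/eqP/subr0_eq <-.
  by rewrite mulrA mulVf ?mul1r// expf_neq0// gt_eqF.
have I0 : \int[leb]_x \int[mu]_u (F \_ D) (u, x) = 0.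
  transitivity (\int[mu]_u \int[leb]_x (F \_ D) (u, x)).
    by apply/esym; exact: (fubini_tonelli _ mF F0).
  apply: integral0_eq => u _; have [u0|u0] := leP (u : R) 0%R.
    by apply: integral0_eq => x _; rewrite epatchE memNset//= => /lt_geF; rewrite u0.
  have mGu : mge0 (fun x => (F \_ D) (u, x)).
    by split=> // ; exact: (measurableT_comp mF (pair1_measurable u)).
  apply/(ge0_integral_eq0P mGu); apply: filterS (homogeneous_density_eq u0) => x lx.
  rewrite epatchE mem_set// /F /= lx mulrA mulfV ?mul1r ?subrr ?normr0//.
  by rewrite expf_neq0// gt_eqF.
have mI : mge0 (fun x => \int[mu]_u (F \_ D) (u, x)).
  split; last by move=> x; apply: integral_ge0 => u _.
  exact: (measurable_fun_fubini_tonelli_G (m1 := mu) (F \_ D)).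
apply: filterS ((ge0_integral_eq0P mI).1 I0) => x hx.
have : ae_eq mu setT (fun u => (F \_ D) (u, x)) (cst 0).
  apply/ae_eq_integral_abs => //; first exact: (measurableT_comp mF (pair2_measurable x)).
  by under eq_integral do rewrite gee0_abs//.
apply: filterS => u /(_ I) Hu u0; exact: FE.
Qed.

End homogeneous_density.

Section radial.
Variables (nrm : 'rV[R]_n -> R) (nu : {measure set 'rV[R]_n -> \bar R}) (l : 'rV[R]_n -> R).
Hypothesis nN : is_norm nrm.
Hypothesis nl : density_of nu l.
Hypothesis rn : radon_on_punctured nu.
Hypothesis hn : homogeneous nu.
Hypothesis n_gt0 : (0 < n)%N.

(* This is l w as soon as l (s *: w) = s^-(n+1) l w for almost every s > 1. *)
Definition spectral_fun (w : 'rV[R]_n) : R :=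
  fine (\int[mu]_(s in `]1%R, +oo[) (l (s *: w) * s ^+ n.-1)%:E).

Lemma rmge0_spectral_fun : rmge0 spectral_fun.
Proof.
have [ml l0 nul] := nl.
have mpos : measurable (`]1%R, +oo[%classic : set (measurableTypeR R)) by [].
have p0 (s : measurableTypeR R) w : 0 <= ((fun s : measurableTypeR R => (l (s *: w) * s ^+ n.-1)%:E) \_ (`]1%R, +oo[)) s.
  rewrite epatchE; case: ifPn => // /set_mem; rewrite /= in_itv/= andbT => s1.
  by rewrite lee_fin mulr_ge0 ?ml.2// exprn_ge0// (le_trans _ (ltW s1)).
split=> [|w]; last first.
  by rewrite fine_ge0// [leRHS]integral_mkcond; apply: integral_ge0 => s _.
apply: measurableT_comp => //.
pose F (p : measurableTypeR R * 'rV[R]_n) : \bar R :=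
  (l ((p.1 : R) *: p.2) * (p.1 : R) ^+ n.-1)%:E.
have mF : measurable_fun setT (F \_ ([set p | (1 < (p.1 : R))%R])).
  apply: measurable_patch.
    rewrite (_ : [set p | _] = fst @^-1` (`]1%R, +oo[%classic : set (measurableTypeR R))).
      by rewrite -[X in measurable X]setTI; exact: measurable_fst.
    by apply/seteqP; split=> p /=; rewrite in_itv/= andbT.
  apply: measurable_funTS; apply/measurable_EFinP.
  apply: measurable_funM; last by apply: measurable_funX; exact: measurable_fst.
  exact: (measurableT_comp ml.1 measurable_scale_pair).
have F0 p : 0 <= (F \_ ([set p | (1 < (p.1 : R))%R])) p.
  rewrite epatchE; case: ifPn => // /set_mem /= s1.
  by rewrite lee_fin mulr_ge0 ?ml.2// exprn_ge0// (le_trans _ (ltW s1)).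
rewrite (_ : (fun w => _) = fun w => \int[mu]_s (F \_ ([set p | (1 < (p.1 : R))%R])) (s, w)).
  exact: (measurable_fun_fubini_tonelli_G (m1 := mu) _).
apply/funext => w; apply: (etrans (integral_mkcond _ _)); apply: eq_integral => s _.
rewrite !epatchE; have -> : (s \in (`]1%R, +oo[%classic : set R)) = ((s, w) \in [set p | (1 < (p.1 : R))%R]); last by [].
by apply/idP/idP => /set_mem hs; apply: mem_set; move: hs; rewrite /= in_itv/= andbT.
Qed.

(** With [rho = nrm x], substitute [s = rho * u] in [spectral_fun]. For almost every [u] the
    integrand becomes [l x * rho ^+ n.-1 * u ^- 2], and the integral of [u ^- 2] beyond [1 / rho] is
    [rho]; together with the Jacobian [rho] this gives [rho ^+ n.+1 * l x]. *)
Lemma radial_densityP : {ae leb, forall x, punctured n x -> l x = radial_density nrm spectral_fun x}.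
Proof.
have [ml l0 nul] := nl.
apply: filterS (homogeneous_density_ae nl rn hn) => x hx [_ x0].
have rx : (0 < nrm x)%R by apply: nrm_gt0 => //; exact/eqP.
rewrite /radial_density; set rho := nrm x in rx *.
suff -> : spectral_fun (rho^-1 *: x) = (rho ^+ n.+1 * l x)%R.
  by rewrite mulrA mulVf ?mul1r// expf_neq0// gt_eqF.
have rho0 : rho != 0%R by rewrite gt_eqF.
have mpos (a : R) : measurable (`]a, +oo[%classic : set (measurableTypeR R)) by [].
rewrite /spectral_fun.
pose F : measurableTypeR R -> \bar R := (fun s : measurableTypeR R => (l (s *: (rho^-1 *: x)) * s ^+ n.-1)%:E) \_ (`]1%R, +oo[).
have mF : measurable_fun setT F.
  apply: measurable_patch => //; apply: measurable_funTS; apply/measurable_EFinP.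
  apply: measurable_funM => //.
  exact: (measurableT_comp ml.1 (measurableT_comp measurable_scale_pair (pair2_measurable _))).
have F0 s : 0 <= F s.
  rewrite /F epatchE; case: ifPn => // /set_mem; rewrite /= in_itv/= andbT => s1.
  by rewrite lee_fin mulr_ge0 ?ml.2// exprn_ge0// (le_trans _ (ltW s1)).
have IE : \int[mu]_s F s = rho%:E * \int[mu]_u F (rho * u)%R.
  by rewrite integral_scale1// muleA -EFinM mulfV// mul1e.
rewrite integral_mkcond -/F IE.
have -> : \int[mu]_u F (rho * u)%R = (l x * rho ^+ n)%:E.
  transitivity (\int[mu]_(u in `]rho^-1%R, +oo[) ((l x * rho ^+ n.-1)%:E * (u ^- 2)%:E)).
    apply/esym; apply: (etrans (integral_mkcond _ _)); apply/esym.
    apply: ae_eq_integral => //.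
    - exact: (measurableT_comp mF (measurable_scale1 rho)).
    - apply: measurable_patch => //; apply: emeasurable_funM; first exact: measurable_cst.
      by apply/measurable_EFinP; apply: measurable_invX; rewrite invr_ge0 ltW.
    apply: filterS hx => u hu _; rewrite /F !epatchE.
    have -> : (u \in (`]rho^-1%R, +oo[%classic : set R)) = ((rho * u)%R \in (`]1%R, +oo[%classic : set R)).
      have hE : (rho^-1 < u)%R = (1 < rho * u)%R by rewrite -[in LHS](mulr1 rho^-1%R) ltr_pdivrMl.
      by apply/idP/idP => /set_mem hs; apply: mem_set; move: hs; rewrite /= !in_itv/= !andbT hE.
    case: ifPn => // /set_mem; rewrite /= in_itv/= andbT => ru.
    have u0 : (0 < u)%R by rewrite -(pmulr_rgt0 _ rx) (lt_trans _ ru).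
    rewrite scalerA mulrAC mulfV// mul1r hu// -EFinM; congr (_%:E).
    have un0 : u != 0%R by rewrite gt_eqF.
    rewrite -{1}(prednK n_gt0) exprMn !exprS; field; rewrite un0 expf_neq0//.
  rewrite ge0_integralZl//.
  - rewrite integral_invsq ?invr_gt0// invrK -EFinM -mulrA -exprSr prednK//.
  - by apply/measurable_EFinP; apply: measurable_invX; rewrite invr_ge0 ltW.
  - move=> u; rewrite /= in_itv/= andbT => ru; rewrite lee_fin invr_ge0 exprn_ge0//.
    by rewrite (le_trans _ (ltW ru))// invr_ge0 ltW.
  - by rewrite lee_fin mulr_ge0 ?ml.2// exprn_ge0// ltW.
by rewrite -EFinM /= mulrCA mulrC exprS.
Qed.

Lemma rmge0_radial_density h : rmge0 h -> rmge0 (radial_density nrm h).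
Proof.
move=> mh; have mN := measurable_nrm nN.
have [mV V0] := rmge0V (conj mN (nrm_ge0 nN)).
split=> [|x]; last by rewrite mulr_ge0 ?mh.2// invr_ge0 exprn_ge0// (nrm_ge0 nN).
apply: measurable_funM; last exact: (measurableT_comp mh.1 (measurable_unit_vector nN)).
rewrite (_ : (fun x => _) = fun x => (nrm x)^-1 ^+ n.+1)%R; first exact: measurable_funX.
by apply/funext => x; rewrite exprVn.
Qed.

Variable sigma : {measure set 'rV[R]_n -> \bar R}.
Hypothesis sP : polar_measure nrm sigma.

Let M : set 'rV[R]_n := [set x | (1 < nrm x)%R].

Let mM : measurable M.
Proof.
rewrite (_ : M = nrm @^-1` `]1%R, +oo[).
  by rewrite -[X in measurable X]setTI; exact: measurable_nrm.
by apply/seteqP; split=> x /=; rewrite in_itv/= andbT.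
Qed.

Let nuM : {measure set 'rV[R]_n -> \bar R} := mrestr nu mM.

(** The case [r = 1] of the normalization of a spectral measure; homogeneity of [nu] supplies the
    other radii. *)
Definition spectral_of : {measure set 'rV[R]_n -> \bar R} :=
  measure_function_pushforward__canonical__measure_function_Measure nuM (measurable_unit_vector nN).

Lemma spectral_ofE B : spectral_of B = nu [set x | (1 < nrm x)%R /\ B (unit_vector nrm x)].
Proof. by rewrite (_ : [set x | _] = unit_vector nrm @^-1` B `&` M)//; apply/seteqP; split=> x []. Qed.

Lemma spectral_measure_of : spectral_measure nrm nu spectral_of.
Proof.
have mS := measurable_sphere nN.
have mU B : measurable B -> measurable [set x | (1 < nrm x)%R /\ B (unit_vector nrm x)].
  move=> mB; apply: (measurableI _ _ mM); rewrite -[X in measurable X]setTI.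
  exact: measurable_unit_vector.
split=> [|r B r0 mB Bs].
  rewrite spectral_ofE; apply: (subset_measure0 _ _ _ rn.1).
  - by apply: mU; exact: measurableC.
  - by apply: measurableC; exact: measurable_punctured.
  move=> x [nx Sx] [ox _]; apply: Sx; have nx0 : (0 < nrm x)%R by rewrite (lt_trans _ nx).
  by split; [apply/orthantZ; rewrite ?invr_gt0 | exact: nrm_unit_vector].
rewrite spectral_ofE -(hn r0 (mU _ mB)); congr (nu _).
apply/seteqP; split=> [x [rx Bx]|_ [x [nx Bx] <-]].
  exists (r^-1 *: x)%R; last by rewrite scalerA mulfV ?scale1r// gt_eqF.
  split; last by rewrite unit_vectorZ// invr_gt0.
  by rewrite (nrmZ nN) ?invr_ge0 ?(ltW r0)// ltr_pdivlMl// mulr1.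
split; first by rewrite (nrmZ nN) ?(ltW r0)// ltr_pMr.
by have := unit_vectorZ nN x r0; rewrite /unit_vector => ->.
Qed.

Lemma spectral_density_of : spectral_density nrm sigma spectral_of spectral_fun.
Proof.
have mh := rmge0_spectral_fun; have [ml l0 nul] := nl.
split=> [|w _|B mB Bs]; [exact: measurable_funTS mh.1 | exact: mh.2 |].
rewrite spectral_ofE -(polar_spectral nN sP n_gt0 mB Bs mh).
have -> : [set x | (1 < nrm x)%R /\ B (unit_vector nrm x)] = cone nrm B `&` M.
  apply/seteqP; split=> x [].
    move=> nx Bx; split=> //; have nx0 : (0 < nrm x)%R by rewrite (lt_trans _ nx).
    split=> //; have [ow _] := Bs _ Bx.
    by apply/(orthantZ (k := (nrm x)^-1)) => //; rewrite invr_gt0.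
  by case=> ? ? ? ?.
have mCM : measurable (cone nrm B `&` M) by apply: measurableI => //; exact: measurable_cone.
rewrite nul//; apply: ae_eq_integral => //.
- exact: rmge0_measurable.
- by apply: rmge0_measurable; exact: rmge0_radial_density.
apply: filterS radial_densityP => x hx [[ox nx _] _]; congr (_%:E); apply: hx; split=> //.
by move=> x0; move: nx; rewrite x0 (nrm0 nN) ltxx.
Qed.

End radial.

End radial_densities.

Section marginal_limits.
Context {R : realType} {d : nat} {dT : measure_display} {T : measurableType dT}
  {P : probability T R}.
Variable X : {RV P >-> 'rV[R]_d}.

Lemma density_ge0_ae n (Y : T -> 'rV[R]_n) g : has_density P Y g ->
  P (Y @^-1` ~` orthant n) = 0%E.
Proof.
move=> [_ _ ->]; last by apply: measurableC; exact: measurable_orthant.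
by rewrite setICl integral_set0.
Qed.

Hypothesis X_ge0 : P (X @^-1` ~` orthant d) = 0%E.

Definition spectral_limit (A : {set 'I_d}) (nrm : 'rV[R]_#|A| -> R)
    (sigma nuA HA : {measure set 'rV[R]_#|A| -> \bar R}) (h : 'rV[R]_#|A| -> R) :=
  [/\ regularly_varying P (sub_rV A \o X) nuA, spectral_measure nrm nuA HA,
      spectral_density nrm sigma HA h, rmge0 h &
      density_of nuA (radial_density nrm h \_ (punctured #|A|))].

(** Taking [A = B] covers the cliques, a strict inclusion the separators, so both receive their
    spectral data by one construction. *)
Lemma spectral_limit_exists (A B : {set 'I_d}) (nrm : 'rV[R]_#|A| -> R)
    (sigma : {measure set 'rV[R]_#|A| -> \bar R})
    (nu : {measure set 'rV[R]_#|B| -> \bar R}) lam :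
  A \subset B -> (0 < #|A|)%N -> is_norm nrm -> polar_measure nrm sigma ->
  regularly_varying P (sub_rV B \o X) nu -> has_exponent_density nu lam ->
  exists nuA HA h, spectral_limit nrm sigma nuA HA h.
Proof.
move=> AB A0 nN sP rn nl; have dn := exponent_density_of rn.1 nl.
have rA := rv_pr_measure AB (measurable_funP X) X_ge0 rn.
have dA := density_pr_measure dn rA.1.
set l := (X in density_of _ X) in dA.
have hA : homogeneous (pr_measure AB nu).
  exact: (rv_homogeneous rA (density_null_hyperplanes dA)).
have mh := rmge0_spectral_fun dA.
exists (pr_measure AB nu), (spectral_of (pr_measure AB nu) nN), (spectral_fun l); split=> //.
- exact: spectral_measure_of rA.1 hA.
- exact: (spectral_density_of nN dA rA.1 hA A0 sP).
have mr := rmge0_radial_density nN mh.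
have mp := @measurable_punctured R #|A|.
have mrp : rmge0 (radial_density nrm (spectral_fun l) \_ (punctured #|A|)).
  exact: rmge0_patchT.
split=> // [x xp|D mD]; first by rewrite patchE memNset.
have [ml l0 ->//] := dA.
apply: ae_eq_integral => //.
- exact: rmge0_measurable.
- exact: rmge0_measurable.
apply: filterS (radial_densityP nN dA rA.1 hA A0) => x hx _; congr (_%:E).
rewrite patchE; case: (boolP (x \in punctured #|A|)) => [/set_mem/hx //|xp].
by rewrite l0// => /mem_set; exact/negP.
Qed.

End marginal_limits.

(** * L1 convergence on corners *)

Section scheffe.
Context {dT : measure_display} {T : measurableType dT} {R : realType}.
Variables (mu : {measure set T -> \bar R}) (K : set T) (f_ : nat -> T -> R) (g : T -> R).
Hypotheses (mK : measurable K) (mf : forall n, measurable_fun K (f_ n))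
  (f0 : forall n x, 0 <= f_ n x) (mg : measurable_fun K g) (g0 : forall x, 0 <= g x).
Hypothesis fg : {ae mu, forall x, K x -> f_ n x @[n --> \oo] --> g x}.
Hypothesis g_fin : (\int[mu]_(x in K) (g x)%:E < +oo)%E.
Local Open Scope ereal_scope.
Hypothesis If : \int[mu]_(x in K) (f_ n x)%:E @[n --> \oo] --> \int[mu]_(x in K) (g x)%:E.

(** [|f - g| = f - g + 2 max(0, g - f)], and the positive part of [g - f] is dominated by the
    integrable [g], so dominated convergence applies to it. *)
Lemma scheffe : \int[mu]_(x in K) `|f_ n x - g x|%:E @[n --> \oo] --> 0.
Proof.
pose w n x : R := Num.max 0%R (g x - f_ n x)%R.
have w0 n x : (0 <= w n x)%R by rewrite /w le_max lexx.
have wg n x : (w n x <= g x)%R by rewrite /w ge_max g0 gerBl f0.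
have mw n : measurable_fun K (w n).
  by apply: measurable_maxr; [exact: measurable_cst | exact: measurable_funB].
have ig : mu.-integrable K (EFin \o g).
  apply/integrableP; split; first exact/measurable_EFinP.
  by under eq_integral => x _ do rewrite gee0_abs ?lee_fin ?g0//.
have Iw : \int[mu]_(x in K) (w n x)%:E @[n --> \oo] --> 0.
  have [] := @dominated_convergence _ _ _ mu K mK (fun n x => (w n x)%:E) (cst 0) (EFin \o g).
  - by move=> n; exact/measurable_EFinP.
  - exact: measurable_cst.
  - apply: filterS fg => x fx Kx; apply: cvg_EFin; first exact: nearW.
    apply: (@squeeze_cvgr _ _ _ _ (cst 0%R) (fun n => `|g x - f_ n x|%R)).
    - by apply: nearW => n; rewrite w0 /w ge_max normr_ge0 ler_norm.
    - exact: cvg_cst.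
    rewrite -(normr0 R) -(subrr (g x)); apply: cvg_norm; apply: cvgB; first exact: cvg_cst.
    exact: fx.
  - exact: ig.
  - by apply: aeW => x n _; rewrite gee0_abs ?lee_fin.
  by move=> _ _; rewrite integral0.
have split n : \int[mu]_(x in K) `|f_ n x - g x|%:E + \int[mu]_(x in K) (g x)%:E =
    \int[mu]_(x in K) (f_ n x)%:E + 2%:E * \int[mu]_(x in K) (w n x)%:E.
  rewrite -ge0_integralZl// ?lee_fin//; last first.
  - by move=> x _; rewrite lee_fin.
  - exact/measurable_EFinP.
  rewrite -!ge0_integralD//.
  - apply: eq_integral => x _; rewrite -EFinM -!EFinD; congr (_%:E).
    rewrite /w; have [gf|fg'] := leP (g x - f_ n x)%R 0%R.
      by rewrite mulr0 addr0 ger0_norm ?subrK// -oppr_le0 opprB.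
    by rewrite ltr0_norm ?opprB; [lra | rewrite -oppr_gt0 opprB].
  - by move=> x _; rewrite lee_fin.
  - exact/measurable_EFinP.
  - by move=> x _; rewrite lee_fin mulr_ge0.
  - by apply/measurable_EFinP; apply: measurable_funM => //; exact: measurable_cst.
  - by apply/measurable_EFinP; apply: measurableT_comp => //; exact: measurable_funB.
  - by move=> x _; rewrite lee_fin.
  - exact/measurable_EFinP.
have Ig : \int[mu]_(x in K) (g x)%:E \is a fin_num.
  by rewrite ge0_fin_numE//; apply: integral_ge0 => x _; rewrite lee_fin.
have -> : (fun n => \int[mu]_(x in K) `|f_ n x - g x|%:E) =
    (fun n => (\int[mu]_(x in K) (f_ n x)%:E + 2%:E * \int[mu]_(x in K) (w n x)%:E)
      - \int[mu]_(x in K) (g x)%:E).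
  by apply/funext => n; rewrite -split addeK.
rewrite -(subee Ig); apply: cvgeB => //; last exact: cvg_cst.
  by rewrite fin_num_adde_defr// fin_numN.
rewrite -[X in _ --> X]adde0 -(mule0 2%:E); apply: cvgeD => //.
  by rewrite mule0 fin_num_adde_defl.
exact: cvgeZl.
Qed.

End scheffe.

Section scaled_density.
Context {R : realType} {n : nat}.

Lemma radial_densityZ (nrm h : 'rV[R]_n -> R) (t : R) x : is_norm nrm -> 0 < t ->
  radial_density nrm h (t *: x) = t ^- n.+1 * radial_density nrm h x.
Proof.
move=> nN t0; rewrite /radial_density -/(unit_vector nrm _) unit_vectorZ//.
by rewrite (nrmZ nN) ?(ltW t0)// exprMn invfM mulrA.
Qed.

Context {dT : measure_display} {T : measurableType dT} {P : probability T R}.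
Variables (Y : T -> 'rV[R]_n) (g : 'rV[R]_n -> R).
Hypothesis mY : measurable_fun setT Y.
Hypothesis Yg : has_density P Y g.
Local Notation leb := (@lebesgue_rV R n).
Local Open Scope ereal_scope.

(** A density is constrained on the orthant only, hence the cut. For [c = k ^+ n] this is the
    density of [Y / k]; regular variation brings in one more factor [k]. *)
Definition rescaled (c k : R) (y : 'rV[R]_n) : R := ((fun y => c * g (k *: y))%R \_ (orthant n)) y.

Lemma rmge0_rescaled c k : (0 <= c)%R -> (0 < k)%R -> rmge0 (rescaled c k).
Proof.
move=> c0 k0; have [mg g0 _] := Yg; have mo := @measurable_orthant R n.
apply: rmge0_patch => //; last by move=> y oy; rewrite mulr_ge0// g0//; exact/orthantZ.
apply: measurable_funM => //.
apply: (measurable_comp mo _ mg).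
  by move=> _ [y oy <-]; exact/orthantZ.
by apply: measurable_funTS; exact: measurable_scale.
Qed.

Lemma rescaledP (c k : R) B : (0 <= c)%R -> (0 < k)%R -> measurable B ->
  c%:E * P [set w | B (k^-1 *: Y w)%R] = \int[leb]_(y in B) (rescaled (c * k ^+ n) k y)%:E.
Proof.
move=> c0 k0 mB; have [mg g0 PY] := Yg; have mo := @measurable_orthant R n.
have k1 : (0 < k^-1)%R by rewrite invr_gt0.
pose B' := [set y | B (k^-1 *: y)%R].
have mB' : measurable B' by rewrite -[X in measurable X]setTI; exact: measurable_scale.
rewrite -[X in P X]/(Y @^-1` B') PY//.
have mo' := measurableI _ _ mB' mo.
have mG : mge0 ((EFin \o g) \_ (B' `&` orthant n)).
  split; last by apply: erestrict_ge0 => y [_ oy]; rewrite lee_fin g0.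
  apply: measurable_patch => //; apply/measurable_EFinP; apply: measurable_funS mg => //.
rewrite [X in _ * X]integral_mkcond.
have -> : \int[leb]_y ((fun x => (g x)%:E) \_ (B' `&` orthant n)) y = (k ^+ n)%:E *
    \int[leb]_y ((EFin \o g) \_ (B' `&` orthant n)) (k *: y)%R.
  by rewrite integral_scale// muleA -EFinM mulfV ?mul1e// expf_neq0// gt_eqF.
rewrite muleA -EFinM -ge0_integralZl//; last 3 first.
- exact: (measurableT_comp mG.1 (measurable_scale k)).
- by move=> x _; exact: mG.2.
- by rewrite lee_fin mulr_ge0// exprn_ge0// ltW.
apply/esym; apply: (etrans (integral_mkcond _ _)); apply: eq_integral => y _.
rewrite /rescaled !epatchE patchE in_setI.
have -> : (k *: y \in B') = (y \in B).
  by apply/idP/idP => /set_mem h; apply/mem_set; move: h; rewrite /B'/= scalerA mulVf ?scale1r// gt_eqF.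
have -> : (k *: y \in orthant n) = (y \in orthant n).
  by apply/idP/idP => /set_mem h; apply/mem_set; apply/(orthantZ k0).
by case: (y \in B); case: (y \in orthant n); rewrite //= ?mule0// mule0.
Qed.

Variables (nu : {measure set 'rV[R]_n -> \bar R}) (l : 'rV[R]_n -> R).
Hypothesis nl : density_of nu l.
Hypothesis rv : regularly_varying P Y nu.
Hypothesis g_cvg : {ae leb, forall x, punctured n x ->
  m%:R ^+ n.+1 * g (m%:R *: x) @[m --> \oo] --> l x}%R.

(** Regular variation along the integers is convergence of the masses on [K], the input that
    [scheffe] requires besides pointwise convergence. The index [m.+1] keeps the scale positive. *)
Lemma cvg_rescaled K : bounded_away K -> nu (boundary K) = 0 ->
  \int[leb]_(y in K) `|rescaled (m.+1%:R ^+ n.+1) m.+1%:R y - l y|%:E @[m --> \oo] --> 0.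
Proof.
move=> bK K0; have [ml l0 nul] := nl; have [mK oK [e e0 eK]] := (bounded_awayP K).1 bK.
have mr m : rmge0 (rescaled (m.+1%:R ^+ n.+1) m.+1%:R).
  by apply: rmge0_rescaled => //; rewrite exprn_ge0.
apply: scheffe => //.
- by move=> m; exact: measurable_funTS (mr m).1.
- by move=> m x; exact: (mr m).2.
- exact: measurable_funTS ml.1.
- exact: ml.2.
- apply: filterS g_cvg => x gx Kx; rewrite /rescaled.
  have ox := oK _ Kx.
  under eq_cvg do rewrite patchE mem_set//.
  have xp : punctured n x.
    by split=> // x0; have [j] := eK _ Kx; rewrite x0 mxE leNgt e0.
  by have := gx xp; rewrite -cvg_shiftS.
- by rewrite -nul//; exact: rv.1.2.
rewrite -nul//; have := rv.2 _ bK K0.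
move=> h; have h2 := cvg_comp _ _ (@cvgr_idn R) h.
rewrite -cvg_shiftS in h2; apply: cvg_trans h2; apply: near_eq_cvg; apply: nearW => m /=.
by rewrite (rescaledP (ltW _) _ mK)//= -exprS.
Qed.

End scaled_density.

Lemma rpatchE {T : Type} {R : realType} (E : set T) (f : T -> R) x :
  (f \_ E) x = if x \in E then f x else 0.
Proof. by rewrite patchE. Qed.

Section corner.
Context {R : realType} {n : nat}.
Implicit Type eps : R.

Definition corner eps : set 'rV[R]_n := [set y | forall j, eps < y ord0 j].

Lemma measurable_corner eps : measurable (corner eps).
Proof. by apply: measurable_forall => j; exact: measurable_coord_lt. Qed.

Lemma corner_orthant eps : 0 < eps -> corner eps `<=` orthant n.
Proof. by move=> e0 y ky j; rewrite ltW// (lt_trans e0). Qed.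

Lemma bounded_away_corner eps : 0 < eps -> (0 < n)%N -> bounded_away (corner eps).
Proof.
move=> e0 n0; apply/bounded_awayP; split; [exact: measurable_corner | exact: corner_orthant |].
by exists eps => // x Kx; exists (Ordinal n0); exact: ltW.
Qed.

Lemma boundary_corner eps : 0 < eps ->
  boundary (corner eps) `<=` [set x | exists j, x ord0 j = eps].
Proof.
move=> e0; rewrite (_ : corner eps =
    orthant n `&` [set x | forall j, j \in [set: 'I_n]%SET -> eps < x ord0 j]).
  exact: boundary_face_slab.
apply/seteqP; split=> [x Kx|x [_ Kx] j]; last by apply: Kx; rewrite inE.
by split=> //; exact: corner_orthant Kx.
Qed.

End corner.
Arguments corner {R} n eps.

(** * Cut densities on two nested vertex sets *)

Section cut_pair.
Context {R : realType} {d : nat} {dT : measure_display} {T : measurableType dT}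
  {P : probability T R}.
Variable X : {RV P >-> 'rV[R]_d}.
Hypothesis X_ge0 : P (X @^-1` ~` orthant d) = 0%E.
Variables (A B : {set 'I_d}) (AB : A \subset B).
Hypothesis A_gt0 : (0 < #|A|)%N.
Variables (fA : 'rV[R]_#|A| -> R) (fB : 'rV[R]_#|B| -> R).
Hypotheses (XfA : has_density P (sub_rV A \o X) fA) (XfB : has_density P (sub_rV B \o X) fB).
Variables (nuA : {measure set 'rV[R]_#|A| -> \bar R}) (nuB : {measure set 'rV[R]_#|B| -> \bar R}).
Variables (lA : 'rV[R]_#|A| -> R) (lB : 'rV[R]_#|B| -> R).
Hypotheses (nlA : density_of nuA lA) (nlB : density_of nuB lB).
Hypotheses (rvA : regularly_varying P (sub_rV A \o X) nuA)
  (rvB : regularly_varying P (sub_rV B \o X) nuB).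
Hypothesis fB_cvg : {ae lebesgue_rV #|B|, forall x, punctured #|B| x ->
  m%:R ^+ #|B|.+1 * fB (m%:R *: x) @[m --> \oo] --> lB x}.
Variable eps : R.
Hypothesis eps_gt0 : 0 < eps.
Local Notation leb n := (@lebesgue_rV R n).
Local Open Scope ereal_scope.
Let K := corner #|A| eps.
Let KB := pr AB @^-1` K.
Let FA m := rescaled fA (m.+1%:R ^+ #|A|.+1) m.+1%:R.
Let FB m := rescaled fB (m.+1%:R ^+ #|B|.+1) m.+1%:R.

Let mK : measurable K. Proof. exact: measurable_corner. Qed.
Let mKB : measurable KB. Proof. exact: measurable_pr_preimage. Qed.
Let mFA m : rmge0 (FA m).
Proof. by apply: (rmge0_rescaled XfA) => //; rewrite exprn_ge0. Qed.
Let mFB m : rmge0 (FB m).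
Proof. by apply: (rmge0_rescaled XfB) => //; rewrite exprn_ge0. Qed.

Let nuK : nuA K < +oo.
Proof. by apply: rvA.1.2; exact: bounded_away_corner. Qed.

Lemma marg_rescaled m : {ae leb d, forall x,
  ((FA m \_ K) (sub_rV A x))%:E = marg A (EFin \o (FB m \_ KB)) x}.
Proof.
have FE (C : {set 'I_d}) (f : 'rV[R]_#|C| -> R) (Xf : has_density P (sub_rV C \o X) f) D :
    measurable D -> \int[leb #|C|]_(y in D) (rescaled f (m.+1%:R ^+ #|C|.+1)%R m.+1%:R y)%:E =
    m.+1%:R%:E * P [set w | D (m.+1%:R^-1 *: (sub_rV C \o X) w)%R].
  by move=> mD; rewrite (rescaledP Xf)// exprS.
apply: marg_eq_on => // [D mD DK|].
  rewrite FE// FE//; last exact: measurable_pr_preimage.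
  congr (_ * P _); apply/seteqP; split=> w; rewrite /preimage/= -(pr_sub AB);
    by rewrite (_ : pr AB (_ *: _) = m.+1%:R^-1 *: pr AB (sub_rV B (X w)))%R//; apply/rowP => j; rewrite !mxE.
rewrite FE//; apply: lte_mul_pinfty; rewrite ?lee_fin//.
have mE : measurable [set w | K (m.+1%:R^-1 *: (sub_rV A \o X) w)%R].
  rewrite -[X in measurable X]setTI.
  apply: (measurableT_comp (measurable_scale _)) => //.
  exact: (measurableT_comp (@measurable_sub_rV R d A) (measurable_funP X)).
by rewrite (le_lt_trans (probability_le1 _ mE))// ltry.
Qed.

(** Nothing relates [nuA] to [nuB] directly; uniqueness of the limit identifies [nuA] with the
    projection of [nuB], whose density is a marginal. *)
Lemma marg_limit : {ae leb d, forall x,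
  ((lA \_ K) (sub_rV A x))%:E = marg A (EFin \o (lB \_ KB)) x}.
Proof.
have [mlA lA0 nulA] := nlA; have [mlB lB0 nulB] := nlB.
have rA := rv_pr_measure AB (measurable_funP X) X_ge0 rvB.
have dA := density_pr_measure nlB rA.1.
have nuE D : measurable D -> nuA D = pr_measure AB nuB D.
  by apply: (rv_unique rvA _ rA); [exact: density_null_hyperplanes nlA | exact: density_null_hyperplanes dA].
apply: marg_eq_on => // [D mD DK|]; last by rewrite -nulA.
rewrite -nulA// nuE// pr_measure_punctured; last first.
  move=> y /DK Ky; split; first exact: (corner_orthant eps_gt0).
  by move=> y0; have := Ky (Ordinal A_gt0); rewrite y0 mxE => /(lt_trans eps_gt0); rewrite ltxx.
by rewrite nulB//; exact: measurable_pr_preimage.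
Qed.

(** No pointwise convergence is assumed of the densities on [A]. The larger densities converge in L1
    on the cylinder [KB], where only the coordinates in [A] exceed [eps]; this set is bounded away
    from the origin because [A] is not empty, and [Ints_contract] passes the convergence on to
    [A]. *)
Lemma cvg_cut x : Ints A (fun x => `|(FA m \_ K) (sub_rV A x) - (lA \_ K) (sub_rV A x)|%:E) x
  @[m --> \oo] --> 0.
Proof.
have [mlA lA0 nulA] := nlA; have [mlB lB0 nulB] := nlB.
have mo := @measurable_orthant R #|B|.
have mcut (C : {set 'I_d}) (D : set 'rV[R]_#|C|) g : measurable D -> rmge0 g -> rmge0 (g \_ D).
  by move=> mD mg; exact: rmge0_patchT.
have msub (C : {set 'I_d}) (g : 'rV[R]_#|C| -> R) : rmge0 g -> rmge0 (g \o sub_rV C).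
  by move=> mg; exact: (rmge0_comp (@measurable_sub_rV R d C) mg).
have deps (C : {set 'I_d}) (g : 'rV[R]_#|C| -> R) : dep C (fun x => ((g \o sub_rV C) x)%:E).
  by move=> y z yz /=; rewrite (sub_rV_eq yz).
have b0 : \int[leb #|B|]_(y in orthant #|B| `&` KB) `|FB m y - lB y|%:E @[m --> \oo] --> 0.
  apply: (cvg_rescaled XfB nlB rvB fB_cvg).
    by apply: bounded_away_rd; exact: bounded_away_corner.
  have mH : measurable [set x : 'rV[R]_#|B| | exists j : 'I_#|A|, x ord0 (pr_index AB j) = eps].
    by apply: measurable_exists => j; exact: measurable_hyperplane.
  apply: (subset_measure0 (measurable_boundary _) mH).
    move=> y /(@boundary_rd _ _ _ (pr_index AB)) /(boundary_corner eps_gt0) [j].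
    by rewrite mxE => yj; exists j.
  apply: null_exists => [j|j]; first exact: measurable_hyperplane.
  exact: density_null_hyperplanes nlB _ _.
apply: (squeeze_cvge _ (cvg_cst 0) b0); apply: nearW => m.
apply/andP; split.
  apply: (mge0_Ints _ _).2; split; last by move=> y; rewrite lee_fin.
  apply/measurable_EFinP; apply: measurableT_comp => //.
  by apply: measurable_funB; [exact: (msub _ _ (mcut _ _ _ mK (mFA m))).1 | exact: (msub _ _ (mcut _ _ _ mK mlA)).1].
apply: le_trans.
  apply: (@Ints_contract R d A B AB ((FA m \_ K) \o sub_rV A) ((lA \_ K) \o sub_rV A)
    ((FB m \_ KB) \o sub_rV B) ((lB \_ KB) \o sub_rV B)).
  - exact/msub/mcut.
  - exact/msub/mcut.
  - exact/msub/mcut.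
  - exact/msub/mcut.
  - exact: deps.
  - exact: deps.
  - exact: deps.
  - exact: deps.
  - exact: marg_rescaled.
  - exact: marg_limit.
have mD : mge0 (fun y => `|(FB m \_ KB) y - (lB \_ KB) y|%:E).
  split; last by move=> y; rewrite lee_fin.
  apply/measurable_EFinP; apply: measurableT_comp => //.
  by apply: measurable_funB; [exact: (mcut _ _ _ mKB (mFB m)).1 | exact: (mcut _ _ _ mKB mlB).1].
rewrite -[leLHS](IntsE x mD) le_eqVlt; apply/orP; left; apply/eqP.
apply/esym; apply: (etrans (integral_mkcond _ _)); apply: eq_integral => y _.
rewrite epatchE !rpatchE in_setI; case: (boolP (y \in orthant #|B|)) => [_|oy] /=.
  by case: (y \in KB) => //; rewrite subrr normr0.
have oy' : ~ orthant #|B| y by move=> /mem_set; exact/negP.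
rewrite /FB /rescaled rpatchE (negbTE oy) lB0; last by case.
by case: ifP => // _; rewrite subrr normr0.
Qed.

(** The corner of the larger set lies in the cylinder over the corner of the smaller one, so the
    marginal identity on the cylinder turns into an inequality. *)
Lemma Ints_cut_le (u : 'rV[R]_#|A| -> R) (U : 'rV[R]_#|B| -> R) : rmge0 U ->
  {ae leb d, forall x, ((u \_ K) (sub_rV A x))%:E = marg A (EFin \o (U \_ KB)) x} ->
  {ae leb d, forall x, Ints (B :\: A)%SET (fun x => ((U \_ (corner #|B| eps)) (sub_rV B x))%:E) x <=
     ((u \_ K) (sub_rV A x))%:E}.
Proof.
move=> mU; apply: filterS => x ->.
have mcut D : measurable D -> mge0 ((EFin \o (U \_ D)) \o sub_rV B).
  move=> mD; apply: mge0_comp; first exact: measurable_sub_rV.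
  apply: rmge0_mge0; exact: rmge0_patchT.
apply: ints_le; [exact: (mcut _ (measurable_corner _)) | exact: mcut |] => y /=.
rewrite lee_fin !rpatchE; case: (boolP (sub_rV B y \in corner #|B| eps)) => [/set_mem yK|_].
  by rewrite mem_set// => j; rewrite mxE; exact: yK.
by case: ifP => // _; exact: mU.2.
Qed.

End cut_pair.

Lemma cvge0_sum {R : realType} (I : Type) (r : seq I) (Q : pred I) (a : nat -> I -> \bar R) :
  (forall i, Q i -> a m i @[m --> \oo] --> 0%E) ->
  (\sum_(i <- r | Q i) a m i)%E @[m --> \oo] --> 0%E.
Proof.
move=> a0; elim: r => [|i r ih].
  rewrite (_ : (fun m => _) = cst 0%E); first exact: cvg_cst.
  by apply/funext => m; rewrite big_nil.
rewrite (_ : (fun m => _) = fun m => (\sum_(i <- i :: r | Q i) a m i)%E)//.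
case: (boolP (Q i)) => Qi; last by under eq_fun do rewrite big_cons (negbTE Qi).
under eq_fun do rewrite big_cons Qi.
have h := @cvgeD _ _ _ _ (fun m => a m i) _ 0%E 0%E isT (a0 i Qi) ih.
by rewrite adde0 in h; exact: h.
Qed.

Section ae_scaling.
Context {R : realType} {n : nat}.

(** The factorization of the density holds almost everywhere and is used at the point
    [m.+1%:R *: x]. *)
Lemma ae_scale (k : R) (Q : 'rV[R]_n -> Prop) : 0 < k ->
  {ae lebesgue_rV n, forall x, Q x} -> {ae lebesgue_rV n, forall x, Q (k *: x)}.
Proof.
move=> k0 [E [mE E0 QE]].
have mI := mge0_indic mE.
have mkE : measurable [set x | E (k *: x)].
  by rewrite -[X in measurable X]setTI; exact: measurable_scale.
exists [set x | E (k *: x)]; split=> //; last by move=> x nQ; exact: QE.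
have h := integral_scale k0 mI.
rewrite [X in (_ * X)%E](_ : _ = 0%E) ?mule0 in h; last by rewrite integral_indic// setIT.
rewrite -h -[X in lebesgue_rV n X]setIT -integral_indic//.
Qed.

End ae_scaling.

(** * Convergence of the rescaled joint density on a corner *)

Section chain_convergence.
Context {R : realType} {d : nat} {dT : measure_display} {T : measurableType dT}
  {P : probability T R}.
Variable X : {RV P >-> 'rV[R]_d}.
Hypothesis X_ge0 : P (X @^-1` ~` orthant d) = 0%E.
Variables (N : nat) (C : 'I_N.+1 -> {set 'I_d}).
Hypotheses (C_rip : running_intersection C)
  (clique_gt0 : forall i, (0 < #|C i|)%N)
  (separator_gt0 : forall i : 'I_N.+1, (0 < i)%N -> (0 < #|separator C i|)%N)
  (C_full : upto C N.+1 = [set: 'I_d]%SET)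
  (C_card : (\sum_i #|C i| = d + \sum_(i < N.+1 | (0 < i)%N) #|separator C i|)%N).
Variables (fX : 'rV[R]_d -> R) (f : forall A : {set 'I_d}, 'rV[R]_#|A| -> R).
Arguments f : clear implicits.
Hypotheses (X_density : has_density P X fX)
  (XA_density : forall A : {set 'I_d}, (0 < #|A|)%N -> has_density P (sub_rV A \o X) (f A))
  (X_factor : {ae lebesgue_rV d, forall x, orthant d x -> fX x = clique_product C f x}).
Variables (nu : forall A : {set 'I_d}, {measure set 'rV[R]_#|A| -> \bar R})
  (g : forall A : {set 'I_d}, 'rV[R]_#|A| -> R).
Arguments g : clear implicits.
Hypotheses (g_ge0 : forall A, clique_or_separator C A -> rmge0 (g A))
  (nu_g : forall A, clique_or_separator C A -> density_of (nu A) (g A \_ (punctured #|A|)))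
  (X_mrv : forall A, clique_or_separator C A -> regularly_varying P (sub_rV A \o X) (nu A))
  (f_cvg : forall i, {ae lebesgue_rV #|C i|, forall x, punctured #|C i| x ->
     m%:R ^+ #|C i|.+1 * f (C i) (m%:R *: x) @[m --> \oo] --> g (C i) x}).
Local Notation leb := (@lebesgue_rV R d).
Local Open Scope ereal_scope.

Let csC i : clique_or_separator C (C i). Proof. by left; exists i. Qed.
Let csS (i : 'I_N.+1) : (0 < i)%N -> clique_or_separator C (separator C i).
Proof. by move=> i0; right; exists i. Qed.

Lemma rmge0_clique_product : rmge0 (clique_product C g).
Proof.
have msub A : clique_or_separator C A -> rmge0 (g A \o sub_rV A).
  by move=> csA; exact: (rmge0_comp (@measurable_sub_rV R d A) (g_ge0 csA)).
apply: (rmge0M (rmge0_prod (fun i _ => msub _ (csC i))) (rmge0V (rmge0_prod _))).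
by move=> i i0; exact/msub/csS.
Qed.

Section fixed_corner.
Variables (eps : R) (eps_gt0 : (0 < eps)%R).

Let cut (A : {set 'I_d}) (u : 'rV[R]_#|A| -> R) (x : 'rV[R]_d) : R := (u \_ (corner #|A| eps)) (sub_rV A x).
Let F (A : {set 'I_d}) m : 'rV[R]_#|A| -> R := rescaled (f A) (m.+1%:R ^+ #|A|.+1) m.+1%:R.
Let l (A : {set 'I_d}) : 'rV[R]_#|A| -> R := g A \_ (punctured #|A|).

Arguments F : clear implicits.
Arguments l : clear implicits.

Let rmge0_cut A u : rmge0 u -> rmge0 (@cut A u).
Proof.
move=> mu; have mc := @measurable_corner R #|A| eps.
apply: (rmge0_comp (@measurable_sub_rV R d A)).
exact: rmge0_patchT.
Qed.

Let rdep_cut (A : {set 'I_d}) u : rdep A (@cut A u).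
Proof. by move=> x y xy; rewrite /cut (sub_rV_eq xy). Qed.

Let mF (A : {set 'I_d}) m : (0 < #|A|)%N -> rmge0 (F A m).
Proof. by move=> A0; apply: (rmge0_rescaled (XA_density A0)) => //; rewrite exprn_ge0. Qed.

Let ml (A : {set 'I_d}) : clique_or_separator C A -> rmge0 (l A).
Proof. by move=> csA; have [] := nu_g csA. Qed.

Let l_cvg i : {ae lebesgue_rV #|C i|, forall x, punctured #|C i| x ->
     m%:R ^+ #|C i|.+1 * f (C i) (m%:R *: x) @[m --> \oo] --> l (C i) x}%R.
Proof. by apply: filterS (f_cvg i) => x fx xp; rewrite /l patchE mem_set//; exact: fx. Qed.

Let p m := chain_product (fun i => cut (F (C i) m)) (fun i => cut (F (separator C i) m)) N.+1.
Let p' := chain_product (fun i => cut (l (C i))) (fun i => cut (l (separator C i))) N.+1.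

Lemma chain_cvg x : Ints [set: 'I_d]%SET (fun y => `|p m y - p' y|%:E) x @[m --> \oo] --> 0.
Proof.
have SC (i : 'I_N.+1) : separator C i \subset C i by exact: subsetIl.
have bound m : Ints [set: 'I_d]%SET (fun y => `|p m y - p' y|%:E) x <=
  \sum_(j < N.+1 | (j <= (ord_max : 'I_N.+1))%N) Ints (C j) (fun y => `|cut (F (C j) m) y - cut (l (C j)) y|%:E) x +
  \sum_(j < N.+1 | (0 < j)%N && (j <= (ord_max : 'I_N.+1))%N)
    Ints (separator C j) (fun y => `|cut (F (separator C j) m) y - cut (l (separator C j)) y|%:E) x.
  have mb i : rmge0 (cut (F (C i) m)) by apply: rmge0_cut; exact: mF.
  have mb' i : rmge0 (cut (l (C i))) by apply: rmge0_cut; exact: ml.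
  have mc (i : 'I_N.+1) : (0 < i)%N -> rmge0 (cut (F (separator C i) m)).
    by move=> i0; apply: rmge0_cut; apply: mF; exact: separator_gt0.
  have mc' (i : 'I_N.+1) : (0 < i)%N -> rmge0 (cut (l (separator C i))).
    by move=> i0; apply: rmge0_cut; apply: ml; exact: csS.
  have bc (i j : 'I_N.+1) : (0 < i)%N -> (j <= i)%N -> separator C i \subset C j ->
      {ae leb, forall x, Ints (C j :\: separator C i)%SET (fun x => (cut (F (C j) m) x)%:E) x <=
        (cut (F (separator C i) m) x)%:E}.
    move=> i0 ji Sj; have A0 := separator_gt0 i0.
    apply: (Ints_cut_le (AB := Sj)); first exact: mF.
    exact: (marg_rescaled Sj (XA_density A0) (XA_density (clique_gt0 j)) eps m).
  have bc' (i : 'I_N.+1) : (0 < i)%N ->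
      {ae leb, forall x, Ints (C i :\: separator C i)%SET (fun x => (cut (l (C i)) x)%:E) x <=
        (cut (l (separator C i)) x)%:E}.
    move=> i0; apply: (Ints_cut_le (AB := SC i)); first exact: ml.
    exact: (marg_limit X_ge0 (SC i) (separator_gt0 i0) (nu_g (csS i0)) (nu_g (csC i))
      (X_mrv (csS i0)) (X_mrv (csC i)) eps_gt0).
  have h := chain_L1 C_rip mb mb' mc mc' (fun i => rdep_cut _) (fun i => rdep_cut _)
    (fun i _ => rdep_cut _) (fun i _ => rdep_cut _) bc bc' x (erefl (val (ord_max : 'I_N.+1))).
  rewrite (_ : upto C _ = [set: 'I_d]%SET) in h; last exact: C_full.
  exact: h.
have cv (A : {set 'I_d}) i : clique_or_separator C A -> (0 < #|A|)%N -> A \subset C i ->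
    Ints A (fun y => `|cut (F A m) y - cut (l A) y|%:E) x @[m --> \oo] --> 0.
  move=> csA A0 sAC; apply: (cvg_cut X_ge0 sAC A0 (XA_density A0) (XA_density (clique_gt0 i)) (nu_g csA) (nu_g (csC i)) (X_mrv csA) (X_mrv (csC i)) (@l_cvg i) eps_gt0).
have h1 := @cvge0_sum R _ (index_enum 'I_N.+1) (fun j => (j <= (ord_max : 'I_N.+1))%N)
  (fun m j => Ints (C j) (fun y => `|cut (F (C j) m) y - cut (l (C j)) y|%:E) x)
  (fun j _ => cv _ j (csC j) (clique_gt0 j) (fintype.subxx _)).
have h2 := @cvge0_sum R _ (index_enum 'I_N.+1) (fun j => (0 < j)%N && (j <= (ord_max : 'I_N.+1))%N)
  (fun m j => Ints (separator C j) (fun y => `|cut (F (separator C j) m) y - cut (l (separator C j)) y|%:E) x)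
  (fun j j0 => cv _ j (csS (proj1 (andP j0))) (separator_gt0 (proj1 (andP j0))) (SC j)).
have h3 := cvgeD (isT : 0 +? 0) h1 h2; rewrite adde0 in h3.
have {}h3 := h3 eventually_filter.
apply: (squeeze_cvge _ (cvg_cst 0) h3).
apply: nearW => m; rewrite bound andbT.
have mp : rmge0 (p m).
  by apply: rmge0_chain => i *; apply: rmge0_cut; apply: mF => //; exact: separator_gt0.
have mp' : rmge0 p'.
  by apply: rmge0_chain => i *; apply: rmge0_cut; apply: ml => //; exact: csS.
exact: (mge0_Ints _ (rmge0_mge0 (rmge0_dist mp mp'))).2.
Qed.

Let cornerP x (A : {set 'I_d}) : corner d eps x -> corner #|A| eps (sub_rV A x).
Proof. by move=> Kx j; rewrite mxE. Qed.

Let cut_corner A u x : corner d eps x -> @cut A u x = u (sub_rV A x).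
Proof. by move=> Kx; rewrite /cut patchE mem_set//; exact: cornerP. Qed.

(** The cliques cover all vertices, so outside the corner some cut clique factor is zero and the
    whole product vanishes. *)
Let chain_off (u : forall A : {set 'I_d}, 'rV[R]_#|A| -> R) s x : ~ corner d eps x ->
  chain_product (fun i => cut (u (C i))) s N.+1 x = 0%R.
Proof.
move=> /existsNP[v /negP]; rewrite -leNgt => xv.
have : v \in upto C N.+1 by rewrite C_full inE.
move=> /bigcupP[i _ vi]; rewrite /chain_product (bigD1 i)//=.
rewrite {1}/cut rpatchE memNset ?mul0r//.
move=> /(_ (enum_rank_in vi v)); rewrite mxE enum_rankK_in//.
by rewrite ltNge xv.
Qed.

Lemma chain_limitE x : p' x = (clique_product C g \_ (corner d eps)) x.
Proof.
rewrite rpatchE; case: (boolP (x \in corner d eps)) => [/set_mem Kx|xK]; last first.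
  by apply: (chain_off l) => Kx; case/negP: xK; exact: mem_set.
have lE (A : {set 'I_d}) : (0 < #|A|)%N -> cut (l A) x = g A (sub_rV A x).
  move=> A0; rewrite cut_corner// /l patchE mem_set//.
  have KA : corner #|A| eps (sub_rV A x) := cornerP Kx.
  split; first exact: corner_orthant KA.
  move=> y0; have := KA (Ordinal A0); rewrite y0 mxE => /(lt_trans eps_gt0).
  by rewrite ltxx.
rewrite /p' /chain_product /clique_product; congr (_ / _)%R.
  by apply: eq_big => [i|i _]; [rewrite ltn_ord | exact: lE].
by apply: eq_big => [i|i /andP[i0 _]]; [rewrite ltn_ord andbT | apply: lE; exact: separator_gt0].
Qed.

(** The powers of [m.+1] contributed by the cliques, divided by those of the separators, leave the
    exponent [d.+1] by [sum_card_cliquesS]. *)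
Lemma chain_rescaledE m : {ae leb, forall x, p m x =
  (rescaled fX (m.+1%:R ^+ d.+1) m.+1%:R \_ (corner d eps)) x}.
Proof.
have m0 : (0 < m.+1%:R :> R)%R by [].
apply: filterS (ae_scale m0 X_factor) => x fx.
rewrite rpatchE; case: (boolP (x \in corner d eps)) => [/set_mem Kx|xK]; last first.
  by apply: (chain_off (fun A => F A m)) => Kx; case/negP: xK; exact: mem_set.
have ox : orthant d x by exact: corner_orthant Kx.
have FE (A : {set 'I_d}) : cut (F A m) x = (m.+1%:R ^+ #|A|.+1 * f A (sub_rV A (m.+1%:R *: x)))%R.
  rewrite cut_corner// /F /rescaled patchE mem_set//; last first.
    exact/(corner_orthant eps_gt0)/cornerP.
  by congr (_ * f A _)%R; apply/rowP => j; rewrite !mxE.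
rewrite /rescaled patchE mem_set// fx; last exact/orthantZ.
rewrite /p /chain_product /clique_product.
rewrite (eq_big predT (fun i => m.+1%:R ^+ #|C i|.+1 * f (C i) (sub_rV (C i) (m.+1%:R *: x)))%R) => [|i|i _]; [|by rewrite ltn_ord|exact: FE].
rewrite [in X in (_ / X)%R](eq_big (fun i : 'I_N.+1 => (0 < i)%N) (fun i => m.+1%:R ^+ #|separator C i|.+1 * f (separator C i) (sub_rV (separator C i) (m.+1%:R *: x)))%R) => [|i|i _]; [|by rewrite ltn_ord andbT|exact: FE].
rewrite !big_split /= !prodrXr.
have k0 a : (m.+1%:R ^+ a != 0 :> R)%R by rewrite expf_neq0// pnatr_eq0.
by rewrite (sum_card_cliquesS C_card) exprD invfM mulrACA mulfK.
Qed.

Lemma cvg_corner B : measurable B ->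
  m.+1%:R%:E * P [set w | (B `&` corner d eps) (m.+1%:R^-1 *: X w)%R] @[m --> \oo] -->
    \int[leb]_(x in B `&` corner d eps) (clique_product C g x)%:E /\
  \int[leb]_(x in B `&` corner d eps) (clique_product C g x)%:E \is a fin_num.
Proof.
move=> mB; have mc := @measurable_corner R d eps; have mBc := measurableI _ _ mB mc.
pose D := B `&` corner d eps.
pose a m := \int[leb]_(x in D) (p m x)%:E.
have mp m : rmge0 (p m).
  apply: rmge0_chain => [i|i i0]; apply: rmge0_cut; apply: mF => //.
  exact: separator_gt0.
have mp' : rmge0 p'.
  apply: rmge0_chain => [i|i i0]; apply: rmge0_cut; apply: ml; [exact: csC | exact: csS].
have mdist m : rmge0 (fun x => `|p m x - p' x|%R) by exact: rmge0_dist.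
have aE m : a m = m.+1%:R%:E * P [set w | D (m.+1%:R^-1 *: X w)%R].
  rewrite (rescaledP X_density)//; apply: ae_eq_integral => //.
  - exact: rmge0_measurable.
  - apply: measurable_funTS; apply: (rmge0_mge0 (rmge0_rescaled X_density _ _)).1 => //.
  apply: filterS (chain_rescaledE m) => x -> [_ Kx].
  by rewrite patchE mem_set// exprS.
have bE : \int[leb]_(x in D) (clique_product C g x)%:E = \int[leb]_(x in D) (p' x)%:E.
  apply: eq_integral => x /set_mem[_ Kx]; rewrite chain_limitE patchE mem_set//.
rewrite bE; suff : a m @[m --> \oo] --> \int[leb]_(x in D) (p' x)%:E /\
    \int[leb]_(x in D) (p' x)%:E \is a fin_num.
  by move=> [h ?]; split=> //; under eq_fun do rewrite -aE.
pose e m := \int[leb]_x `|p m x - p' x|%:E.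
have e0 : e m @[m --> \oo] --> 0.
  have h := chain_cvg 0%R; apply: cvg_trans h; apply: near_eq_cvg; apply: nearW => m.
  by rewrite /e (IntsTE 0%R (rmge0_mge0 (mdist m))).
have eD m : \int[leb]_(x in D) `|p m x - p' x|%:E <= e m.
  by apply: ge0_subset_integral => //; exact: (rmge0_mge0 (mdist m)).1.
have mD (u : 'rV[R]_d -> R) : rmge0 u -> measurable_fun D (EFin \o u).
  move=> mu; exact: rmge0_measurable.
have ab (u v : 'rV[R]_d -> R) : rmge0 u -> rmge0 v ->
    \int[leb]_(x in D) (u x)%:E <= \int[leb]_(x in D) (v x)%:E + \int[leb]_(x in D) `|u x - v x|%:E.
  move=> mu mv; rewrite -ge0_integralD//; last 3 first.
  - by move=> x _; rewrite lee_fin; exact: mv.2.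
  - exact: mD.
  - exact: mD (rmge0_dist mu mv).
  apply: ge0_le_integral => //.
  - by move=> x _; rewrite lee_fin; exact: mu.2.
  - exact: mD.
  - by apply: emeasurable_funD; [exact: mD | exact: mD (rmge0_dist mu mv)].
  by move=> x _; rewrite -EFinD lee_fin addrC -lerBlDr ler_norm.
have le1 m : a m <= \int[leb]_(x in D) (p' x)%:E + e m.
  by apply: (le_trans (ab _ _ (mp m) mp')); rewrite leeD2l.
have le2 m : \int[leb]_(x in D) (p' x)%:E <= a m + e m.
  apply: (le_trans (ab _ _ mp' (mp m))); rewrite leeD2l//.
  by under eq_integral do rewrite distrC.
have a_fin m : a m < +oo.
  have mE : measurable [set w | D (m.+1%:R^-1 *: X w)%R].
    rewrite -[X in measurable X]setTI.
    by apply: (measurableT_comp (measurable_scale _) (measurable_funP X)).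
  by rewrite aE lte_mul_pinfty ?lee_fin// (le_lt_trans (probability_le1 _ mE))// ltry.
set I := \int[leb]_(x in D) (p' x)%:E in le1 le2 *.
have I0 : 0 <= I by apply: integral_ge0 => x _; rewrite lee_fin; exact: mp'.2.
have e_ge0 m : 0 <= e m by apply: integral_ge0 => x _; rewrite lee_fin.
have e_small : \forall m \near \oo, e m < 1%:E.
  have h : nbhs (0 : \bar R) [set x | x < 1%:E].
    by apply: open_nbhs_nbhs; split; [exact: open_ereal_lt_ereal | rewrite /= lte_fin].
  exact: (e0 _ h).
(* Finiteness of the limit comes from a single index: [a m] is finite, being a multiple of a
   probability, and for some [m] the distance to the limit is below 1. *)
have I_fin : I \is a fin_num.
  rewrite ge0_fin_numE//; have [m _ /(_ m (leqnn m)) em] := e_small.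
  by rewrite (le_lt_trans (le2 m))// lte_add_pinfty// (lt_trans em)// ltry.
have h1 : I + e m @[m --> \oo] --> I.
  by rewrite -[X in _ --> X]adde0; apply: cvgeD => //; [rewrite fin_num_adde_defr | exact: cvg_cst].
have h2 : I - e m @[m --> \oo] --> I.
  rewrite -[X in _ --> X]sube0; apply: cvgeB => //; [rewrite fin_num_adde_defr// | exact: cvg_cst].
split=> //; apply: (squeeze_cvge _ h2 h1); apply: filterS e_small => m em; rewrite le1 andbT.
by rewrite leeBlDr// ge0_fin_numE// (lt_trans em)// ltry.
Qed.

End fixed_corner.

End chain_convergence.

(** * Tightness *)

Lemma cvg_natSy {R : realType} : (m.+1%:R : R) @[m --> \oo] --> +oo.
Proof. by have h := @cvgr_idn R; rewrite -cvg_shiftS in h; exact: h. Qed.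

Section rescaled_vector.
Context {R : realType} {d : nat} {dT : measure_display} {T : measurableType dT}
  {P : probability T R}.
Variable X : {RV P >-> 'rV[R]_d}.
Hypothesis X_ge0 : P (X @^-1` ~` orthant d) = 0%E.
Local Notation leb := (@lebesgue_rV R d).
Local Open Scope ereal_scope.

Lemma measurable_rescaled (k : R) B : measurable B -> measurable [set w | B (k *: X w)%R].
Proof.
move=> mB; rewrite -[X in measurable X]setTI.
by apply: (measurableT_comp (measurable_scale _) (measurable_funP X)).
Qed.

Lemma measurable_slab (u v : 'I_d) (a b : R) :
  measurable [set x : 'rV[R]_d | (a < x ord0 u)%R /\ (x ord0 v <= b)%R].
Proof. by apply: measurableI; [exact: measurable_coord_lt | exact: measurable_coord_le]. Qed.

(** No mass of order [1 / t] escapes to the region where [X_u] is of size [t] while [X_v] is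
    negligible. *)
Definition tight (u v : 'I_d) := forall delta eta : R, (0 < delta)%R -> (0 < eta)%R ->
  exists2 eps : R, (0 < eps)%R & \forall t \near +oo%R,
    t%:E * P [set w | (delta < (t^-1 *: X w) ord0 u)%R /\ ((t^-1 *: X w) ord0 v <= eps)%R] <= eta%:E.

Lemma tight_refl u : tight u u.
Proof.
move=> delta eta d0 eta0; exists delta => //; apply: nearW => t.
rewrite [X in P X](_ : _ = set0) ?measure0 ?mule0 ?lee_fin ?ltW//.
by apply/seteqP; split=> w //= -[]; rewrite ltNge => /negP.
Qed.

(** Split according to whether coordinate [v] exceeds the threshold [e1] provided by the first
    assumption; if it does, [e1] serves as [delta] in the second. *)
Lemma tight_trans u v w : tight u v -> tight v w -> tight u w.
Proof.
move=> uv vw delta eta d0 eta0.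
have eta2 : (0 < eta / 2)%R by rewrite divr_gt0.
have [e1 e10 H1] := uv _ _ d0 eta2; have [e2 e20 H2] := vw _ _ e10 eta2.
exists e2 => //; near=> t.
have t0 : (0 < t)%R by near: t; exact: nbhs_pinfty_gt.
have m1 := measurable_rescaled t^-1%R (measurable_slab u v delta e1).
have m2 := measurable_rescaled t^-1%R (measurable_slab v w e1 e2).
have m3 := measurable_rescaled t^-1%R (measurable_slab u w delta e2).
rewrite (splitr eta) EFinD.
apply: (@le_trans _ _ (t%:E * (P [set z | (delta < (t^-1 *: X z) ord0 u)%R /\ ((t^-1 *: X z) ord0 v <= e1)%R] +
  P [set z | (e1 < (t^-1 *: X z) ord0 v)%R /\ ((t^-1 *: X z) ord0 w <= e2)%R]))).
  rewrite lee_pmul2l// ?lte_fin//.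
  apply: (le_trans _ (measureU2 _ m1 m2)); apply: le_measure; rewrite ?inE//.
    exact: measurableU.
  move=> z /= [zu zw]; have [zv|zv] := leP ((t^-1 *: X z) ord0 v) e1%R; first by left.
  by right.
rewrite ge0_muleDr//; apply: leeD; near: t; [exact: H1 | exact: H2].
Unshelve. all: by end_near. Qed.

Lemma tight_connected (e : rel 'I_d) u v :
  (forall u v, e u v -> tight u v) -> connect e u v -> tight u v.
Proof.
move=> et /connectP[p pp ->]; elim: p u pp => [|w p ih] u /=; first by move=> _; exact: tight_refl.
by move=> /andP[/et uw /ih]; exact: tight_trans.
Qed.

(** The slabs with [x_u > delta] and [x_v <= 1 / k.+1] decrease to a subset of the null hyperplane
    [x_v = 0]. Some slab thus has small limit mass, and regular variation transfers this to large
    [t]. *)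
Lemma tight_clique (A : {set 'I_d}) (nu : {measure set 'rV[R]_#|A| -> \bar R}) u v :
  regularly_varying P (sub_rV A \o X) nu -> null_hyperplanes nu ->
  u \in A -> v \in A -> tight u v.
Proof.
move=> rv nh uA vA delta eta d0 eta0.
pose iu := enum_rank_in uA u; pose iv := enum_rank_in uA v.
have iuE : enum_val iu = u by rewrite enum_rankK_in.
have ivE : enum_val iv = v by rewrite enum_rankK_in.
pose D k : set 'rV[R]_#|A| := orthant #|A| `&` [set x | (delta < x ord0 iu)%R /\ (x ord0 iv <= k.+1%:R^-1)%R].
have mo := @measurable_orthant R #|A|.
have mD k : measurable (D k).
  apply: measurableI => //; apply: measurableI; [exact: measurable_coord_lt | exact: measurable_coord_le].
have bD k : bounded_away (D k).
  apply/bounded_awayP; split=> //; first by move=> x [].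
  by exists delta => // x [_ [/ltW ? _]]; exists iu.
have D0 k : nu (boundary (D k)) = 0.
  have mU := measurableU _ _ (measurable_hyperplane iu delta) (measurable_hyperplane iv k.+1%:R^-1%R).
  apply: (subset_measure0 (measurable_boundary _) mU); first exact: boundary_slab.
  apply/eqP; rewrite eq_le measure_ge0 andbT.
  apply: (le_trans (measureU2 _ (measurable_hyperplane iu delta) (measurable_hyperplane iv k.+1%:R^-1%R))).
  rewrite [X in X + _](_ : _ = 0); last exact: nh.
  by rewrite add0e [X in X <= _](_ : _ = 0)//; exact: nh.
have cD : nu (D k) @[k --> \oo] --> nu (\bigcap_k D k).
  apply: nonincreasing_cvg_mu => //.
  - by apply: rv.1.2; exact: bD.
  - exact: bigcapT_measurable.
  move=> k l kl; apply/subsetPset => x [ox [xu xv]]; split=> //; split=> //.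
  by rewrite (le_trans xv)// lef_pV2 ?posrE// ler_nat.
have cD0 : nu (\bigcap_k D k) = 0.
  apply: (subset_measure0 _ (measurable_hyperplane iv 0%R)); last exact: nh.
    exact: bigcapT_measurable.
  move=> x Dx; apply/eqP; rewrite eq_le; apply/andP; split; last by have [ox _] := Dx 0%N Logic.I; exact: ox.
  rewrite leNgt; apply/negP => xv; have [k kx] := ltr_add_invr xv.
  rewrite add0r in kx; have [_ [_ ]] := Dx k Logic.I.
  by rewrite leNgt kx.
rewrite cD0 in cD.
have small : nbhs (0 : \bar R) [set x | x < eta%:E].
  by apply: open_nbhs_nbhs; split; [exact: open_ereal_lt_ereal | rewrite /= lte_fin].
have [k _ /(_ k (leqnn k)) /= kD] := cD _ small.
exists k.+1%:R^-1%R; first by rewrite invr_gt0.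
have h := rv.2 _ (bD k) (D0 k).
have small2 : nbhs (nu (D k)) [set x | x < eta%:E].
  by apply: open_nbhs_nbhs; split; first exact: open_ereal_lt_ereal.
have {}h := h _ small2.
near=> t.
have t0 : (0 < t)%R by near: t; exact: nbhs_pinfty_gt.
have t1 : (0 < t^-1)%R by rewrite invr_gt0.
have : t%:E * P [set w | D k (t^-1 *: (sub_rV A \o X) w)%R] < eta%:E by near: t; exact: h.
move=> /ltW; apply: le_trans; rewrite lee_pmul2l// ?lte_fin//.
have mE2 : measurable [set w | D k (t^-1 *: (sub_rV A \o X) w)%R].
  rewrite -[X in measurable X]setTI.
  apply: (measurableT_comp (measurable_scale _)) => //.
  exact: (measurableT_comp (@measurable_sub_rV R d A) (measurable_funP X)).
have mE1 := measurable_rescaled t^-1%R (measurable_slab u v delta k.+1%:R^-1%R).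
have mN : measurable (X @^-1` ~` orthant d).
  by apply: measurable_funPTI; apply: measurableC; exact: measurable_orthant.
apply: (@le_trans _ _ (P ([set w | D k (t^-1 *: (sub_rV A \o X) w)%R] `|` X @^-1` ~` orthant d))).
  apply: le_measure; rewrite ?inE//; first exact: measurableU.
  move=> w [wu wv]; have [ow|ow] := pselect (orthant d (X w)); [left | by right].
  split; first by apply/(orthantZ t1) => j; rewrite mxE; exact: ow.
  by move: wu wv; rewrite /= !mxE iuE ivE.
by rewrite (le_trans (measureU2 _ mE2 mN))// [X in _ + X](_ : _ = 0)// adde0.
Unshelve. all: by end_near. Qed.

Section box_convergence.
Variable lam : 'rV[R]_d -> R.
Hypothesis mlam : rmge0 lam.
Hypothesis cvg_lam : forall eps B, (0 < eps)%R -> measurable B ->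
  m.+1%:R%:E * P [set w | (B `&` corner d eps) (m.+1%:R^-1 *: X w)%R] @[m --> \oo] -->
    \int[leb]_(x in B `&` corner d eps) (lam x)%:E /\
  \int[leb]_(x in B `&` corner d eps) (lam x)%:E \is a fin_num.
Hypothesis X_tight : forall u v, tight u v.

Lemma tight_box (y : 'rV[R]_d) (eta : R) : (forall j, 0 < y ord0 j)%R -> (0 < eta)%R ->
  exists2 eps : R, (0 < eps)%R & \forall t \near +oo%R,
    t%:E * P [set w | (box_compl y `\` corner d eps) (t^-1 *: X w)%R] <= eta%:E.
Proof.
move=> y0 eta0; pose J := ('I_d * 'I_d)%type.
(* A point of the box complement outside the corner has some [x_u > y_u] and some [x_v <= eps]. The
   error [eta] is shared among all such pairs, and the successor keeps the denominator positive. *)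
pose eta' := (eta / #|{: J}|.+1%:R)%R.
have eta'0 : (0 < eta')%R by rewrite divr_gt0.
have /choice[ef Hef] : forall p : J, exists eps : R, (0 < eps)%R /\ \forall t \near +oo%R,
    t%:E * P [set w | (y ord0 p.1 < (t^-1 *: X w) ord0 p.1)%R /\ ((t^-1 *: X w) ord0 p.2 <= eps)%R] <= eta'%:E.
  by move=> p; have [eps e0 H] := X_tight p.1 p.2 (y0 p.1) eta'0; exists eps.
exists (\big[Num.min/1%R]_p ef p)%R.
  by apply: lt_bigmin => // p _; exact: (Hef p).1.
have H := filter_forall _ (fun p => (Hef p).2).
near=> t.
have t0 : (0 < t)%R by near: t; exact: nbhs_pinfty_gt.
have Ht p : t%:E * P [set w | (y ord0 p.1 < (t^-1 *: X w) ord0 p.1)%R /\ ((t^-1 *: X w) ord0 p.2 <= ef p)%R] <= eta'%:E.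
  by move: p; near: t; exact: H.
have mF (p : J) := measurable_rescaled t^-1%R (measurable_slab p.1 p.2 (y ord0 p.1) (ef p)).
apply: (@le_trans _ _ (t%:E * \sum_p P [set w | (y ord0 p.1 < (t^-1 *: X w) ord0 p.1)%R /\ ((t^-1 *: X w) ord0 p.2 <= ef p)%R])).
  rewrite lee_pmul2l ?lte_fin//; apply: (le_trans _ (measure_exists_le P mF)).
  apply: le_measure; rewrite ?inE.
  - apply: measurable_rescaled; apply: measurableD; first exact: measurable_box_compl.
    exact: measurable_corner.
  - by apply: measurable_exists.
  move=> w [[ow /existsNP[u /negP]]]; rewrite -ltNge => yu /existsNP[v /negP]; rewrite -leNgt => xv.
  exists (u, v) => /=; split=> //; apply: (le_trans xv).
  exact: bigmin_le_cond.
rewrite ge0_sume_distrr//.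
apply: (@le_trans _ _ (\sum_(p : J) eta'%:E)); first by apply: lee_sum => p _; exact: Ht.
rewrite sumEFin lee_fin sumr_const -mulr_natr /eta' -mulrA ler_piMr ?(ltW eta0)//.
by rewrite ler_pdivrMl// mulr1 ler_nat.
Unshelve. all: by end_near. Qed.

(** Exchange of the limits in [m] and in [eps]: one corner captures both the prelimit mass and the
    limit integral up to [eta]. *)
Lemma cvg_box (y : 'rV[R]_d) : (forall j, 0 < y ord0 j)%R ->
  m.+1%:R%:E * P [set w | box_compl y (m.+1%:R^-1 *: X w)%R] @[m --> \oo] -->
    \int[leb]_(x in box_compl y) (lam x)%:E /\
  \int[leb]_(x in box_compl y) (lam x)%:E \is a fin_num.
Proof.
move=> y0; pose D := box_compl y; have mD : measurable D by exact: measurable_box_compl.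
have mK eps : measurable (D `&` corner d eps) by apply: measurableI => //; exact: measurable_corner.
pose a m := m.+1%:R%:E * P [set w | D (m.+1%:R^-1 *: X w)%R].
pose c eps m := m.+1%:R%:E * P [set w | (D `&` corner d eps) (m.+1%:R^-1 *: X w)%R].
pose I eps := \int[leb]_(x in D `&` corner d eps) (lam x)%:E.
pose L := \int[leb]_(x in D) (lam x)%:E.
have [mE E0] := rmge0_mge0 mlam.
have ca eps m : c eps m <= a m.
  rewrite lee_pmul2l ?lte_fin//; apply: le_measure; rewrite ?inE; [exact: measurable_rescaled|exact: measurable_rescaled|].
  by move=> w [].
have IL eps : I eps <= L.
  by apply: ge0_subset_integral => //; exact: measurable_funTS.
have main eta : (0 < eta)%R -> exists2 eps, (0 < eps)%R & (\forall m \near \oo, a m <= c eps m + eta%:E) /\ L <= I eps + eta%:E.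
  move=> eta0; have [eps e0 He] := tight_box y0 eta0.
  have Hm : \forall m \near \oo, a m <= c eps m + eta%:E.
    have Hs : \forall m \near \oo,
      m.+1%:R%:E * P [set w | (D `\` corner d eps) (m.+1%:R^-1 *: X w)%R] <= eta%:E := @cvg_natSy R _ He.
    apply: filterS Hs => m Hm.
    have mDm : measurable [set w | D (m.+1%:R^-1 *: X w)%R] by exact: measurable_rescaled.
    have mcm : measurable [set w | corner d eps (m.+1%:R^-1 *: X w)%R].
      by apply: measurable_rescaled; exact: measurable_corner.
    rewrite /a (measureDI P mDm mcm) ge0_muleDr// addeC leeD//.
  exists eps => //; split=> //.
  (* The corners at [1 / j.+1] exhaust [D] up to the coordinate hyperplanes, which are null. The
     integral over each is a limit of prelimit masses, themselves at most [c eps m + eta] for large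
     [m], so no limit mass beyond [eta] lies off the corner at [eps]. *)
  pose Lm := density_measure leb mE E0.
  pose G j := D `&` corner d j.+1%:R^-1%R.
  have cG : Lm (G j) @[j --> \oo] --> Lm (\bigcup_j G j).
    apply: nondecreasing_cvg_mu => //.
    - by move=> j; exact: mK.
    - by apply: bigcupT_measurable => j; exact: mK.
    move=> i j ij; apply/subsetPset => x [Dx Kx]; split=> // v.
    by rewrite (le_lt_trans _ (Kx v))// lef_pV2 ?posrE// ler_nat.
  have GL : Lm (\bigcup_j G j) = L.
    have mH : measurable [set x : 'rV[R]_d | exists j, x ord0 j = 0%R].
      by apply: measurable_exists => j; exact: measurable_hyperplane.
    have mG : measurable (\bigcup_j G j) by apply: bigcupT_measurable => j; exact: mK.
    rewrite density_measureE /L.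
    apply: (etrans (integral_mkcond _ _)); apply/esym; apply: (etrans (integral_mkcond _ _)).
    apply: ae_eq_integral => //; [exact: measurable_patch _ (measurable_funTS _) | exact: measurable_patch _ (measurable_funTS _) |].
    exists [set x : 'rV[R]_d | exists j, x ord0 j = 0%R]; split=> //.
      by apply: null_exists => j; [exact: measurable_hyperplane | exact: lebesgue_hyperplane].
    move=> x /= nx; apply: contrapT => /forallNP x0; apply: nx => _; rewrite !epatchE.
    have [Dx|Dx] := pselect (D x); last first.
      by rewrite !memNset// => -[j _ [/Dx]].
    rewrite !mem_set//; have ox : orthant d x by have [] := Dx.
    have xp j : (0 < x ord0 j)%R by rewrite lt_neqAle ox andbT eq_sym; apply/eqP; exact: x0.
    have b0 : (0 < \big[Num.min/1%R]_j x ord0 j)%R by apply: lt_bigmin.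
    have [k kx] := ltr_add_invr b0; rewrite add0r in kx.
    by exists k => //; split=> // j; rewrite (lt_le_trans kx)//; exact: bigmin_le_cond.
  rewrite GL in cG; have /cvg_lim <- // := cG.
  apply: lime_le; first by apply/cvg_ex; exists L.
  apply: nearW => j; have j0 : (0 < j.+1%:R^-1 :> R)%R by rewrite invr_gt0.
  have [h1 f1] := cvg_lam j0 mD; have [h2 f2] := cvg_lam e0 mD.
  have h3 : c eps m + eta%:E @[m --> \oo] --> I eps + eta%:E.
    by apply: cvgeD => //; [rewrite fin_num_adde_defl | exact: cvg_cst].
  rewrite -[leRHS](cvg_lim _ h3)// -[leLHS](cvg_lim _ h1)//.
  apply: lee_lim; [by apply/cvg_ex; eexists; exact: h1 | by apply/cvg_ex; eexists; exact: h3 |].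
  by apply: filterS Hm => m; apply: le_trans; exact: ca.
have Lfin : L \is a fin_num.
  have [eps e0 [_ LI]] := main 1%R ltr01.
  have [_ f2] := cvg_lam e0 mD.
  rewrite ge0_fin_numE; last by apply: integral_ge0 => x _; exact: E0.
  by rewrite (le_lt_trans LI)// ltey_eq fin_numD f2.
split=> //.
have fin (B : set 'rV[R]_d) m : measurable B -> m.+1%:R%:E * P [set w | B (m.+1%:R^-1 *: X w)%R] \is a fin_num.
  by move=> mB; rewrite fin_numM// fin_num_measure//; exact: measurable_rescaled.
rewrite -/L -(fineK Lfin); apply/fine_cvgP; split; first by apply: nearW => m; exact: fin.
apply/cvgrPdist_le => eta eta0; have eta2 : (0 < eta / 2)%R by rewrite divr_gt0.
have [eps e0 [Hm LI]] := main _ eta2; have [h2 f2] := cvg_lam e0 mD.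
rewrite -(fineK f2) in h2; have /fine_cvgP[_ /cvgrPdist_le /(_ _ eta2) Hc] := h2.
apply: filterS2 Hm Hc => m am /= cm; have afin := fin D m mD; have cfin := fin _ m (mK eps).
have r1 : (fine (a m) <= fine (c eps m) + eta / 2)%R by rewrite -lee_fin EFinD !fineK.
have r2 : (fine (c eps m) <= fine (a m))%R by rewrite -lee_fin !fineK.
have r3 : (fine L <= fine (I eps) + eta / 2)%R by rewrite -lee_fin EFinD !fineK.
have r4 : (fine (I eps) <= fine L)%R by rewrite -lee_fin !fineK.
move: cm; rewrite -/D -/(I eps) -/(c eps m) -/(a m) -/L ler_distl => /andP[c1 c2].
by rewrite ler_distl; apply/andP; split; lra.
Qed.

End box_convergence.

End rescaled_vector.

(** * Domains of attraction *)

(** With [x = a m / m.+1], raise [exp(- x / (1 - x)) <= 1 - x <= exp(- x)] to the power [m.+1]; both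
    outer terms converge to [exp(- l)]. *)
Lemma cvg_pow_exp {R : realType} (a : nat -> R) (l : R) :
  a m @[m --> \oo] --> l -> (1 - a m / m.+1%:R) ^+ m.+1 @[m --> \oo] --> expR (- l).
Proof.
move=> al.
have inv0 : (m.+1%:R^-1 : R) @[m --> \oo] --> (0 : R).
  by apply/gtr0_cvgV0; [exact: nearW | exact: cvg_natSy].
have x0 : a m / m.+1%:R @[m --> \oo] --> (0 : R).
  by rewrite -(mulr0 l); apply: cvgM.
have cE (u : nat -> R) (v : R) : u m @[m --> \oo] --> v -> expR (u m) @[m --> \oo] --> expR v.
  by move=> uv; apply: (cvg_comp _ _ uv); exact: continuous_expR.
have lo : expR (- (a m / (1 - a m / m.+1%:R))) @[m --> \oo] --> expR (- l).
  apply: cE; apply: cvgN; rewrite -[X in _ --> X]divr1; apply: cvgM => //.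
  apply: cvgV; first exact: oner_neq0.
  by rewrite -[X in _ --> X]subr0; apply: cvgB => //; exact: cvg_cst.
have hi : expR (- a m) @[m --> \oo] --> expR (- l) by apply: cE; exact: cvgN.
have small : \forall m \near \oo, a m / m.+1%:R < 1.
  by apply: (cvgr_lt 0 x0); exact: ltr01.
apply: (squeeze_cvgr _ lo hi); apply: filterS small => m xm.
set x := a m / m.+1%:R in xm *.
have m0 : m.+1%:R != 0 :> R by rewrite pnatr_eq0.
have aE : a m = m.+1%:R * x by rewrite /x mulrCA mulfV// mulr1.
have x1 : 0 < 1 - x by rewrite subr_gt0.
have e1 : 1 - x <= expR (- x) by rewrite -[1 - x]/(1 + - x) expR_ge1Dx.
have e2 : expR (- (x / (1 - x))) <= 1 - x.
  rewrite expRN invf_ple ?posrE ?expR_gt0//; apply: le_trans (expR_ge1Dx _).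
  by rewrite le_eqVlt; apply/orP; left; apply/eqP; field; rewrite gt_eqF.
rewrite {}aE; move: x x1 e1 e2 {xm} => x x1 e1 e2.
have E (z : R) : expR (- (m.+1%:R * z)) = expR (- z) ^+ m.+1 by rewrite -expRM_natl mulrN.
by rewrite -mulrA !E !lerXn2r ?nnegrE ?expR_ge0 ?(ltW x1).
Qed.

Section density_homogeneous.
Context {R : realType} {n : nat}.
Local Open Scope ereal_scope.

Lemma density_homogeneous (nu : {measure set 'rV[R]_n -> \bar R}) l : density_of nu l ->
  (forall (t : R) x, (0 < t)%R -> l (t *: x)%R = (t ^- n.+1 * l x)%R) -> homogeneous nu.
Proof.
move=> [ml l0 nul] lZ t B t0 mB.
have t00 : t != 0%R by rewrite gt_eqF.
rewrite !nul//; last exact: measurable_scale_image.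
have -> : \int[lebesgue_rV n]_(x in B) (l x)%:E = t%:E *
    ((t ^+ n)%:E * \int[lebesgue_rV n]_(x in B) (l (t *: x))%:E).
  rewrite muleA -EFinM -exprS -ge0_integralZl//; last 3 first.
  - by apply/measurable_EFinP/measurable_funTS; exact: (measurableT_comp ml.1 (measurable_scale t)).
  - by move=> x _; rewrite lee_fin ml.2.
  - by rewrite lee_fin exprn_ge0// ltW.
  by apply: eq_integral => x _; rewrite lZ// -EFinM mulrA mulfV ?mul1r// expf_neq0.
by rewrite integral_scale_image// muleA -EFinM mulVf// mul1e.
Qed.

Lemma density_dominated (nu : {measure set 'rV[R]_n -> \bar R}) l : density_of nu l ->
  nu `<< lebesgue_rV n.
Proof.
move=> [ml l0 nul]; apply/null_content_dominatesP => A mA A0; rewrite nul//.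
apply: null_set_integral => //.
exact: rmge0_measurable.
Qed.

End density_homogeneous.

Section attraction.
Context {R : realType} {d : nat} {dT : measure_display} {T : measurableType dT}
  {P : probability T R}.
Variable X : {RV P >-> 'rV[R]_d}.
Hypothesis X_null : forall j, P [set w | (X w ord0 j <= 0)%R] = 0%E.
Hypothesis X_frechet : forall (u : 'I_d) (x : R), 0 < x ->
     P [set w | X w ord0 u <= x] = (expR (- x^-1))%:E.
Variable lam : 'rV[R]_d -> R.
Hypothesis mlam : rmge0 lam.
Hypothesis lamZ : forall (t : R) x, 0 < t -> lam (t *: x) = t ^- d.+1 * lam x.
Local Notation leb := (@lebesgue_rV R d).
Local Open Scope ereal_scope.
Hypothesis cvg_lam : forall y : 'rV[R]_d, (forall j, 0 < y ord0 j)%R ->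
  m.+1%:R%:E * P [set w | box_compl y (m.+1%:R^-1 *: X w)%R] @[m --> \oo] -->
    \int[leb]_(x in box_compl y) (lam x)%:E /\
  \int[leb]_(x in box_compl y) (lam x)%:E \is a fin_num.

Let lam0 : 'rV[R]_d -> R := lam \_ (punctured d).

Let mlam0 : rmge0 lam0.
Proof.
have mp := @measurable_punctured R d.
exact: rmge0_patchT.
Qed.

Definition limit_measure : {measure set 'rV[R]_d -> \bar R} :=
  density_measure leb (rmge0_mge0 mlam0).1 (rmge0_mge0 mlam0).2.
Local Notation Lambda := limit_measure.

Lemma density_limit : density_of Lambda lam0.
Proof. by split=> // x xp; rewrite /lam0 patchE memNset. Qed.

Lemma limit_box (y : 'rV[R]_d) : (forall j, 0 <= y ord0 j)%R ->
  Lambda (box_compl y) = \int[leb]_(x in box_compl y) (lam x)%:E.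
Proof.
move=> y0; rewrite density_measureE; apply: eq_integral => x /set_mem xy.
by rewrite /lam0 patchE mem_set//; exact: box_compl_punctured xy.
Qed.

Lemma limit_radon : radon_on_punctured Lambda.
Proof.
split; first exact: density_of_punctured density_limit.
move=> B /bounded_awayP[mB oB [e e0 eB]].
(* Half of [e] turns the bound [e <= x_j] into a strict one, which membership in a box complement
   requires. *)
have y0 (j : 'I_d) : (0 < (const_mx (e / 2) : 'rV[R]_d) ord0 j)%R by rewrite mxE divr_gt0.
have [_ f] := cvg_lam y0; rewrite -limit_box in f; last by move=> j; exact: ltW.
apply: (@le_lt_trans _ _ (Lambda (box_compl (const_mx (e / 2)%R)))); last by rewrite ltey_eq f.
apply: le_measure; rewrite ?inE//; first exact: measurable_box_compl.
move=> x Bx; split; first exact: oB.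
have [j ej] := eB _ Bx; move=> /(_ j); rewrite mxE; apply/negP; rewrite -ltNge.
by rewrite (lt_le_trans _ ej)// ltr_pdivrMr// ltr_pMr// ltr1n.
Qed.

Lemma limit_homogeneous : homogeneous Lambda.
Proof.
apply: (density_homogeneous density_limit) => t x t0; rewrite /lam0 !patchE.
have -> : (t *: x \in punctured d) = (x \in punctured d).
  by apply/idP/idP => /set_mem h; apply: mem_set; apply/(puncturedZ t0).
by case: ifP => _; [exact: lamZ | rewrite mulr0].
Qed.

Lemma limit_exponent : exponent_measure Lambda.
Proof. by split; [exact: limit_radon | exact: limit_homogeneous]. Qed.

Let mXle (j : 'I_d) (a : R) : measurable [set w | (X w ord0 j <= a)%R].
Proof. by have := measurable_funP X measurableT _ (measurable_coord_le j a); rewrite setTI. Qed.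

Lemma X_pos_ae : P [set w | exists j, (X w ord0 j <= 0)%R] = 0.
Proof.
apply/eqP; rewrite eq_le measure_ge0 andbT (le_trans (measure_exists_le P (fun j => mXle j 0%R)))//.
by rewrite big1// => j _; exact: X_null.
Qed.

Lemma box_measurable (y : 'rV[R]_d) (k : R) : measurable [set w | box_compl y (k *: X w)%R].
Proof. by apply: measurable_rescaled; exact: measurable_box_compl. Qed.

(* n P(X_j > n) >= 1/2 for Frechet(1) margins. *)
Lemma box_lower (j : 'I_d) (y : 'rV[R]_d) (m : nat) : y ord0 j = 1%R ->
  (1 / 2)%:E <= m.+1%:R%:E * P [set w | box_compl y (m.+1%:R^-1 *: X w)%R].
Proof.
move=> yj; have m0 : (0 < m.+1%:R :> R)%R by [].
have mj := mXle j m.+1%:R.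
have mE : measurable [set w | exists j, (X w ord0 j <= 0)%R].
  by apply: measurable_exists => i; exact: mXle.
have mB := box_measurable y m.+1%:R^-1%R.
have h : P (~` [set w | (X w ord0 j <= m.+1%:R)%R]) <= P [set w | box_compl y (m.+1%:R^-1 *: X w)%R].
  apply: (@le_trans _ _ (P ([set w | box_compl y (m.+1%:R^-1 *: X w)%R] `|` [set w | exists j, (X w ord0 j <= 0)%R]))).
    apply: le_measure; rewrite ?inE; [exact: measurableC | exact: measurableU |].
    move=> w /= /negP; rewrite -ltNge => Xj.
    have [[i Xi]|nX] := pselect (exists j, (X w ord0 j <= 0)%R); first by right; exists i.
    left; split=> [i|/(_ j)].
      rewrite mxE mulr_ge0// leNgt; apply/negP => Xi; apply: nX; exists i; exact: ltW.
    by rewrite mxE yj ler_pdivrMl// mulr1 leNgt Xj.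
  by rewrite (le_trans (measureU2 _ mB mE))// [X in _ + X](_ : _ = 0) ?adde0//; exact: X_pos_ae.
apply: (@le_trans _ _ (m.+1%:R%:E * P (~` [set w | (X w ord0 j <= m.+1%:R)%R]))); last first.
  by rewrite lee_pmul2l ?lte_fin.
rewrite probability_setC// X_frechet// -EFinB -EFinM lee_fin.
have e1 : (expR (- m.+1%:R^-1) <= (1 + m.+1%:R^-1)^-1 :> R)%R.
  by rewrite expRN lef_pV2 ?posrE ?expR_gt0 ?addr_gt0 ?invr_gt0// expR_ge1Dx.
apply: (@le_trans _ _ (m.+1%:R * (1 - (1 + m.+1%:R^-1)^-1))%R); last first.
  by rewrite ler_pM2l// lerB.
have -> : (m.+1%:R * (1 - (1 + m.+1%:R^-1)^-1) = m.+1%:R / (m.+1%:R + 1) :> R)%R.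
  move: (m.+1%:R : R)%R m0 => z z0; field.
  by repeat (apply/andP; split); apply: lt0r_neq0; lra.
rewrite ler_pdivlMr ?addr_gt0// mulrDr mulr1.
have : (1 <= m.+1%:R :> R)%R by rewrite ler1n.
by move: (m.+1%:R : R)%R => z z1; lra.
Qed.

Lemma limit_lower (j : 'I_d) (y : 'rV[R]_d) : (forall j, 0 < y ord0 j)%R -> y ord0 j = 1%R ->
  (1 / 2)%:E <= Lambda (box_compl y).
Proof.
move=> y0 yj; have [h _] := cvg_lam y0; rewrite limit_box; last by move=> i; exact: ltW.
have /cvg_lim <- // := h; apply: lime_ge; first by apply/cvg_ex; eexists; exact: h.
by apply: nearW => m; exact: box_lower yj.
Qed.

Let H (j : 'I_d) (a : R) : set 'rV[R]_d := orthant d `&` [set x | (a < x ord0 j)%R].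

Let mH j a : measurable (H j a).
Proof. by apply: measurableI; [exact: measurable_orthant | exact: measurable_coord_lt]. Qed.

Let bH j a : (0 < a)%R -> Lambda (H j a) < +oo.
Proof.
move=> a0; apply: limit_radon.2; apply/bounded_awayP; split=> //; first by move=> x [].
by exists a => // x [_ /ltW ?]; exists j.
Qed.

Let HZ j (a t : R) : (0 < t)%R -> Lambda (H j (t * a)%R) = t^-1%:E * Lambda (H j a).
Proof.
move=> t0; rewrite -limit_homogeneous//; congr (Lambda _); apply/seteqP; split=> [x [ox xa]|_ [x [ox xa] <-]].
  have t1 : (0 < t^-1)%R by rewrite invr_gt0.
  exists (t^-1 *: x)%R; last by rewrite scalerA mulfV ?scale1r// gt_eqF.
  split; first exact/(orthantZ t1).
  by rewrite /= mxE ltr_pdivlMl.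
by split; [exact/(orthantZ t0) | rewrite /= mxE ltr_pM2l].
Qed.

(* Box complements with y_j = 1 have mass at least 1/2; letting the other y_v tend
   to infinity isolates the half-space x_j > 1. *)
Lemma halfspace_lower (j : 'I_d) : (1 / 4)%:E <= Lambda (H j 1%R).
Proof.
pose c := \sum_(v : 'I_d) Lambda (H v 1%R).
have c0 : 0 <= c by apply: sume_ge0.
have cfin : c \is a fin_num.
  by rewrite ge0_fin_numE//; apply: lte_sum_pinfty => v _; exact: bH.
have fc0 : (0 <= fine c)%R by rewrite fine_ge0.
(* By homogeneity the half-spaces [x_v > M] weigh at most [c / M <= 1 / 4] together, half of the
   lower bound in [limit_lower]. *)
pose M := (4 * fine c + 1)%R.
have M1 : (1 <= M)%R by rewrite lerDr mulr_ge0.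
have M0 : (0 < M)%R by rewrite (lt_le_trans _ M1).
pose y : 'rV[R]_d := (\row_v (if v == j then 1 else M))%R.
have y0 v : (0 < y ord0 v)%R by rewrite mxE; case: ifP.
have yj : y ord0 j = 1%R by rewrite mxE eqxx.
have h := limit_lower y0 yj.
have mex := measurable_exists (fun v => mH v (M * 1)%R).
have h2 : Lambda (box_compl y) <= Lambda (H j 1%R) + (1 / 4)%:E.
  apply: (@le_trans _ _ (Lambda (H j 1%R `|` [set x | exists v, H v (M * 1)%R x]))).
    apply: le_measure; rewrite ?inE; [exact: measurable_box_compl | exact: measurableU |].
    move=> x [ox /existsNP[v /negP]]; rewrite -ltNge mxE; case: eqP => [->|_] xv; first by left.
    by right; exists v; split=> //=; rewrite mulr1.
  rewrite (le_trans (measureU2 _ (mH _ _) mex))// leeD2l//.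
  rewrite (le_trans (measure_exists_le _ (fun v => mH v _)))//.
  under eq_bigr do rewrite HZ//.
  rewrite -ge0_sume_distrr// -/c -(fineK cfin) -EFinM lee_fin.
  rewrite ler_pdivrMl// /M; lra.
have := le_trans h h2; have Hfin : Lambda (H j 1%R) \is a fin_num by rewrite ge0_fin_numE// bH.
by rewrite -(fineK Hfin) -EFinD !lee_fin; lra.
Qed.

(** If [y_j <= 0], the box complement contains the half-space [x_j > 1 / M] for every positive [M],
    whose mass is at least [M / 4] by homogeneity; [M = 4 max(r, 1)] exceeds any prescribed [r]. *)
Lemma limit_infinite (y : 'rV[R]_d) j : (y ord0 j <= 0)%R -> Lambda (box_compl y) = +oo.
Proof.
move=> yj; apply: eq_infty => r; pose M := (4 * Num.max r 1)%R.
have M0 : (0 < M)%R by rewrite mulr_gt0// lt_max ltr01 orbT.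
have rM : (r <= M * (1 / 4))%R.
  by rewrite /M (_ : 4 * _ * _ = Num.max r 1)%R ?le_max ?lexx//; field.
have mHM : Lambda (H j (M^-1 * 1)%R) <= Lambda (box_compl y).
  apply: le_measure; rewrite ?inE//; first exact: measurable_box_compl.
  move=> x [ox /= xj]; split=> // /(_ j) xy; move: xj; rewrite mulr1 ltNge.
  by rewrite (le_trans xy)// (le_trans yj)// invr_ge0 ltW.
apply: (le_trans _ mHM); rewrite HZ ?invr_gt0// invrK.
apply: (@le_trans _ _ (M%:E * (1 / 4)%:E)); first by rewrite -EFinM lee_fin.
by rewrite lee_pmul2l ?lte_fin//; exact: halfspace_lower.
Qed.

Hypothesis X_ge0 : P (X @^-1` ~` orthant d) = 0.

Let mrV_le (y : 'rV[R]_d) : measurable [set w | rV_le (X w) y].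
Proof.
have := measurable_funP X measurableT _ (measurable_rV_le y); rewrite setTI; exact.
Qed.

(** [X] lies in the orthant only almost surely, whereas box complements are subsets of it, so events
    are compared on the orthant. *)
Lemma prob_eq_orthant (E F : set T) : measurable E -> measurable F ->
  (forall w, orthant d (X w) -> E w <-> F w) -> P E = P F.
Proof.
have mN : measurable (X @^-1` ~` orthant d).
  by apply: measurable_funPTI; apply: measurableC; exact: measurable_orthant.
have le (A B : set T) : measurable A -> measurable B ->
    (forall w, orthant d (X w) -> A w -> B w) -> P A <= P B.
  move=> mA mB AB; rewrite -[leRHS]adde0 -[X in _ + X]X_ge0.
  apply: (le_trans _ (measureU2 _ mB mN)); apply: le_measure; rewrite ?inE//.
    exact: measurableU.
  by move=> w Aw; have [ow|ow] := pselect (orthant d (X w)); [left; exact: AB | right].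
move=> mE mF EF; apply/eqP; rewrite eq_le; apply/andP.
by split; apply: le => // w ow /(EF _ ow).
Qed.

Lemma prob_le_box (k : R) (y : 'rV[R]_d) : (0 < k)%R ->
  P [set w | rV_le (X w) (k *: y)%R] = 1 - P [set w | box_compl y (k^-1 *: X w)%R].
Proof.
move=> k0; have k1 : (0 < k^-1)%R by rewrite invr_gt0.
have mB := box_measurable y k^-1%R; rewrite -probability_setC//.
have xE w : rV_le (X w) (k *: y)%R <-> rV_le (k^-1 *: X w)%R y.
  by split=> h j; have := h j; rewrite !mxE ler_pdivrMl.
apply: prob_eq_orthant => [||w ow]; [exact: mrV_le | exact: measurableC |].
split=> [/xE wy [_]//|wy]; apply/xE; apply: contrapT => nwy; apply: wy.
by split=> //; exact/(orthantZ k1).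
Qed.

(** Independence turns the distribution function of the maximum into [(1 - a / m) ^+ m], where [a]
    is [m] times the probability that [X / m] lies in the box complement, and [a] converges to the
    exponent function. *)
Lemma max_stable : attracted_max_stable X Lambda.
Proof.
move=> d' T' P' Y [Ylaw Yind] y yp _.
rewrite -(cvg_shiftS (fun m => P' [set w | rV_le (componentwise_max Y m w) (m%:R *: y)%R])).
pose p m := fine (P [set w | rV_le (X w) (m.+1%:R *: y)%R]).
have pE m : P' [set w | rV_le (componentwise_max Y m.+1 w) (m.+1%:R *: y)%R] = (p m ^+ m.+1)%:E.
  pose B := [set x | rV_le x (m.+1%:R *: y)%R].
  have mB : measurable B by exact: measurable_rV_le.
  have [s us [ss ms]] : exists2 s : seq nat, uniq s & size s = m.+1 /\ s =i gtn m.+1.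
    by exists (iota 0 m.+1); [exact: iota_uniq | rewrite size_iota; split=> // k; rewrite mem_iota].
  have -> : [set w | rV_le (componentwise_max Y m.+1 w) (m.+1%:R *: y)%R] =
      \bigcap_(k in [set` s]) (Y k @^-1` B).
    apply/seteqP; split=> w /= h.
      move=> k /=; rewrite ms => /= km j; apply: le_trans (h j).
      by rewrite mxE; exact: (le_bigmax _ (fun k : 'I_m.+1 => Y k w ord0 j) (Ordinal km)).
    move=> j; rewrite mxE; apply: bigmax_le => [|k _].
      by apply: (h 0%N) => //=; rewrite ms.
    by apply: (h k) => //=; rewrite ms inE ltn_ord.
  rewrite (Yind _ (fun=> B))//.
  rewrite (eq_bigr (fun=> (p m)%:E)) => [|k _]; last first.
    by rewrite Ylaw//; rewrite fineK// fin_num_measure//; exact: mrV_le.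
  rewrite -[in RHS]ss; elim: s {us ss ms} => [|k s ih]; first by rewrite big_nil.
  by rewrite big_cons ih -EFinM /= exprS.
rewrite [X in X @ _](_ : _ = fun m => (p m ^+ m.+1)%:E); last by apply/funext => m; exact: pE.
(* If some [y_j] is zero, the limit is [exp(- oo) = 0], and the probabilities vanish too because
   [X_j > 0] almost surely. *)
have [y0|/existsNP[j /negP]] := pselect (forall j, 0 < y ord0 j)%R; last first.
  rewrite -leNgt => yj; rewrite /exponent_fun (limit_infinite yj) /=.
  rewrite (_ : (fun m => _) = cst 0); first exact: cvg_cst.
  apply/funext => m; rewrite (_ : p m = 0)%R ?expr0n//.
  rewrite /p (_ : P _ = 0)//; apply: (subset_measure0 _ (mXle j 0%R) _ (X_null j)).
    exact: mrV_le.
  by move=> w /(_ j); rewrite mxE => /= h; rewrite (le_trans h)// mulr_ge0_le0.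
have [h f] := cvg_lam y0; pose L := \int[leb]_(x in box_compl y) (lam x)%:E.
have -> : expeR (- exponent_fun Lambda y) = (expR (- fine L))%:E.
  by rewrite /exponent_fun limit_box ?/L => [|j]; [rewrite -[in LHS](fineK f) | exact: ltW].
apply: cvg_EFin; first exact: nearW.
rewrite -(fineK f) in h; have /fine_cvgP[_ {}h] := h.
apply: cvg_trans (cvg_pow_exp h); apply: near_eq_cvg; apply: nearW => m /=.
congr (_ ^+ _)%R; rewrite /p prob_le_box// fineB//; last exact: fin_num_measure (box_measurable _ _).
rewrite /= fineM//; last exact: fin_num_measure (box_measurable _ _).
by rewrite /= mulrAC mulfV ?mul1r// pnatr_eq0.
Qed.

Let q (z : 'rV[R]_d) (t : R) : R := fine (P [set w | box_compl z (t^-1 *: X w)%R]).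

Let qE z t : P [set w | box_compl z (t^-1 *: X w)%R] = (q z t)%:E.
Proof. by rewrite fineK// fin_num_measure//; exact: box_measurable. Qed.

Let q_nonincreasing z (s t : R) : (0 < s)%R -> (s <= t)%R -> (q z t <= q z s)%R.
Proof.
move=> s0 st; have t0 := lt_le_trans s0 st.
rewrite -lee_fin -!qE; apply: le_measure; rewrite ?inE; [exact: box_measurable | exact: box_measurable |].
have [s1 t1] : (0 < s^-1)%R /\ (0 < t^-1)%R by rewrite !invr_gt0.
move=> w [/(orthantZ t1) ow tz]; split; first exact/(orthantZ s1).
move=> sz; apply: tz => j; apply: le_trans (sz j); rewrite !mxE ler_wpM2r ?ow//.
by rewrite lef_pV2.
Qed.

(* t P(X / t in [0, z]^c) is squeezed between its values at consecutive integers. *)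
Lemma cvg_box_real (z : 'rV[R]_d) : (forall j, 0 < z ord0 j)%R ->
  (t * q z t)%R @[t --> +oo%R] --> fine (Lambda (box_compl z)).
Proof.
move=> z0; have [h f] := cvg_lam z0.
rewrite -limit_box in h f; last by move=> j; exact: ltW.
set l := fine _; pose alpha m := (m.+1%:R * q z m.+1%:R)%R.
have al : alpha m @[m --> \oo] --> l.
  rewrite -(fineK f) in h; have /fine_cvgP[_] := h; apply: cvg_trans; apply: near_eq_cvg.
  by apply: nearW => m; rewrite /= qE.
have inv0 : (m.+1%:R^-1 : R)%R @[m --> \oo] --> (0 : R)%R.
  by apply/gtr0_cvgV0; [exact: nearW | exact: cvg_natSy].
have lo : (n%:R * q z n.+1%:R)%R @[n --> \oo] --> l.
  rewrite -[X in _ --> X]mulr1 -[X in (l * X)%R]subr0.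
  have : (alpha n * (1 - n.+1%:R^-1))%R @[n --> \oo] --> (l * (1 - 0))%R.
    by apply: cvgM => //; apply: cvgB => //; exact: cvg_cst.
  apply: cvg_trans; apply: near_eq_cvg; apply: nearW => n.
  by rewrite /alpha mulrAC mulrBr mulr1 mulfV ?pnatr_eq0// -natr1 addrK.
have hi : (n.+1%:R * q z n%:R)%R @[n --> \oo] --> l.
  suff : (n.+2%:R * q z n.+1%:R)%R @[n --> \oo] --> l.
    by rewrite -(cvg_shiftS (fun n => n.+1%:R * q z n%:R)%R).
  rewrite -[X in _ --> X]mulr1 -[X in (l * X)%R]addr0.
  have : (alpha n * (1 + n.+1%:R^-1))%R @[n --> \oo] --> (l * (1 + 0))%R.
    by apply: cvgM => //; apply: cvgD => //; exact: cvg_cst.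
  apply: cvg_trans; apply: near_eq_cvg; apply: nearW => n.
  by rewrite /alpha mulrAC mulrDr mulr1 mulfV ?pnatr_eq0// natr1.
have tr : Num.truncn (t : R) @[t --> +oo%R] --> \oo.
  move=> A [n0 _ n0A]; suff : \forall t \near +oo%R, A (Num.truncn (t : R)) by [].
  near=> t; apply: n0A => /=.
  have t0 : (0 <= t)%R by near: t; exact: nbhs_pinfty_ge.
  by rewrite truncn_ge_nat//; near: t; exact: nbhs_pinfty_ge.
apply: (squeeze_cvgr _ (cvg_comp _ _ tr lo) (cvg_comp _ _ tr hi)); near=> t => /=.
have t1 : (1 <= t)%R by near: t; exact: nbhs_pinfty_ge.
have t0 : (0 < t)%R := lt_le_trans ltr01 t1.
have /andP[nt tn] := truncn_itv (ltW t0).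
have n0 : (0 < (Num.truncn t)%:R :> R)%R by rewrite ltr0n truncn_gt0.
have q0 x : (0 <= q z x)%R by rewrite fine_ge0.
apply/andP; split; apply: ler_pM => //.
- by apply: q_nonincreasing => //; exact: ltW.
- exact: ltW.
- exact: q_nonincreasing.
Unshelve. all: by end_near. Qed.

(** On the orthant, exceeding [t] in sup norm means that [X / t] lies in the box complement of the
    vector of ones. The joint event is the box complement of [min(y, 1)] with that of [y] removed.
    The factor [t] cancels in the quotient. *)
Lemma pareto : attracted_pareto X Lambda.
Proof.
move=> y yp yfin _; have [j0 _] := punctured_gt0 yp.
pose o : 'rV[R]_d := const_mx 1%R; pose yo := rV_min y o.
(* Finiteness at [min(y, 1)] forces all coordinates of [y] to be positive, by [limit_infinite]. *)
have y0 j : (0 < y ord0 j)%R.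
  rewrite ltNge; apply/negP => yj; move: yfin; rewrite /exponent_fun (@limit_infinite _ j) ?ltxx//.
  by rewrite !mxE ge_min yj.
have o0 j : (0 < o ord0 j)%R by rewrite mxE.
have yo0 j : (0 < yo ord0 j)%R by rewrite !mxE lt_min y0/=.
have L0 : fine (Lambda (box_compl o)) != 0%R.
  have := @limit_lower j0 o o0 (mxE _ _ _ _); have [_ f] := cvg_lam o0.
  rewrite -limit_box in f; last by move=> j; exact: ltW.
  by rewrite -{1}(fineK f) lee_fin => h; rewrite gt_eqF//; apply: lt_le_trans h; lra.
have main : ((t * q yo t - t * q y t) / (t * q o t))%R @[t --> +oo%R] --> pareto_fun Lambda y.
  apply: cvgM; last by apply: cvgV => //; exact: cvg_box_real.
  by apply: cvgB; exact: cvg_box_real.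
apply: cvg_trans main; apply: near_eq_cvg; near=> t.
have t0 : (0 < t)%R by near: t; exact: nbhs_pinfty_gt.
have t1 : (0 < t^-1)%R by rewrite invr_gt0.
have tn0 : t != 0%R by rewrite gt_eqF.
have mnorm : measurable [set w | (t < `|X w|)%R].
  rewrite (_ : [set w | _] = ~` [set w | forall j, (`|X w ord0 j| <= t)%R]).
    apply: measurableC; apply: measurable_forall => j.
    rewrite (_ : (fun w => _) = [set w | (X w ord0 j <= t)%R] `&` X @^-1` [set x | (- t <= x ord0 j)%R]).
      apply: measurableI; first exact: mXle.
      by have := measurable_funP X measurableT _ (measurable_coord_ge j (- t)%R); rewrite setTI.
    apply/seteqP; split=> w /=; first by rewrite ler_norml => /andP[].
    by case=> a b; rewrite ler_norml a b.
  apply/seteqP; split=> w /=; rewrite ltNge; first by move=> /negP h /(rV_norm_leP _ (ltW t0)).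
  by move=> h; apply/negP => /(rV_norm_leP _ (ltW t0)).
have xE w (z : 'rV[R]_d) : rV_le (X w) (t *: z)%R <-> rV_le (t^-1 *: X w)%R z.
  by split=> h j; have := h j; rewrite !mxE ler_pdivrMl.
have nE w : orthant d (X w) -> (t < `|X w|)%R <-> box_compl o (t^-1 *: X w)%R.
  move=> ow; rewrite ltNge; split=> [/negP h|[_ h]].
    split; first exact/(orthantZ t1).
    move=> /xE wo; apply: h; apply/(rV_norm_leP _ (ltW t0)) => j.
    by rewrite ger0_norm ?ow//; have := wo j; rewrite !mxE mulr1.
  apply/negP => /(rV_norm_leP _ (ltW t0)) H'; apply: h; apply/xE => j.
  by rewrite !mxE mulr1 (le_trans (ler_norm _)).
have PB : P [set w | (t < `|X w|)%R] = (q o t)%:E.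
  by rewrite -qE; apply: prob_eq_orthant => //; exact: box_measurable.
have mby := box_measurable y t^-1%R; have mbyo := box_measurable yo t^-1%R.
have PAB : P ([set w | rV_le (X w) (t *: y)%R] `&` [set w | (t < `|X w|)%R]) = (q yo t - q y t)%:E.
  have -> : P ([set w | rV_le (X w) (t *: y)%R] `&` [set w | (t < `|X w|)%R]) =
      P ([set w | box_compl yo (t^-1 *: X w)%R] `\` [set w | box_compl y (t^-1 *: X w)%R]).
    apply: prob_eq_orthant; [exact: measurableI | exact: measurableD |].
    move=> w ow; have ow' : orthant d (t^-1 *: X w)%R by exact/(orthantZ t1).
    split=> [[/xE wy /(nE _ ow)[_ wo]]|[[_ wyo] wy]].
      split; last by case.
      by split=> // wyo; apply: wo => j; have := wyo j; rewrite !mxE le_min => /andP[].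
    have {}wy : rV_le (t^-1 *: X w)%R y by apply: contrapT => h; apply: wy.
    split; first exact/xE.
    apply/(nE _ ow); split=> // wo; apply: wyo => j.
    by have := wy j; have := wo j; rewrite !mxE le_min => -> ->.
  have PI : P ([set w | box_compl yo (t^-1 *: X w)%R] `&` [set w | box_compl y (t^-1 *: X w)%R]) = (q y t)%:E.
    rewrite -qE; congr (P _); apply/seteqP; split=> [w [] //|w [ow wy]]; split=> //.
    by split=> // wyo; apply: wy => j; have := wyo j; rewrite !mxE le_min => /andP[].
  have h : P [set w | box_compl yo (t^-1 *: X w)%R] =
      P ([set w | box_compl yo (t^-1 *: X w)%R] `\` [set w | box_compl y (t^-1 *: X w)%R]) +
      P ([set w | box_compl yo (t^-1 *: X w)%R] `&` [set w | box_compl y (t^-1 *: X w)%R]).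
    by rewrite [LHS](measureDI P mbyo mby).
  by rewrite EFinB -!qE h PI qE -addeA subee// adde0.
rewrite /cond_prob PAB PB /= -mulrBr -mulf_div mulfV// mul1r.
Unshelve. all: by end_near. Qed.

End attraction.

(** * Homogeneity of the clique product, and the conclusion *)

Section clique_products.
Context {R : realType} {d : nat} {N : nat} (C : 'I_N.+1 -> {set 'I_d}).
Variable g : forall A : {set 'I_d}, 'rV[R]_#|A| -> R.
Arguments g : clear implicits.

Lemma clique_productZ (t : R) x : 0 < t ->
  (\sum_i #|C i| = d + \sum_(i < N.+1 | (0 < i)%N) #|separator C i|)%N ->
  (forall (A : {set 'I_d}) (y : 'rV[R]_#|A|), clique_or_separator C A ->
    g A (t *: y) = t ^- #|A|.+1 * g A y) ->
  clique_product C g (t *: x) = t ^- d.+1 * clique_product C g x.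
Proof.
move=> t0 /sum_card_cliquesS C_card gZ; have k0 a : t ^+ a != 0 by rewrite expf_neq0// gt_eqF.
have subZ (A : {set 'I_d}) : clique_or_separator C A ->
    g A (sub_rV A (t *: x)) = t^-1 ^+ #|A|.+1 * g A (sub_rV A x).
  by move=> csA; rewrite exprVn -gZ//; congr (g A _); apply/rowP => j; rewrite !mxE.
rewrite /clique_product (eq_bigr _ (fun i _ => subZ _ (or_introl (ex_intro _ i erefl)))).
rewrite [in X in _ / X](eq_bigr (fun i => t^-1 ^+ #|separator C i|.+1 * g (separator C i) (sub_rV (separator C i) x))) => [|i i0]; last first.
  by apply: subZ; right; exists i.
rewrite !big_split /= !prodrXr C_card exprD invfM !exprVn mulrACA.
by rewrite mulfK// invr_eq0.
Qed.

Lemma clique_productE x : clique_product C g x =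
  g (C ord0) (sub_rV (C ord0) x) * \prod_(i < N.+1 | (0 < i)%N)
    (g (C i) (sub_rV (C i) x) / g (separator C i) (sub_rV (separator C i) x)).
Proof.
rewrite /clique_product (bigD1 ord0)//= -mulrA; congr (_ * _).
rewrite prodf_div; congr (_ / _); apply: eq_bigl => i.
by rewrite -val_eqE /= lt0n.
Qed.

End clique_products.

Theorem proposition1 (R : realType)
  (* the graph, with vertex set 'I_d *)
  (d : nat) (d_gt0 : (0 < d)%N)
  (e : rel 'I_d) (e_sym : symmetric e) (e_irr : irreflexive e)
  (e_connected : connected_graph e) (e_chordal : chordal e)
  (* the maximal cliques C_1 = C ord0, ..., C_(N+1), in running intersection
     order *)
  (N : nat) (C : 'I_N.+1 -> {set 'I_d}) (C_inj : injective C)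
  (C_cliques : forall A, max_clique e A <-> exists i, A = C i)
  (C_rip : running_intersection C)
  (* the random vector, with its marginal densities *)
  (dT : measure_display) (T : measurableType dT) (P : probability T R)
  (X : {RV P >-> 'rV[R]_d})
  (X_frechet : forall (u : 'I_d) (x : R), 0 < x ->
     P [set w | X w ord0 u <= x] = (expR (- x^-1))%:E)
  (fX : 'rV[R]_d -> R) (X_density : has_density P X fX)
  (f : forall A : {set 'I_d}, 'rV[R]_#|A| -> R)
  (XA_density : forall A : {set 'I_d}, (0 < #|A|)%N ->
     has_density P (sub_rV A \o X) (f A))
  (X_markov : pairwise_markov P e X)
  (X_factor : {ae lebesgue_rV d, forall x, orthant d x ->
     fX x = clique_product C f x})
  (* the limit measures on the cliques *)
  (nu : forall i, {measure set 'rV[R]_#|C i| -> \bar R})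
  (X_mrv : forall i, regularly_varying P (sub_rV (C i) \o X) (nu i))
  (nu_face : forall i,
     nu i (punctured #|C i| `\` open_face #|C i|) = 0%E)
  (lam : forall i, 'rV[R]_#|C i| -> R)
  (nu_density : forall i, has_exponent_density (nu i) (lam i))
  (f_cvg : forall i, {ae lebesgue_rV #|C i|, forall x, punctured #|C i| x ->
     n%:R ^+ #|C i|.+1 * f (C i) (n%:R *: x) @[n --> \oo] --> lam i x})
  (* the norms, and the reference measures on their unit spheres *)
  (nrm : forall A : {set 'I_d}, 'rV[R]_#|A| -> R)
  (nrm_norm : forall A : {set 'I_d}, (0 < #|A|)%N -> is_norm (nrm A))
  (sigma : forall A : {set 'I_d}, {measure set 'rV[R]_#|A| -> \bar R})
  (sigma_polar : forall A : {set 'I_d}, (0 < #|A|)%N ->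
     polar_measure (nrm A) (sigma A)) :
  exists (nuA HA : forall A : {set 'I_d}, {measure set 'rV[R]_#|A| -> \bar R})
    (h : forall A : {set 'I_d}, 'rV[R]_#|A| -> R),
  let lamA A := radial_density (nrm A) (h A) in
  let lambda (y : 'rV[R]_d) :=
    lamA (C ord0) (sub_rV (C ord0) y) *
    \prod_(i < N.+1 | (0 < i)%N)
      (lamA (C i) (sub_rV (C i) y) /
       lamA (separator C i) (sub_rV (separator C i) y)) in
  [/\ forall A, clique_or_separator C A ->
        [/\ regularly_varying P (sub_rV A \o X) (nuA A),
            spectral_measure (nrm A) (nuA A) (HA A) &
            spectral_density (nrm A) (sigma A) (HA A) (h A)],
      forall i B, measurable B -> nuA (C i) B = nu i B,
      forall i, {ae lebesgue_rV #|C i|, forall x, punctured #|C i| x ->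
        lam i x = lamA (C i) x} &
      exists Lambda : {measure set 'rV[R]_d -> \bar R},
        [/\ exponent_measure Lambda, attracted_max_stable X Lambda,
            attracted_pareto X Lambda, Lambda `<< lebesgue_rV d &
            has_exponent_density Lambda lambda]].
Proof.
have clique_gt0 i : (0 < #|C i|)%N by rewrite finset.card_gt0; exact: (clique_neq0 d_gt0 C_cliques).
have separator_gt0 (i : 'I_N.+1) : (0 < i)%N -> (0 < #|separator C i|)%N.
  by move=> i0; rewrite finset.card_gt0; exact: (separator_neq0 d_gt0 e_sym e_connected C_cliques).
have cs_gt0 (A : {set 'I_d}) : clique_or_separator C A -> (0 < #|A|)%N.
  by move=> [[i ->]|[i i0 ->]]; [exact: clique_gt0 | exact: separator_gt0].
have X_ge0 := density_ge0_ae X_density.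
have ex (A : {set 'I_d}) : exists p : {measure set 'rV[R]_#|A| -> \bar R} *
    {measure set 'rV[R]_#|A| -> \bar R} * ('rV[R]_#|A| -> R),
    clique_or_separator C A -> spectral_limit X (nrm A) (sigma A) p.1.1 p.1.2 p.2.
  (* For sets that are neither cliques nor separators the conclusion claims nothing, and any
     measures serve as default. *)
  have [csA|ncs] := pselect (clique_or_separator C A); last by exists (sigma A, sigma A, fun=> 0).
  have [i Ai] : exists i, A \subset C i.
    by case: csA => [[i ->]|[i i0 ->]]; exists i; rewrite ?fintype.subxx// subsetIl.
  have A0 := cs_gt0 _ csA.
  have [nuA [HA [h H]]] := spectral_limit_exists X_ge0 Ai A0 (nrm_norm _ A0)
    (sigma_polar _ A0) (X_mrv i) (nu_density i).
  by exists (nuA, HA, h).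
(* The choice is made once per vertex set, so that equal separators receive the same limit measure
   and spectral density. *)
pose p (A : {set 'I_d}) := projT1 (cid (ex A)).
have pP (A : {set 'I_d}) : clique_or_separator C A -> spectral_limit X (nrm A) (sigma A) (p A).1.1 (p A).1.2 (p A).2.
  exact: projT2 (cid (ex A)).
pose nuA (A : {set 'I_d}) := (p A).1.1; pose h (A : {set 'I_d}) := (p A).2.
pose lamA (A : {set 'I_d}) := radial_density (nrm A) (h A).
have csC i : clique_or_separator C (C i) by left; exists i.
have nuE i B : measurable B -> nuA (C i) B = nu i B.
  have [rv _ _ _ dn] := pP _ (csC i).
  apply: (rv_unique rv (density_null_hyperplanes dn) (X_mrv i)).
  exact: density_null_hyperplanes (exponent_density_of (X_mrv i).1 (nu_density i)).
have lamE i : {ae lebesgue_rV #|C i|, forall x, punctured #|C i| x -> lam i x = lamA (C i) x}.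
  have [rv _ _ _ [m0 l0 dn]] := pP _ (csC i).
  have dn' : density_of (nu i) (lamA (C i) \_ (punctured #|C i|)).
    by split=> // B mB; rewrite -nuE//; exact: dn.
  have := density_eq (exponent_density_of (X_mrv i).1 (nu_density i)) dn' (X_mrv i).1.2.
  by apply: filterS => x /[swap] xp; rewrite !patchE mem_set.
exists nuA, (fun A : {set 'I_d} => (p A).1.2), h => lamA' lambda; split=> //.
  by move=> A /pP[].
have lamZ (A : {set 'I_d}) (y : 'rV[R]_#|A|) (t : R) : 0 < t -> clique_or_separator C A ->
    lamA A (t *: y) = t ^- #|A|.+1 * lamA A y.
  by move=> t0 /cs_gt0 A0; exact: radial_densityZ (nrm_norm _ A0) t0.
have C_card := card_cliques_full C_cliques.
have C_full := upto_full C_cliques.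
have g_ge0 (A : {set 'I_d}) : clique_or_separator C A -> rmge0 (lamA A).
  by move=> csA; have [_ _ _ mh _] := pP _ csA; apply: rmge0_radial_density; [exact: (nrm_norm _ (cs_gt0 _ csA))|exact: mh].
have mlam : rmge0 (clique_product C lamA) := rmge0_clique_product g_ge0.
have f_cvg' i : {ae lebesgue_rV #|C i|, forall x, punctured #|C i| x ->
     n%:R ^+ #|C i|.+1 * f (C i) (n%:R *: x) @[n --> \oo] --> lamA (C i) x}.
  by apply: filterS2 (f_cvg i) (lamE i) => x fx lx xp; rewrite -lx//; exact: fx.
have nu_g (A : {set 'I_d}) : clique_or_separator C A -> density_of (nuA A) (lamA A \_ (punctured #|A|)).
  by move=> /pP[].
have X_rv (A : {set 'I_d}) : clique_or_separator C A -> regularly_varying P (sub_rV A \o X) (nuA A).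
  by move=> /pP[].
have corner_cvg eps B : 0 < eps -> measurable B -> _ := fun e0 mB =>
  cvg_corner X_ge0 C_rip clique_gt0 separator_gt0 C_full C_card X_density XA_density X_factor
    nu_g X_rv f_cvg' e0 mB.
have X_tight u v : tight X u v.
  apply: (tight_connected (e := e)) (e_connected u v) => a b ab.
  have [i [ai bi]] := edge_in_clique e_sym C_cliques ab.
  exact: (tight_clique X_ge0 (X_rv _ (csC i)) (density_null_hyperplanes (nu_g _ (csC i))) ai bi).
have cvg_lam := cvg_box mlam corner_cvg X_tight.
(* Within the orthant, [x_j <= 0] is a hyperplane, which is Lebesgue-null, so a vector with a
   density does not charge it. *)
have X_null j : P [set w | X w ord0 j <= 0] = 0%E.
  have [X_fX _ XfX] := X_density; have mj : measurable [set x : 'rV[R]_d | x ord0 j <= 0] := measurable_coord_le j 0.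
  apply: (etrans (XfX _ mj)).
  have mH := measurable_hyperplane (n := d) j (0 : R).
  have mo := @measurable_orthant R d.
  have mB : measurable ([set x : 'rV[R]_d | x ord0 j <= 0] `&` orthant d).
    by apply: measurableI => //; exact: measurable_coord_le.
  apply: null_set_integral => //.
    by apply/measurable_EFinP; apply: (measurable_funS mo _ X_fX) => x [].
  apply: (subset_measure0 mB mH) (lebesgue_hyperplane j 0) => x [xj ox].
  by apply/eqP; rewrite eq_le xj ox.
have lambdaZ (t : R) x : 0 < t -> clique_product C lamA (t *: x) = t ^- d.+1 * clique_product C lamA x.
  by move=> t0; apply: clique_productZ => // A y; exact: lamZ.
exists (limit_measure mlam); split.
- exact: (limit_exponent mlam lambdaZ cvg_lam).
- exact: max_stable.
- exact: pareto.
- exact: density_dominated (density_limit mlam).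
have lambdaE : lambda = clique_product C lamA.
  by apply/funext => y; rewrite clique_productE.
rewrite lambdaE; split.
- exact: measurable_funTS mlam.1.
- by move=> x _; exact: mlam.2.
move=> y [oy _]; exact: limit_box.
Qed.
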